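(* Let $X$ be a Hausdorff topological space. The following properties are equivalent: (i) there is an AF $C^*$-algebra $A$ such that $X$ is homeomorphic to $\mathrm{Glimm}(A)$; (ii) there is a separable $C^*$-algebra $A$ such that $X$ is homeomorphic to $\mathrm{Glimm}(A)$; (iii) $X$ is homeomorphic to a (topological) quotient of a locally compact Hausdorff second countable space; (iv) $X = \bigcup_{n=1}^{\infty} X_n$, where $\{X_n\}_{n=1}^{\infty}$ is an increasing sequence of compact metrizable subspaces of $X$ such that a subset $F$ of $X$ is closed if and only if $F\cap X_n$ is closed for each $n$.
   Context: An AF $C^*$-algebra is a $C^*$-algebra (not necessarily unital) that is the closure of the union of an increasing sequence of finite dimensional $C^*$-subalgebras; in particular it is separable. For a $C^*$-algebra $A$ (not necessarily unital), $\mathrm{Prim}(A)$ denotes the primitive ideal space of $A$ with the hull-kernel topology, and $C^b(\mathrm{Prim}(A))$ the algebra of continuous bounded complex-valued functions on it. The Glimm space $\mathrm{Glimm}(A)$ is the complete regularization of $\mathrm{Prim}(A)$: it is the set of equivalence classes of $\mathrm{Prim}(A)$ under the relation $P\sim Q$ iff $f(P)=f(Q)$ for all $f\in C^b(\mathrm{Prim}(A))$, endowed with the weakest topology for which all elements of $C^b(\mathrm{Prim}(A))$, regarded as functions on $\mathrm{Glimm}(A)$, are continuous. (It is a completely regular Hausdorff space, and the natural map $\phi_A:\mathrm{Prim}(A)\to\mathrm{Glimm}(A)$ has the universal property that any continuous map of $\mathrm{Prim}(A)$ into a completely regular Hausdorff space factors uniquely through $\phi_A$.) In (iii), ''quotient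 of $Z$'' means the image of $Z$ under a quotient map, i.e. a surjection $q:Z\to X$ such that $U\subseteq X$ is open if and only if $q^{-1}(U)$ is open in $Z$. *)

(* Defs.v *)
From HB Require Import structures.
From mathcomp Require Import all_boot all_order all_algebra.
From mathcomp Require Import all_classical all_reals all_analysis.
From mathcomp Require Import complex.

Set Implicit Arguments.
Unset Strict Implicit.
Unset Printing Implicit Defensive.

Import Order.TTheory GRing.Theory Num.Theory.
Import numFieldNormedType.Exports.

Local Open Scope classical_set_scope.
Local Open Scope ring_scope.

(* Products are carried by a dedicated operation because the ring structures
   of the library all have a unit. The norm takes its values in the complex
   numbers, whose order is the partial order extending that of the reals. *)
HB.mixin Record isCStarAlgebra (R : realType) A
    & CompleteNormedModule R[i] A := {
  cmul : A -> A -> A ;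
  star : A -> A ;
  cmulA : associative cmul ;
  cmulDl : left_distributive cmul +%R ;
  cmulDr : right_distributive cmul +%R ;
  cmulZl : forall (k : R[i]) (x y : A), cmul (k *: x) y = k *: cmul x y ;
  cmulZr : forall (k : R[i]) (x y : A), cmul x (k *: y) = k *: cmul x y ;
  starK : involutive star ;
  starD : {morph star : x y / x + y} ;
  starZ : forall (k : R[i]) (x : A), star (k *: x) = Num.conj k *: star x ;
  starM : forall x y : A, star (cmul x y) = cmul (star y) (star x) ;
  norm_cmul : forall x y : A, `|cmul x y| <= `|x| * `|y| ;
  norm_cstar : forall x : A, `|cmul (star x) x| = `|x| ^+ 2
}.

#[short(type="cstarAlgType")]
HB.structure Definition CStarAlgebra (R : realType) :=
  {A of CompleteNormedModule R[i] A & isCStarAlgebra R A}.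

HB.mixin Record isHilbert (R : realType) H & CompleteNormedModule R[i] H := {
  inner : H -> H -> R[i] ;
  inner_linearl : forall (k : R[i]) (x y z : H),
    inner (k *: x + y) z = k * inner x z + inner y z ;
  inner_conj : forall x y : H, inner y x = Num.conj (inner x y) ;
  norm_inner : forall x : H, `|x| ^+ 2 = inner x x
}.

#[short(type="hilbertType")]
HB.structure Definition Hilbert (R : realType) :=
  {H of CompleteNormedModule R[i] H & isHilbert R H}.

Definition is_subspace (R : realType) (V : completeNormedModType R[i])
    (M : set V) : Prop :=
  M 0 /\ forall (k : R[i]) (x y : V), M x -> M y -> M (k *: x + y).

Section Representations.
Context (R : realType) (A : cstarAlgType R).

Record star_representation (H : hilbertType R) (pi : A -> H -> H) : Prop := {
  rep_op_linear : forall (a : A) (k : R[i]) (x y : H),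
    pi a (k *: x + y) = k *: pi a x + pi a y ;
  rep_op_continuous : forall a : A, continuous (pi a) ;
  rep_linear : forall (k : R[i]) (a b : A) (x : H),
    pi (k *: a + b) x = k *: pi a x + pi b x ;
  rep_mul : forall (a b : A) (x : H), pi (cmul a b) x = pi a (pi b x) ;
  rep_star : forall (a : A) (x y : H),
    inner (pi a x) y = inner x (pi (star a) y)
}.

Definition irreducible (H : hilbertType R) (pi : A -> H -> H) : Prop :=
  (exists a x, pi a x != 0) /\
  forall M : set H, is_subspace M -> closed M ->
    (forall a x, M x -> M (pi a x)) -> M = [set 0] \/ M = setT.

Definition rep_ker (H : hilbertType R) (pi : A -> H -> H) : set A :=
  [set a | forall x, pi a x = 0].

Definition primitive_ideal (P : set A) : Prop :=
  exists (H : hilbertType R) (pi : A -> H -> H),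
    [/\ star_representation pi, irreducible pi & P = rep_ker pi].

Lemma primitive_idealM (P : set A) : primitive_ideal P ->
  forall a b, P a -> P (cmul a b) /\ P (cmul b a).
Proof.
move=> [H [pi [pir _ ->]]] a b Pa; split=> x; rewrite (rep_mul pir) ?Pa//.
have := rep_op_linear pir b (-1) 0 0.
by rewrite scaler0 addr0 scaleN1r addNr.
Qed.

Lemma primitive_ideal_proper (P : set A) : primitive_ideal P -> P != setT.
Proof.
move=> [H [pi [_ [[a [x /negP pax]] _] ->]]]; apply/negP => /eqP PT.
have : rep_ker pi a by rewrite PT.
by move=> /(_ x) /eqP.
Qed.

Lemma primitive_ideal_prime (P I J : set A) : primitive_ideal P ->
  (forall a b, I a -> I (cmul a b)) ->
  (forall a b, I a -> J b -> P (cmul a b)) -> I `<=` P \/ J `<=` P.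
Proof.
move=> [H [pi [pir [_ irr] ->]]] Ir IJ.
have pi0 a : pi a 0 = 0.
  have := rep_op_linear pir a (-1) 0 0.
  by rewrite scaler0 addr0 scaleN1r addNr.
pose M : set H := [set x | forall a, I a -> pi a x = 0].
have [|||M0|MT] := irr M.
- split=> [a _|k x y Mx My a Ia]; first exact: pi0.
  by rewrite (rep_op_linear pir) Mx// My// scaler0 addr0.
- have -> : M = \bigcap_(a in I) (pi a @^-1` [set 0]).
    by apply/seteqP; split=> x Mx a Ia; exact: Mx.
  apply: closed_bigI => a _; apply: closed_comp.
    by move=> x _; exact: rep_op_continuous pir a x.
  exact/accessible_closed_set1/hausdorff_accessible/norm_hausdorff.
- by move=> b x Mx a Ia; rewrite -(rep_mul pir); apply: Mx; exact: Ir.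
- right=> b Jb x; have : M (pi b x).
    by move=> a Ia; rewrite -(rep_mul pir); exact: IJ.
  by rewrite M0.
- by left=> a Ia x; have : M x by [rewrite MT|]; exact.
Qed.

Definition Prim : Type := set_type [set P : set A | primitive_ideal P].

HB.instance Definition _ := Choice.on Prim.

Definition ideal_of (P : Prim) : set A := set_val P.

Lemma ideal_ofP (P : Prim) : primitive_ideal (ideal_of P).
Proof. by rewrite /ideal_of set_valE; exact: set_mem (valP P). Qed.

Definition hull (I : set A) : set Prim := [set P | I `<=` ideal_of P].

Definition kernel (S : set Prim) : set A := \bigcap_(P in S) ideal_of P.

(* The hull-kernel closure of S is hull (kernel S). *)
Definition hk_open (U : set Prim) : Prop := hull (kernel (~` U)) `<=` ~` U.

Fact hk_openT : hk_open setT.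
Proof.
rewrite /hk_open setCT => P; rewrite /hull /kernel bigcap_set0 /= => TP.
by have /eqP := primitive_ideal_proper (ideal_ofP P); apply; apply/seteqP.
Qed.

Fact kernelM (S : set Prim) a b : kernel S a -> kernel S (cmul a b).
Proof.
by move=> Sa P SP; have [] := primitive_idealM (ideal_ofP P) b (Sa P SP).
Qed.

Fact hk_openI : setI_closed hk_open.
Proof.
move=> U V oU oV; rewrite /hk_open setCI => P PUV.
have [||UP|VP] := @primitive_ideal_prime (ideal_of P) (kernel (~` U))
  (kernel (~` V)) (ideal_ofP P).
- by move=> a b; exact: kernelM.
- move=> a b Ua Vb; apply: PUV => Q [UQ|VQ].
    by have [] := primitive_idealM (ideal_ofP Q) b (Ua Q UQ).
  by have [] := primitive_idealM (ideal_ofP Q) a (Vb Q VQ).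
- by left; exact: oU.
- by right; exact: oV.
Qed.

Fact hk_open_bigU (I : Type) (f : I -> set Prim) :
  (forall i, hk_open (f i)) -> hk_open (\bigcup_i f i).
Proof.
move=> of_ P Pf [i _ fiP]; apply: (of_ i P) fiP => a fa; apply: Pf => Q fQ.
by apply: fa => fiQ; apply: fQ; exists i.
Qed.

HB.instance Definition _ :=
  isOpenTopological.Build Prim hk_openT hk_openI hk_open_bigU.

End Representations.

Section Glimm.
Context (R : realType) (A : cstarAlgType R).

Definition Cb : set (Prim A -> R[i]^o) :=
  [set f | continuous f /\ bounded_fun f].

Definition glimm_rel (P Q : Prim A) : bool := `[< forall f, Cb f -> f P = f Q >].

Fact glimm_rel_refl : reflexive glimm_rel.
Proof. by move=> P; apply/asboolP. Qed.

Fact glimm_rel_sym : symmetric glimm_rel.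
Proof. by move=> P Q; apply/asboolP/asboolP => PQ f /PQ. Qed.

Fact glimm_rel_trans : transitive glimm_rel.
Proof.
move=> Q P S /asboolP PQ /asboolP QS; apply/asboolP => f Cf.
by rewrite PQ// QS.
Qed.

Canonical glimm_equiv :=
  EquivRel glimm_rel glimm_rel_refl glimm_rel_sym glimm_rel_trans.

Definition glimm_quot : Type := {eq_quot glimm_equiv}%qT.

HB.instance Definition _ := Choice.on glimm_quot.

(* [repr] selects a representative of a class; the value below does not depend
   on the choice when f is in Cb. *)
Definition glimm_fun (f : Prim A -> R[i]^o) (x : glimm_quot) : R[i]^o :=
  f (repr (x : {eq_quot glimm_equiv}%qT)).

Lemma glimm_funE (f : Prim A -> R[i]^o) (P : Prim A) : Cb f ->
  glimm_fun f (\pi_({eq_quot glimm_equiv})%qT P) = f P.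
Proof.
move=> Cf; rewrite /glimm_fun.
suff /asboolP/(_ f Cf) : glimm_rel (repr (\pi_({eq_quot glimm_equiv})%qT P)) P.
  by [].
by apply/eqmodP; rewrite reprK.
Qed.

Definition Glimm : topologicalType :=
  sup_topology (fun f : Cb =>
    Topological.class (initial_topology (glimm_fun (set_val f)))).

End Glimm.

Section AF.
Context (R : realType) (A : cstarAlgType R).

Definition cstar_separable : Prop := exists D : set A, countable D /\ dense D.

Definition cstar_subalgebra (B : set A) : Prop :=
  [/\ is_subspace B, forall x y, B x -> B y -> B (cmul x y),
      forall x, B x -> B (star x) & closed B].

Definition finite_dimensional (B : set A) : Prop :=
  exists (n : nat) (e : 'I_n -> A),
    B = [set x | exists c : 'I_n -> R[i], x = \sum_(i < n) c i *: e i].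

Definition is_AF : Prop := exists B : nat -> set A,
  [/\ forall n, cstar_subalgebra (B n) /\ finite_dimensional (B n),
      forall n, B n `<=` B n.+1 & closure (\bigcup_n B n) = setT].

End AF.

Definition homeomorphic (X Y : topologicalType) : Prop :=
  exists (f : X -> Y) (g : Y -> X),
    [/\ cancel f g, cancel g f, continuous f & continuous g].

Definition quotient_map (Z Y : topologicalType) (q : Z -> Y) : Prop :=
  (forall y, exists z, q z = y) /\
  forall U : set Y, open U <-> open (q @^-1` U).

Definition metrizable (R : realType) (X : topologicalType) : Prop :=
  exists M : metricType R, homeomorphic X M.

(* Main.v *)
Require Import Defs.
From HB Require Import structures.
From mathcomp Require Import all_boot all_order all_algebra.
From mathcomp Require Import all_classical all_reals all_analysis.
From mathcomp Require Import complex.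
From mathcomp Require Import ring lra.

(**
  (ii) => (iv).  For d in A and eps > 0 the set of P with |pi_P(d)| >= eps is
  compact and the set of P with |pi_P(d)| > eps is open.  For compactness, a filter F
  on Prim A gives the sublinear functional q(x) = inf_S sup_(P in S) Re <pi_P(x) v, v>
  (S in F, |v| = 1) on the unitization, and the GNS representation of an extreme
  linear functional below q, attaining q at d* d, is irreducible with kernel a cluster
  point of F.  Openness is functional calculus for d* d in the multiplier algebra,
  i.e. the adjointable operators on A.  When A is separable, countably many d and eps
  suffice, so the quotient of Prim A by the Glimm relation is k_omega; once Hausdorff
  it is normal, so its topology is the weak topology defining Glimm A.  Compact
  Hausdorff spaces with a countable network are metrizable, whence (iv).  The same
  argument with a locally compact second countable space in place of Prim A gives
  (iii) => (iv).

  (iv) => (iii), (i).  X is a quotient q : Z -> X of a countable sum Z of Cantor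
  spaces.  Choose pairs (z_k, w_k) dense in {(x, y) | q x = q y}.  On the Hilbert space
  with one basis vector over each point of Z and infinitely many over z_k and over w_k
  for each k, let A be generated by the projections onto the basis vectors over a
  cylinder of Z, and, for each k, by the matrix units among the vectors over z_k and
  w_k.  Then A is AF, and a primitive ideal containing all matrix units is the kernel of
  evaluation at a point of Z, while any other is, for some k, the annihilator of the
  vectors over z_k and w_k; the latter is contained in the kernels of evaluation at z_k
  and at w_k.  Hence the continuous functions on Prim A are those on Z that agree at
  z_k and w_k for all k, i.e. those on X.
*)

Set Implicit Arguments.
Unset Strict Implicit.
Unset Printing Implicit Defensive.

Import Order.TTheory GRing.Theory Num.Theory.
Import numFieldNormedType.Exports.

Local Open Scope classical_set_scope.
Local Open Scope ring_scope.
Local Open Scope complex_scope.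

(** * Real-valued norms and completions *)

(** Separability enters the compactness argument a second time: an extreme functional is built by
    maximising successively along a dense sequence, and putting [star d d] first in this sequence
    makes the functional attain [q] there. The three properties of the functional have separate
    uses. Extremality makes the representation irreducible; being below [q] puts its kernel in the
    closure of every member of the filter; the value at [star d d] keeps the norm of [d] from
    dropping in the limit, and keeps the representation from being zero. A primitive ideal does not
    determine a representation, so bounds on [pi d] are encoded as membership of one element in the
    kernel.

    In the converse direction the infinite multiplicity is essential: an element of a finite stage
    acts on all but finitely many vectors over [z k] or [w k] by its value at that point. This
    places the block ideal below both evaluation ideals, so that no continuous function into a
    Hausdorff space tells the two points apart. Countably many pairs keep the algebra separable, and
    their density is enough because the functions are continuous. *)

Section RealNorm.
Context (R : realType).

(** Norms over [R[i]] take values in [R[i]], where the order is only partial; the real part turns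
    norm estimates into statements about [R], within reach of suprema, infima and [lra]. *)
Definition nr (V : normedZmodType (R[i] : numDomainType)) (x : V) : R := complex.Re `|x|.

Section Zmod.
Context (V : normedZmodType (R[i] : numDomainType)).
Implicit Types x y z : V.

Lemma nrE x : `|x| = (nr x)%:C.
Proof. by rewrite /nr RRe_real. Qed.

Lemma nr_ge0 x : 0 <= nr x.
Proof. by rewrite -ler0c -nrE. Qed.

Lemma nr0 : nr (0 : V) = 0.
Proof. by rewrite /nr normr0. Qed.

Lemma nr_eq0 x : nr x = 0 -> x = 0.
Proof. by move=> x0; apply/normr0_eq0; rewrite nrE x0. Qed.

Lemma nr_le0 x : nr x <= 0 -> x = 0.
Proof. by move=> x0; apply/nr_eq0/eqP; rewrite eq_le x0 nr_ge0. Qed.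

Lemma nrD x y : nr (x + y) <= nr x + nr y.
Proof. by rewrite -lecR rmorphD/= -!nrE ler_normD. Qed.

Lemma nrN x : nr (- x) = nr x.
Proof. by rewrite /nr normrN. Qed.

Lemma nrC x y : nr (x - y) = nr (y - x).
Proof. by rewrite -nrN opprB. Qed.

Lemma nrB x y : nr (x - y) <= nr x + nr y.
Proof. by rewrite -(nrN y) nrD. Qed.

Lemma nr_tri y x z : nr (x - z) <= nr (x - y) + nr (y - z).
Proof. by rewrite -[x - z](subrKA y) nrD. Qed.

Lemma nr_sub x y : nr x - nr y <= nr (x - y).
Proof. by rewrite lerBlDr (le_trans _ (nrD _ _))// subrK. Qed.

Lemma nr_eq x y : (forall e : R, 0 < e -> nr (x - y) <= e) -> x = y.
Proof.
move=> xy; apply/eqP; rewrite -subr_eq0; apply/eqP/nr_le0.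
by apply/ler_addgt0Pl => e e0; rewrite addr0 xy.
Qed.

End Zmod.

Lemma nr_real (r : R) : nr (r%:C : R[i]) = `|r|.
Proof. by rewrite /nr normc_def/= expr0n/= addr0 sqrtr_sqr. Qed.

Lemma nrcM (a b : R[i]) : nr (a * b) = nr a * nr b.
Proof. by apply/complexI; rewrite -nrE normrM !nrE -rmorphM. Qed.

Lemma nr_conj (a : R[i]) : nr (a^*)%C = nr a.
Proof. by rewrite /nr normcJ. Qed.

Lemma nr_Re (a : R[i]) : `|complex.Re a| <= nr a.
Proof. by rewrite -lecR -nrE normc_ge_Re. Qed.

Lemma nr_Im (a : R[i]) : `|complex.Im a| <= nr a.
Proof.
by rewrite -normrN -ReiNIm (le_trans (nr_Re _))// nrcM /nr normc_def/=
  expr0n expr1n/= add0r sqrtr1 mulr1.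
Qed.

Lemma nr_ReIm (a : R[i]) : nr a <= `|complex.Re a| + `|complex.Im a|.
Proof.
rewrite {1}[a]complexE (le_trans (nrD _ _))// nrcM !nr_real lerD2l.
by rewrite /nr normc_def/= expr0n expr1n/= add0r sqrtr1 mul1r.
Qed.

Lemma nrc1 : nr (1 : R[i]) = 1.
Proof. by rewrite -[1]/(1%:C) nr_real normr1. Qed.

Lemma nr_sq (a : R[i]) : a * a^*%C = ((nr a) ^+ 2)%:C.
Proof. by rewrite -sqr_normc nrE rmorphXn. Qed.

Section Mod.
Context (V : normedModType R[i]).
Implicit Types x y z : V.

Lemma nrZ (k : R[i]) x : nr (k *: x) = nr k * nr x.
Proof. by apply/complexI; rewrite -nrE normrZ !nrE -rmorphM. Qed.

Lemma nrZr (r : R) x : nr (r%:C *: x) = `|r| * nr x.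
Proof. by rewrite nrZ nr_real. Qed.

Lemma nbhs_nr x (A : set V) :
  nbhs x A <-> exists2 e : R, 0 < e & forall y, nr (x - y) <= e -> A y.
Proof.
split=> [/nbhs_ballP[e/= e0 xA]|[e e0 xA]].
  have er : e = (complex.Re e)%:C by rewrite RRe_real// gtr0_real.
  have re0 : 0 < complex.Re e by rewrite -ltcR -er.
  exists (complex.Re e / 2) => [|y xy]; first by rewrite divr_gt0.
  apply: xA; rewrite -ball_normE /ball_/= nrE er ltcR (le_lt_trans xy)//.
  by rewrite ltr_pdivrMr// ltr_pMr// ltr1n.
apply/nbhs_ballP; exists e%:C => /=; first by rewrite ltcR.
by move=> y; rewrite -ball_normE /ball_/= nrE ltcR => /ltW/xA.
Qed.

Lemma closed_nr (M : set V) : closed M <->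
  forall x, (forall e : R, 0 < e -> exists2 y, M y & nr (x - y) <= e) -> M x.
Proof.
split=> [cM x Mx|cM x Mx].
  apply: cM => B /nbhs_nr[e e0 eB].
  by have [y My /eB] := Mx e e0; exists y.
apply: cM => e e0.
have [|y [My]] := Mx [set y | nr (x - y) <= e]; first by apply/nbhs_nr; exists e.
by exists y.
Qed.

Lemma closure_nr (M : set V) x : closure M x <->
  forall e : R, 0 < e -> exists2 y, M y & nr (x - y) <= e.
Proof.
split=> [cM e e0|cM B /nbhs_nr[e e0 eB]].
  have [|y [My]] := cM [set y | nr (x - y) <= e]; first by apply/nbhs_nr; exists e.
  by exists y.
by have [y My /eB] := cM e e0; exists y.
Qed.

End Mod.

Lemma continuous_nr (V W : normedModType R[i]) (f : V -> W) (C : R) :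
  (forall x y, nr (f x - f y) <= C * nr (x - y)) -> continuous f.
Proof.
move=> fC x A /nbhs_nr[e e0 eA].
change (nbhs x (f @^-1` A)); apply/nbhs_nr; exists (e / (`|C| + 1)) => [|y xy].
  by rewrite divr_gt0// ltr_wpDl.
apply: eA; rewrite (le_trans (fC _ _))//.
rewrite (@le_trans _ _ ((`|C| + 1) * nr (x - y)))//.
  by rewrite ler_wpM2r ?nr_ge0// ler_wpDr// ler_norm.
by rewrite mulrC -ler_pdivlMr// ltr_wpDl.
Qed.

Definition cvgs (V : normedZmodType (R[i] : numDomainType)) (u : nat -> V) (l : V) :=
  forall e : R, 0 < e -> exists N, forall n, (N <= n)%N -> nr (u n - l) <= e.

Lemma seq_complete (V : completeNormedModType R[i]) (u : nat -> V) :
  (forall e : R, 0 < e -> exists N, forall m n, (N <= m)%N -> (N <= n)%N ->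
     nr (u m - u n) <= e) ->
  exists l, cvgs u l.
Proof.
move=> cu.
have /cauchy_cvg : cauchy (u @ \oo).
  apply/cauchy_ballP => e e0.
  have er : e = (complex.Re e)%:C by rewrite RRe_real// gtr0_real.
  have re0 : 0 < complex.Re e / 2 by rewrite divr_gt0// -ltcR -er.
  have [N uN] := cu _ re0.
  exists ([set x | exists2 n, (N <= n)%N & x = u n],
          [set x | exists2 n, (N <= n)%N & x = u n]) => /=.
    by split; exists N => // n /= Nn; exists n.
  move=> [x y]/= [[n Nn ->] [m Nm ->]].
  rewrite -ball_normE /ball_/= nrE er ltcR (le_lt_trans (uN _ _ Nn Nm))//.
  by rewrite ltr_pdivrMr// ltr_pMr ?ltr1n// -ltcR -er.
move=> /cvg_ex[l ul]; exists l => e e0.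
have /ul[N _ Nu] : nbhs l [set y | nr (l - y) <= e] by apply/nbhs_nr; exists e.
by exists N => n /Nu/=; rewrite nrC.
Qed.

Lemma complex_complete (F : set_system R[i]^o) :
  ProperFilter F -> cauchy F -> cvg F.
Proof.
move=> FF /cauchy_ballP cF.
have cf (f : R[i]^o -> R^o) : (forall x y, `|f x - f y| <= nr (x - y)) ->
    cvg (f @ F).
  move=> f1; apply: R_complete; apply/cauchy_ballP => e e0.
  have [|[A B]/= [FA FB] AB] := cF e%:C; first by rewrite ltcR.
  exists (f @` A, f @` B) => /=.
    by split; [apply: filterS FA|apply: filterS FB] => x; exists x.
  move=> [_ _]/= [[x Ax <-] [y By <-]].
  have := AB (x, y) (conj Ax By); rewrite -!ball_normE /ball_/= nrE ltcR.
  exact: le_lt_trans.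
have /cvg_ex[a /cvgrPdist_le Fa] : cvg ((fun x => complex.Re x : R^o) @ F).
  by apply: cf => x y; rewrite -[_ - _]/(complex.Re x - complex.Re y) -raddfB nr_Re.
have /cvg_ex[b /cvgrPdist_le Fb] : cvg ((fun x => complex.Im x : R^o) @ F).
  by apply: cf => x y; rewrite -[_ - _]/(complex.Im x - complex.Im y) -raddfB nr_Im.
apply/cvg_ex; exists (a +i* b : R[i]^o) => A /nbhs_nr[e e0 eA].
have e20 : 0 < e / 2 by rewrite divr_gt0.
apply: filterS2 (Fa _ e20) (Fb _ e20) => x xa xb; apply: eA.
rewrite (le_trans (nr_ReIm _))// [e]splitr !raddfB/=.
exact: lerD.
Qed.

End RealNorm.

(* A separate name is needed: the completeness instance of the library for
   [R^o] with [R : realType] shadows any instance for [R[i]^o]. *)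
Definition Cplx (R : realType) : Type := R[i]^o.

HB.instance Definition _ (R : realType) := NormedModule.copy (Cplx R) R[i]^o.

HB.instance Definition _ (R : realType) :=
  Uniform_isComplete.Build (Cplx R) (@complex_complete R).

Section BoundedFunctions.
Context (R : realType) (S : Type) (W : completeNormedModType R[i]).

(* Hilbert space completions, operator algebras and closed subspaces are all spaces of
   functions [f : S -> W] normed by the least multiple of a weight dominating them. *)
Record bfspace := BFSpace {
  bf_w : S -> R ;
  bf_mem : set (S -> W) ;
  bf_w_ge0 : forall s, 0 <= bf_w s ;
  bf_mem0 : bf_mem 0 ;
  bf_memZD : forall (k : R[i]) f g, bf_mem f -> bf_mem g -> bf_mem (k *: f + g) ;
  bf_bounded : forall f, bf_mem f -> exists C, forall s, nr (f s) <= C * bf_w s ;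
  bf_closed : forall f, (forall e, 0 < e -> exists2 g, bf_mem g &
    forall s, nr (f s - g s) <= e * bf_w s) -> bf_mem f
}.

Variable D : bfspace.

Definition bf_pred : {pred S -> W} := fun f => `[<bf_mem D f>].

Lemma bf_submod : submod_closed bf_pred.
Proof.
split; first exact/asboolP/bf_mem0.
move=> k f g /asboolP Df /asboolP Dg; exact/asboolP/bf_memZD.
Qed.

HB.instance Definition _ := GRing.isSubmodClosed.Build R[i] (S -> W) bf_pred
  bf_submod.

Record bf := Bf { bf_val : S -> W ; bf_valP : bf_val \in bf_pred }.

HB.instance Definition _ := [isSub for bf_val].
HB.instance Definition _ := [Choice of bf by <:].
HB.instance Definition _ := [SubChoice_isSubLmodule of bf by <:].

Lemma bf_mem_val (f : bf) : bf_mem D (bf_val f).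
Proof. exact/asboolP/bf_valP. Qed.

Definition mkbf f (Df : bf_mem D f) : bf := Bf (introT (asboolP _) Df).

Lemma bf_eq (f g : bf) : bf_val f =1 bf_val g -> f = g.
Proof. by move=> fg; apply/val_inj/funext. Qed.

Lemma bf_valD (f g : bf) s : bf_val (f + g) s = bf_val f s + bf_val g s.
Proof. by []. Qed.
Lemma bf_valB (f g : bf) s : bf_val (f - g) s = bf_val f s - bf_val g s.
Proof. by []. Qed.
Lemma bf_valZ k (f : bf) s : bf_val (k *: f) s = k *: bf_val f s.
Proof. by []. Qed.
(** Nonnegativity is imposed so that the infimum exists even when the weight vanishes everywhere. *)
Let bounds (f : bf) := [set C : R | 0 <= C /\ forall s, nr (bf_val f s) <= C * bf_w D s].

Let bounds_inf f : has_inf (bounds f).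
Proof.
split; last by exists 0 => C [].
have [C fC] := bf_bounded (bf_mem_val f); exists `|C|; split=> // s.
by rewrite (le_trans (fC s))// ler_wpM2r ?bf_w_ge0// ler_norm.
Qed.

Let bnorm (f : bf) : R := inf (bounds f).

Let bnorm_ge0 f : 0 <= bnorm f.
Proof. by apply: lb_le_inf; [case: (bounds_inf f)|move=> C []]. Qed.

Let bnormP f s : nr (bf_val f s) <= bnorm f * bf_w D s.
Proof.
have := bf_w_ge0 D s; rewrite le_eqVlt => /predU1P[w0|w0].
  have [C [_ /(_ s)]] := (bounds_inf f).1; by rewrite -w0 !mulr0.
rewrite -ler_pdivrMr//; apply: lb_le_inf; first by case: (bounds_inf f).
by move=> C [_ /(_ s)]; rewrite -ler_pdivrMr.
Qed.

Let bnorm_le f C : 0 <= C -> (forall s, nr (bf_val f s) <= C * bf_w D s) ->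
  bnorm f <= C.
Proof. by move=> C0 fC; apply: ge_inf => //; exact: (bounds_inf f).2. Qed.

Let cnorm (f : bf) : R[i] := (bnorm f)%:C.

Let cnormD f g : cnorm (f + g) <= cnorm f + cnorm g.
Proof.
rewrite -rmorphD/= lecR; apply: bnorm_le => [|s]; first by rewrite addr_ge0.
by rewrite bf_valD (le_trans (nrD _ _))// mulrDl lerD.
Qed.

Let bnormZ_le k f : bnorm (k *: f) <= nr k * bnorm f.
Proof.
apply: bnorm_le => [|s]; first by rewrite mulr_ge0// nr_ge0.
by rewrite bf_valZ nrZ -mulrA ler_wpM2l// nr_ge0.
Qed.

Let cnormZ k f : cnorm (k *: f) = `|k| * cnorm f.
Proof.
rewrite nrE -rmorphM; congr (_%:C); apply/eqP; rewrite eq_le bnormZ_le/=.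
have [->|k0] := eqVneq k 0; first by rewrite nr0 mul0r.
have {1}-> : f = k^-1 *: (k *: f) by rewrite scalerA mulVf// scale1r.
rewrite (le_trans (ler_wpM2l (nr_ge0 _) (bnormZ_le _ _)))// mulrA -nrcM.
by rewrite divff// nrc1 mul1r.
Qed.

Let cnorm_eq0 f : cnorm f = 0 -> f = 0.
Proof.
move=> /complexI f0; apply: bf_eq => s; apply: nr_le0.
by rewrite (le_trans (bnormP _ _))// f0 mul0r.
Qed.

HB.instance Definition _ :=
  Lmodule_isNormed.Build R[i] bf cnormD cnormZ cnorm_eq0.

Lemma nr_bf (f : bf) s : nr (bf_val f s) <= nr f * bf_w D s.
Proof. exact: bnormP. Qed.

Lemma nr_bf_le (f : bf) C : 0 <= C ->
  (forall s, nr (bf_val f s) <= C * bf_w D s) -> nr f <= C.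
Proof. exact: bnorm_le. Qed.

(** A Cauchy filter converges pointwise, with an error proportional to the weight and uniform in the
    point; [bf_closed] then keeps the pointwise limit in the space. *)
Lemma bf_complete (F : set_system bf) : ProperFilter F -> cauchy F -> cvg F.
Proof.
move=> FF /cauchy_ballP cF.
have {}cF e : 0 < e -> exists A B, [/\ F A, F B &
    forall f g, A f -> B g -> nr (f - g) <= e].
  move=> e0; have [|[A B]/= [FA FB] AB] := cF e%:C; first by rewrite ltcR.
  exists A, B; split=> // f g Af Bg; have := AB (f, g) (conj Af Bg).
  by rewrite -ball_normE /ball_/= nrE ltcR => /ltW.
have /choice[g gP] s : exists y : W, (fun f => bf_val f s) @ F --> y.
  apply/cvg_ex; apply: cauchy_cvg; apply/cauchy_ballP => e e0.
  have er : e = (complex.Re e)%:C by rewrite RRe_real// gtr0_real.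
  have re0 : 0 < complex.Re e by rewrite -ltcR -er.
  have w0 : 0 < bf_w D s + 1 by rewrite ltr_wpDl// bf_w_ge0.
  have [|A [B [FA FB AB]]] := cF (complex.Re e / (bf_w D s + 1)).
    by rewrite divr_gt0.
  exists ((fun f => bf_val f s) @` A, (fun f => bf_val f s) @` B) => /=.
    by split; [apply: (@filterS _ F _ A)|apply: (@filterS _ F _ B)] => // x; exists x.
  move=> [_ _]/= [[x Ax <-] [y By <-]].
  rewrite -ball_normE /ball_/= nrE er ltcR -bf_valB (le_lt_trans (nr_bf _ _))//.
  rewrite (@le_lt_trans _ _ (complex.Re e / (bf_w D s + 1) * bf_w D s))//.
    by rewrite ler_wpM2r ?bf_w_ge0// AB.
  by rewrite mulrAC ltr_pdivrMr// ltr_pM2l// ltrDl.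
have gF e : 0 < e -> exists2 A, F A &
    forall f, A f -> forall s, nr (g s - bf_val f s) <= e * bf_w D s.
  move=> e0; have [A [B [FA FB AB]]] := cF _ e0; exists B => // f Bf s.
  apply/ler_addgt0Pl => d d0.
  have sd : F [set h | nr (g s - bf_val h s) <= d].
    by apply: (gP s [set y | nr (g s - y) <= d]); apply/nbhs_nr; exists d.
  have [h [Ah hd]] := filter_ex (filterI FA sd).
  rewrite (le_trans (nr_tri (bf_val h s) _ _))// lerD// -bf_valB.
  by rewrite (le_trans (nr_bf _ _))// ler_wpM2r ?bf_w_ge0// AB.
have Dg : bf_mem D g.
  apply: bf_closed => e e0; have [A FA Ag] := gF _ e0.
  have [h Ah] := filter_ex FA; exists (bf_val h); [exact: bf_mem_val|exact: Ag].
apply/cvg_ex; exists (mkbf Dg) => A /nbhs_nr[e e0 eA].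
have [B FB Bg] := gF _ e0; apply: filterS FB => f Bf; apply: eA.
by apply: nr_bf_le; [exact: ltW|move=> s; rewrite bf_valB Bg].
Qed.

HB.instance Definition _ := Uniform_isComplete.Build bf bf_complete.

End BoundedFunctions.

(** * Positive forms, Hilbert spaces and C*-algebras *)

Section Conj.
Context (R : realType).
Implicit Types a b : R[i].
Lemma conjM a b : (a * b)^*%C = a^*%C * b^*%C.
Proof. exact: rmorphM. Qed.
Lemma conjD a b : (a + b)^*%C = a^*%C + b^*%C.
Proof. exact: rmorphD. Qed.
Lemma conjN a : (- a)^*%C = - a^*%C.
Proof. exact: rmorphN. Qed.
Lemma ReD a b : complex.Re (a + b) = complex.Re a + complex.Re b.
Proof. by case: a; case: b. Qed.
Lemma ReN a : complex.Re (- a) = - complex.Re a.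
Proof. by case: a. Qed.
Lemma ReB a b : complex.Re (a - b) = complex.Re a - complex.Re b.
Proof. by rewrite ReD ReN. Qed.
Lemma Re_conj a : complex.Re a^*%C = complex.Re a.
Proof. by case: a. Qed.
Lemma ReZ (r : R) a : complex.Re (r%:C * a) = r * complex.Re a.
Proof. by case: a => x y /=; rewrite mul0r subr0. Qed.
Lemma rcM (r t : R) : (r * t)%:C = r%:C * t%:C :> R[i].
Proof. exact: rmorphM. Qed.
Lemma rcD (r t : R) : (r + t)%:C = r%:C + t%:C :> R[i].
Proof. exact: rmorphD. Qed.
Lemma rcB (r t : R) : (r - t)%:C = r%:C - t%:C :> R[i].
Proof. exact: rmorphB. Qed.
End Conj.

Section PsdForm.
Context (R : realType) (V : lmodType R[i]).

Record psd_form := PsdForm {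
  form : V -> V -> R[i] ;
  form_linearl : forall k x y z, form (k *: x + y) z = k * form x z + form y z ;
  form_conj : forall x y, form y x = (form x y)^*%C ;
  form_ge0 : forall x, 0 <= complex.Re (form x x)
}.

Variable f : psd_form.

Lemma form0l z : form f 0 z = 0.
Proof.
have := form_linearl f (-1) 0 0 z.
by rewrite scaler0 addr0 mulN1r addNr.
Qed.

Lemma formDl x y z : form f (x + y) z = form f x z + form f y z.
Proof. by have := form_linearl f 1 x y z; rewrite scale1r mul1r. Qed.

Lemma formZl k x z : form f (k *: x) z = k * form f x z.
Proof. by have := form_linearl f k x 0 z; rewrite !addr0 form0l addr0. Qed.

Lemma formNl x z : form f (- x) z = - form f x z.
Proof. by rewrite -scaleN1r formZl mulN1r. Qed.

Lemma formBl x y z : form f (x - y) z = form f x z - form f y z.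
Proof. by rewrite formDl formNl. Qed.

Lemma formDr x y z : form f z (x + y) = form f z x + form f z y.
Proof. by rewrite form_conj formDl conjD -!(form_conj f). Qed.

Lemma formZr k x z : form f z (k *: x) = k^*%C * form f z x.
Proof. by rewrite form_conj formZl conjM -!(form_conj f). Qed.

Lemma formNr x z : form f z (- x) = - form f z x.
Proof. by rewrite form_conj formNl conjN -!(form_conj f). Qed.

Lemma formBr x y z : form f z (x - y) = form f z x - form f z y.
Proof. by rewrite formDr formNr. Qed.

Lemma form0r z : form f z 0 = 0.
Proof. by rewrite form_conj form0l conjc0. Qed.

Definition fnorm2 x := complex.Re (form f x x).

Lemma formxx x : form f x x = (fnorm2 x)%:C.
Proof.
rewrite /fnorm2; have := form_conj f x x; case: (form f x x) => a b [].
by move=> /eqP; rewrite -subr_eq0 opprK -mulr2n mulrn_eq0/= => /eqP->.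
Qed.

Lemma form_CS x y : nr (form f x y) ^+ 2 <= fnorm2 x * fnorm2 y.
Proof.
set c := form f x y; set N := nr c ^+ 2.
have N0 : 0 <= N by rewrite sqr_ge0.
have NE : N%:C = c * c^*%C by rewrite nr_sq.
clearbody N.
(* Value of the form at [x - s c y]: the factor [c] makes the cross terms real. *)
have quad (s : R) : 0 <= fnorm2 x - s * N *+ 2 + s ^+ 2 * N * fnorm2 y.
  suff -> : fnorm2 x - s * N *+ 2 + s ^+ 2 * N * fnorm2 y =
      fnorm2 (x - (s%:C * c) *: y) by exact: form_ge0.
  apply/complexI; rewrite -formxx formBl !formBr !formZl !formZr !formxx.
  rewrite (form_conj f x y) -/c conjM conjc_real.
  rewrite !(rmorphD, rmorphN, rmorphM, rmorphMn, rmorphXn)/=.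
  by rewrite NE; ring.
clear NE.
have Y0 : 0 <= fnorm2 y by exact: form_ge0.
have X0 : 0 <= fnorm2 x by exact: form_ge0.
have [->|N1] := eqVneq N 0; first by rewrite mulr_ge0.
have {}N0 : 0 < N by rewrite lt0r N1.
have [Y1|Y1] := eqVneq (fnorm2 y) 0.
  (* When [y] is a null vector the bound is affine in [s]; this [s] gives it the negative value
     [- fnorm2 x - 2]. *)
  have := quad ((fnorm2 x + 1) / N).
  rewrite Y1 mulr0 addr0 divfK//.
  by move=> ?; exfalso; lra.
have {}Y0 : 0 < fnorm2 y by rewrite lt0r Y1.
have := quad (fnorm2 y)^-1.
have -> : (fnorm2 y)^-1 ^+ 2 * N * fnorm2 y = (fnorm2 y)^-1 * N by field.
rewrite mulr2n opprD addrA addrNK subr_ge0 => h.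
by rewrite -ler_pdivrMr// mulrC.
Qed.

End PsdForm.

Section Hilbert.
Context (R : realType) (H : hilbertType R).
Implicit Types x y z : H.

Lemma inner_ge0 x : 0 <= complex.Re (inner x x : R[i]).
Proof. by rewrite -norm_inner nrE -rmorphXn/= sqr_ge0. Qed.

Definition hform : psd_form H :=
  PsdForm (@inner_linearl R H) (@inner_conj R H) inner_ge0.

Lemma inner_xx x : inner x x = (nr x ^+ 2)%:C.
Proof. by rewrite -norm_inner nrE rmorphXn. Qed.

Lemma innerC x y : inner y x = (inner x y)^*%C.
Proof. exact: inner_conj. Qed.

Lemma innerDl x y z : inner (x + y) z = inner x z + inner y z.
Proof. exact: (formDl hform). Qed.
Lemma innerZl k x z : inner (k *: x) z = k * inner x z.
Proof. exact: (formZl hform). Qed.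
Lemma innerBl x y z : inner (x - y) z = inner x z - inner y z.
Proof. exact: (formBl hform). Qed.
Lemma inner0l z : inner 0 z = 0 :> R[i].
Proof. exact: (form0l hform). Qed.
Lemma innerDr x y z : inner z (x + y) = inner z x + inner z y.
Proof. exact: (formDr hform). Qed.
Lemma innerZr k x z : inner z (k *: x) = k^*%C * inner z x.
Proof. exact: (formZr hform). Qed.
Lemma innerBr x y z : inner z (x - y) = inner z x - inner z y.
Proof. exact: (formBr hform). Qed.
Lemma inner0r z : inner z 0 = 0 :> R[i].
Proof. exact: (form0r hform). Qed.

Lemma nr2E x : nr x ^+ 2 = complex.Re (inner x x : R[i]).
Proof. by rewrite inner_xx. Qed.

Lemma inner_CS x y : nr (inner x y : R[i]) <= nr x * nr y.
Proof.
rewrite -ler_sqr ?nnegrE ?nr_ge0// ?mulr_ge0 ?nr_ge0// exprMn !nr2E.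
exact: (form_CS hform).
Qed.

Lemma parallelogram x y :
  nr (x + y) ^+ 2 + nr (x - y) ^+ 2 = (nr x ^+ 2 + nr y ^+ 2) *+ 2.
Proof.
rewrite !nr2E innerBl !innerBr !innerDl !innerDr.
by rewrite !(ReD, ReN); ring.
Qed.

Lemma inner_inj x y : (forall z, inner x z = inner y z) -> x = y.
Proof.
move=> xy; apply/eqP; rewrite -subr_eq0; apply/eqP/nr_le0.
rewrite -(@ler_sqr R) ?nnegrE ?nr_ge0// expr0n/= nr2E innerBl.
by rewrite -!xy subrr.
Qed.

End Hilbert.

(** * Norm identities and square roots in a C*-algebra *)

Section CStar.
Context (R : realType) (A : cstarAlgType R).
Implicit Types x y z : A.
Local Notation "x ** y" := (cmul x y) (at level 40, left associativity).

Lemma cmul0x x : 0 ** x = 0.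
Proof. by have := cmulZl 0 0 x; rewrite !scale0r. Qed.
Lemma cmulx0 x : x ** 0 = 0.
Proof. by have := cmulZr 0 x 0; rewrite !scale0r. Qed.
Lemma cmulNx x y : (- x) ** y = - (x ** y).
Proof. by rewrite -scaleN1r cmulZl scaleN1r. Qed.
Lemma cmulxN x y : x ** (- y) = - (x ** y).
Proof. by rewrite -scaleN1r cmulZr scaleN1r. Qed.
Lemma cmulBl x y z : (x - y) ** z = x ** z - y ** z.
Proof. by rewrite cmulDl cmulNx. Qed.
Lemma cmulBr x y z : x ** (y - z) = x ** y - x ** z.
Proof. by rewrite cmulDr cmulxN. Qed.

Lemma star0 : star (0 : A) = 0.
Proof. by have := starZ 0 (0 : A); rewrite rmorph0 !scale0r. Qed.
Lemma starN x : star (- x) = - star x.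
Proof. by rewrite -scaleN1r starZ rmorphN1 scaleN1r. Qed.
Lemma starB x y : star (x - y) = star x - star y.
Proof. by rewrite starD starN. Qed.
Lemma starZr (r : R) x : star (r%:C *: x) = r%:C *: star x.
Proof. by rewrite starZ; congr (_ *: _); exact: conjc_real. Qed.

Lemma nr_cmul x y : nr (x ** y) <= nr x * nr y.
Proof. by rewrite -lecR rmorphM/= -!nrE norm_cmul. Qed.

Lemma nr_cstar x : nr (star x ** x) = nr x ^+ 2.
Proof. by apply/complexI; rewrite -nrE norm_cstar nrE rmorphXn. Qed.

(** The C*-identity and submultiplicativity give [|y|^2 <= |y^*| |y|]; this is applied to [x] and to
    [star x]. *)
Lemma nr_star x : nr (star x) = nr x.
Proof.
suff le y : nr y <= nr (star y).
  by apply/eqP; rewrite eq_le le -{2}(starK x) le.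
have [->|y0] := eqVneq (nr y) 0; first exact: nr_ge0.
have {}y0 : 0 < nr y by rewrite lt0r y0 nr_ge0.
by rewrite -(ler_pM2r y0) -expr2 -nr_cstar nr_cmul.
Qed.

Section Sqrt.
Variable u : A.
Hypothesis u1 : nr u <= 1.

(** Fixed-point iteration for [2 b - b^2 = u], that is for [b = 1 - sqrt (1 - u)], written so that
    it makes sense in an algebra without unit. *)
Let b := fix b n := if n is m.+1 then 2^-1 *: (u + b m ** b m) else 0.
(** The same iteration for the number 1. Its increments dominate those of [b]; being monotone and
    bounded by 1 it is Cauchy, which covers the borderline case of norm exactly 1. *)
Let t := fix t n : R := if n is m.+1 then 2^-1 * (1 + t m ^+ 2) else 0.

Let t01 n : 0 <= t n <= 1.
Proof.
elim: n => [|n /andP[t0 t1]]; first by rewrite /= lexx ler01.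
have /= := sqr_ge0 (t n); have : t n ^+ 2 <= 1 by rewrite expr_le1.
by move=> ? ?; apply/andP; split=> /=; lra.
Qed.

Let comm_b c n : c ** u = u ** c -> c ** b n = b n ** c.
Proof.
move=> cu; elim: n => [|n ih] /=; first by rewrite cmulx0 cmul0x.
by rewrite cmulZr cmulZl cmulDr cmulDl cu cmulA ih -cmulA ih cmulA.
Qed.

Let bb m n : b m ** b n = b n ** b m.
Proof. by apply: comm_b; apply/esym; exact: comm_b. Qed.

Let bt n : nr (b n) <= t n.
Proof.
elim: n => [|n ih] /=; first by rewrite nr0.
rewrite nrZ.
have -> : nr (2^-1 : R[i]) = 2^-1.
  by rewrite (_ : 2^-1 = (2^-1 : R)%:C) ?nr_real ?ger0_norm// fmorphV rmorph_nat.
rewrite ler_wpM2l// (le_trans (nrD _ _))// lerD// (le_trans (nr_cmul _ _))//.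
by rewrite expr2 ler_pM// nr_ge0.
Qed.

Let b_step n : nr (b n.+1 - b n) <= t n.+1 - t n.
Proof.
elim: n => [|n ih].
  rewrite /= subr0 cmul0x addr0 nrZ subr0 expr0n addr0 mulr1.
  rewrite (_ : 2^-1 = (2^-1 : R)%:C) ?nr_real ?ger0_norm//; last first.
    by rewrite fmorphV rmorph_nat.
  by rewrite ger_pMr.
(* The iterates commute, so the difference of their squares factors just as it does for [t]. *)
have -> : b n.+2 - b n.+1 = 2^-1 *: ((b n.+1 + b n) ** (b n.+1 - b n)).
  rewrite [b n.+2]/= {2}[b n.+1]/= -scalerBr; congr (_ *: _).
  rewrite opprD addrACA subrr add0r cmulDl !cmulBr.
  rewrite (bb n n.+1) addrA addrNK.
  by [].
have -> : t n.+2 - t n.+1 = 2^-1 * ((t n.+1 + t n) * (t n.+1 - t n)).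
  by rewrite /=; ring.
rewrite nrZ.
have -> : nr (2^-1 : R[i]) = 2^-1.
  by rewrite (_ : 2^-1 = (2^-1 : R)%:C) ?nr_real ?ger0_norm// fmorphV rmorph_nat.
rewrite ler_wpM2l// (le_trans (nr_cmul _ _))// ler_pM ?nr_ge0//.
by rewrite (le_trans (nrD _ _))// lerD.
Qed.

Let b_dist m n : (m <= n)%N -> nr (b n - b m) <= t n - t m.
Proof.
elim: n => [|n ih]; first by rewrite leqn0 => /eqP->; rewrite !subrr nr0.
rewrite leq_eqVlt => /predU1P[->|]; first by rewrite !subrr nr0.
rewrite ltnS => /ih h; rewrite (le_trans (nr_tri (b n) _ _))//.
by have := b_step n; lra.
Qed.

Let t_cauchy (e : R) : 0 < e -> exists N, forall m n, (N <= m)%N -> (N <= n)%N ->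
  t m - t n <= e.
Proof.
move=> e0; have st : has_sup (range t).
  by split; [exists (t 0), 0|exists 1 => _ [n _ <-]; case/andP: (t01 n)].
have [_ [N _ <-] hN] := sup_adherent e0 st.
exists N => m n Nm Nn.
have := b_dist Nn; have := nr_ge0 (b n - b N).
have : t m <= sup (range t) by apply: ub_le_sup; [exact: st.2|exists m].
by lra.
Qed.

(** In the presence of a unit the equation says [(1 - b)^2 = 1 - u]; the later square roots all come
    from here. Commutation and self-adjointness hold for each iterate and pass to the limit. *)
Lemma sqrt_exists : exists b : A, [/\ b + b - b ** b = u, nr b <= 1,
  forall c, c ** u = u ** c -> c ** b = b ** c & star u = u -> star b = b].
Proof.
have [e e0|l bl] := @seq_complete R A b.
  have [N NP] := t_cauchy e0; exists N => m n Nm Nn.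
  have [/b_dist h|/ltnW/b_dist h] := leqP m n.
    by rewrite nrC (le_trans h)// NP.
  by rewrite (le_trans h)// NP.
have l1 : nr l <= 1.
  apply/ler_addgt0Pl => e e0; have [N /(_ _ (leqnn N)) NP] := bl e e0.
  have := nr_sub l (b N); rewrite nrC in NP; have := bt N; have := t01 N.
  by move=> /andP[]; lra.
exists l; split=> //.
- apply: nr_eq => e e0; have e50 : 0 < e / 6 by lra.
  have [N NP] := bl _ e50.
  have h0 := NP N (leqnn _); have h1 := NP N.+1 (leqnSn _).
  have -> : l + l - l ** l - u = ((l - b N.+1) + (l - b N.+1)) -
      ((l - b N) ** l + b N ** (l - b N)).
    have bE : u = b N.+1 + b N.+1 - b N ** b N.
      have h2 : 2^-1 + 2^-1 = 1 :> R[i] by rewrite -div1r -splitr.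
      by rewrite /= -scalerDl h2 scale1r addrK.
    have -> : (l - b N) ** l + b N ** (l - b N) = l ** l - b N ** b N.
      by rewrite cmulBl cmulBr addrA subrK.
    rewrite {1}bE [in RHS]addrACA -opprD.
    by rewrite !opprB addrACA [RHS]addrACA; congr (_ + _); exact: addrC.
  rewrite (le_trans (nrB _ _))// (le_trans (lerD (nrD _ _) (nrD _ _)))//.
  have := nr_cmul (l - b N) l; have := nr_cmul (b N) (l - b N).
  rewrite ![nr (l - _)]nrC.
  have bN1 : nr (b N) <= 1 by case/andP: (t01 N) (bt N) => *; lra.
  have : nr (b N) * nr (b N - l) <= nr (b N - l) by rewrite ler_piMl ?nr_ge0.
  have : nr (b N - l) * nr l <= nr (b N - l) by rewrite ler_piMr ?nr_ge0.
  lra.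
- move=> c cu; apply: nr_eq => e e0.
  have e50 : 0 < e / 2 / (nr c + 1) by rewrite !divr_gt0// ltr_wpDl// nr_ge0.
  have [N /(_ _ (leqnn N)) NP] := bl _ e50.
  have -> : c ** l - l ** c = (b N - l) ** c - c ** (b N - l).
    by rewrite cmulBl cmulBr comm_b// opprB [RHS]addrC addrA subrK.
  rewrite (le_trans (nrB _ _))// (le_trans (lerD (nr_cmul _ _) (nr_cmul _ _)))//.
  have : nr (b N - l) * nr c <= e / 2.
    rewrite (le_trans (ler_wpM2r (nr_ge0 _) NP))// mulrAC.
    rewrite ler_pdivrMr; last by rewrite ltr_wpDl// nr_ge0.
    by rewrite ler_wpM2l ?lerDl// ltW// divr_gt0.
  by rewrite [nr c * _]mulrC; lra.
- move=> us; apply: nr_eq => e e0.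
  have e50 : 0 < e / 2 by lra.
  have [N /(_ _ (leqnn N)) NP] := bl _ e50.
  have bs : star (b N) = b N.
    elim: N {NP} => [|n ih] /=; first exact: star0.
    rewrite (_ : 2^-1 = (2^-1 : R)%:C); last by rewrite fmorphV rmorph_nat.
    by rewrite starZr starD us starM ih.
  have -> : star l - l = (b N - l) - star (b N - l).
    by rewrite starB bs opprB [RHS]addrC subrKA.
  by rewrite (le_trans (nrB _ _))// nr_star; lra.
Qed.

End Sqrt.
End CStar.

Section Contractive.
Context (R : realType) (A : cstarAlgType R) (H : hilbertType R).
Variables (pi : A -> H -> H) (pir : star_representation pi).
Local Notation "x ** y" := (cmul x y) (at level 40, left associativity).

Lemma rep0 x : pi 0 x = 0.
Proof.
have := rep_linear pir (-1) 0 0 x.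
by rewrite scaler0 addr0 scaleN1r addNr.
Qed.

Lemma repD a b x : pi (a + b) x = pi a x + pi b x.
Proof. by have := rep_linear pir 1 a b x; rewrite !scale1r. Qed.

Lemma repZ k a x : pi (k *: a) x = k *: pi a x.
Proof. by have := rep_linear pir k a 0 x; rewrite !addr0 rep0 addr0. Qed.

Lemma repN a x : pi (- a) x = - pi a x.
Proof. by rewrite -scaleN1r repZ scaleN1r. Qed.

Lemma repB a b x : pi (a - b) x = pi a x - pi b x.
Proof. by rewrite repD repN. Qed.

Lemma rep_op0 a : pi a 0 = 0.
Proof.
have := rep_op_linear pir a (-1) 0 0.
by rewrite scaler0 addr0 scaleN1r addNr.
Qed.

Lemma rep_opD a x y : pi a (x + y) = pi a x + pi a y.
Proof. by have := rep_op_linear pir a 1 x y; rewrite !scale1r. Qed.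

Lemma rep_opZ a k x : pi a (k *: x) = k *: pi a x.
Proof. by have := rep_op_linear pir a k x 0; rewrite !addr0 rep_op0 addr0. Qed.

Lemma rep_opN a x : pi a (- x) = - pi a x.
Proof. by rewrite -scaleN1r rep_opZ scaleN1r. Qed.

Lemma rep_opB a x y : pi a (x - y) = pi a x - pi a y.
Proof. by rewrite rep_opD rep_opN. Qed.

Lemma rep_cstar a x : inner (pi (star a ** a) x) x = (nr (pi a x) ^+ 2)%:C.
Proof. by rewrite (rep_mul pir) (rep_star pir) starK inner_xx. Qed.

(* With [2 b - b^2 = a^* a] one has [|x|^2 - |pi a x|^2 = |x - pi b x|^2]. *)
Lemma rep_contractive a x : nr (pi a x) <= nr a * nr x.
Proof.
suff main c : nr c <= 1 -> nr (pi c x) <= nr x.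
  have [/nr_eq0 ->|a0] := eqVneq (nr a) 0; first by rewrite rep0 !nr0 mul0r.
  have {}a0 : 0 < nr a by rewrite lt0r a0 nr_ge0.
  have := main ((nr a)^-1%:C *: a).
  rewrite nrZr repZ nrZr ger0_norm ?invr_ge0 ?nr_ge0// mulVf ?gt_eqF// => /(_ (lexx _)).
  by rewrite mulrC ler_pdivrMr// mulrC.
move=> c1; have [|b [bc _ _ bs]] := @sqrt_exists R A (star c ** c).
  by rewrite nr_cstar expr_le1// nr_ge0.
have {}bs : star b = b by apply: bs; rewrite starM starK.
rewrite -(@ler_sqr R) ?nnegrE ?nr_ge0// -subr_ge0.
suff -> : nr x ^+ 2 - nr (pi c x) ^+ 2 = nr (x - pi b x) ^+ 2 by rewrite sqr_ge0.
apply/complexI; rewrite rmorphB/= -rep_cstar -bc -!inner_xx.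
rewrite repB repD (rep_mul pir) !innerBl !innerBr innerDl.
rewrite !(rep_star pir) bs.
by ring.
Qed.

End Contractive.

(** * C*-algebras of adjointable operators *)

Section Operators.
Context (R : realType) (E : completeNormedModType R[i]).

(** Common frame for the inner product of a Hilbert space and for the [A]-valued form [x^* y] on [A]
    itself. [adjfZ] only moves scalars across, because the first form is linear and the second
    conjugate-linear in the left variable; [adj_tau] is the conjugation, respectively the star. *)
Record adj_form := AdjForm {
  adj_codom : normedModType R[i] ;
  adjf : E -> E -> adj_codom ;
  adj_tau : adj_codom -> adj_codom ;
  adjfC : forall x y, adjf y x = adj_tau (adjf x y) ;
  adjfDl : forall x y z, adjf (x + y) z = adjf x z + adjf y z ;
  adjfDr : forall x y z, adjf z (x + y) = adjf z x + adjf z y ;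
  adjfZ : forall k x y, adjf (k *: x) y = adjf x (k^*%C *: y) ;
  adjf_xx : forall x, nr (adjf x x) = nr x ^+ 2 ;
  adjf_CS : forall x y, nr (adjf x y) <= nr x * nr y
}.

Variable B : adj_form.
Local Notation "<| x , y |>" := (adjf B x y).

Lemma adjfNl x y : <| - x, y |> = - <| x, y |>.
Proof.
have h : <| 0, y |> = 0.
  by apply: (addrI <| 0, y |>); rewrite -adjfDl !addr0.
by apply/eqP; rewrite eq_sym -subr_eq0 -opprD -adjfDl subrr h oppr0.
Qed.

Lemma adjfNr x y : <| y, - x |> = - <| y, x |>.
Proof.
have h : <| y, 0 |> = 0.
  by apply: (addrI <| y, 0 |>); rewrite -adjfDr !addr0.
by apply/eqP; rewrite eq_sym -subr_eq0 -opprD -adjfDr subrr h oppr0.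
Qed.

Lemma adjfBl x y z : <| x - y, z |> = <| x, z |> - <| y, z |>.
Proof. by rewrite adjfDl adjfNl. Qed.
Lemma adjfBr x y z : <| z, x - y |> = <| z, x |> - <| z, y |>.
Proof. by rewrite adjfDr adjfNr. Qed.

Lemma adjf_inj y z : (forall x, <| x, y |> = <| x, z |>) -> y = z.
Proof.
move=> yz; apply/eqP; rewrite -subr_eq0; apply/eqP/nr_le0.
rewrite -(@ler_sqr R) ?nnegrE ?nr_ge0// expr0n/= -(adjf_xx B) adjfBr yz subrr.
by rewrite nr0.
Qed.

Definition adjoint (f g : E -> E) := forall x y, <| f x, y |> = <| x, g y |>.

Definition op_bounded (f : E -> E) (C : R) := forall x, nr (f x) <= C * nr x.

Lemma adjoint_bounded f g C : 0 <= C -> adjoint f g -> op_bounded f C ->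
  op_bounded g C.
Proof.
move=> C0 fg fC y; have [->|gy0] := eqVneq (nr (g y)) 0.
  by rewrite mulr_ge0// nr_ge0.
have {}gy0 : 0 < nr (g y) by rewrite lt0r gy0 nr_ge0.
rewrite -(ler_pM2r gy0) -expr2 -(adjf_xx B) -fg (le_trans (adjf_CS B _ _))//.
by rewrite mulrAC ler_wpM2r ?nr_ge0.
Qed.

Record opcore := OpCore {
  oc_mem : set (E -> E) ;
  oc0 : oc_mem 0 ;
  ocZD : forall k f g, oc_mem f -> oc_mem g -> oc_mem (k *: f + g) ;
  oc_comp : forall f g, oc_mem f -> oc_mem g -> oc_mem (f \o g) ;
  oc_adj : forall f, oc_mem f -> exists2 g, oc_mem g & adjoint f g ;
  oc_lin : forall f, oc_mem f -> forall k x y, f (k *: x + y) = k *: f x + f y ;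
  oc_bd : forall f, oc_mem f -> exists2 C, 0 <= C & op_bounded f C
}.

Variable K : opcore.

Definition op_mem (T : E -> E) := forall e : R, 0 < e -> exists2 f, oc_mem K f &
  forall x, nr (T x - f x) <= e * nr x.

Lemma op_mem_core f : oc_mem K f -> op_mem f.
Proof.
move=> Kf e e0; exists f => // x; rewrite subrr nr0 mulr_ge0 ?nr_ge0//.
exact: ltW.
Qed.

Lemma op_mem_lin T : op_mem T -> forall k x y, T (k *: x + y) = k *: T x + T y.
Proof.
move=> KT k x y; apply: nr_eq => e e0.
set c := nr (k *: x + y) + nr k * nr x + nr y + 1.
have c0 : 0 < c by rewrite ltr_wpDl// !addr_ge0 ?mulr_ge0 ?nr_ge0.
have [f Kf Tf] := KT (e / c) (divr_gt0 e0 c0).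
have -> : T (k *: x + y) - (k *: T x + T y) = (T (k *: x + y) - f (k *: x + y))
   - (k *: (T x - f x) + (T y - f y)).
  rewrite (oc_lin Kf) scalerBr [in RHS]addrACA -[in RHS]opprD [in RHS]opprB.
  by rewrite [RHS]addrA subrK.
rewrite (le_trans (nrB _ _))// (le_trans (lerD (Tf _) (nrD _ _)))//.
have := lerD (ler_wpM2l (nr_ge0 k) (Tf x)) (Tf y); rewrite -nrZ => h.
rewrite (le_trans (lerD (lexx _) h))//.
have -> : e / c * nr (k *: x + y) + (nr k * (e / c * nr x) + e / c * nr y) =
   e * (c - 1) / c.
  have -> : c - 1 = nr (k *: x + y) + nr k * nr x + nr y by rewrite /c addrK.
  by ring.
by rewrite ler_pdivrMr// ler_wpM2l ?gerBl// ltW.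
Qed.

Lemma op_mem_bd T : op_mem T -> exists2 C, 0 <= C & op_bounded T C.
Proof.
move=> KT; have [f Kf Tf] := KT 1 ltr01; have [C C0 fC] := oc_bd Kf.
exists (1 + C) => [|x]; first by rewrite addr_ge0.
by rewrite -[T x](subrK (f x)) (le_trans (nrD _ _))// mulrDl lerD.
Qed.

(** The form may be vector-valued, so the adjoint is found as a limit: by [adjoint_bounded] the
    adjoints of approximating core operators are Cauchy in norm, and they converge pointwise because
    [E] is complete. *)
Lemma op_mem_adj T : op_mem T -> exists2 S, op_mem S & adjoint T S.
Proof.
move=> KT.
have /choice[f fP] n : exists f, oc_mem K f /\
    forall x, nr (T x - f x) <= n.+1%:R^-1 * nr x.
  have n0 : 0 < n.+1%:R^-1 :> R by rewrite invr_gt0.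
  by have [f Kf Tf] := KT _ n0; exists f.
have /choice[g gP] n : exists g, oc_mem K g /\ adjoint (f n) g.
  by have [g] := oc_adj (fP n).1; exists g.
have gg m n y : nr (g m y - g n y) <= (m.+1%:R^-1 + n.+1%:R^-1) * nr y.
  have a : adjoint (fun x => f m x - f n x) (fun y => g m y - g n y).
    by move=> u v; rewrite adjfBl adjfBr (gP m).2 (gP n).2.
  apply: (adjoint_bounded _ a) => [|x]; first by rewrite addr_ge0 ?invr_ge0.
  rewrite (le_trans (nr_tri (T x) _ _))// nrC mulrDl lerD//; exact: (fP _).2.
have inv_small (e c : R) : 0 < e -> 0 <= c ->
    exists N, forall n, (N <= n)%N -> n.+1%:R^-1 * c <= e.
  move=> e0 c0; have c1 : 0 < c + 1 by rewrite ltr_wpDl.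
  have [N] := ltr_add_invr (divr_gt0 e0 c1); rewrite add0r => hN.
  exists N => n Nn; have : n.+1%:R^-1 <= e / (c + 1).
    by rewrite (le_trans _ (ltW hN))// lef_pV2 ?posrE// ler_nat ltnS.
  move=> h; rewrite (le_trans (ler_wpM2r c0 h))// mulrAC ler_pdivrMr//.
  by rewrite ler_wpM2l ?lerDl// ltW.
have /choice[S SP] y : exists l, cvgs (fun n => g n y) l.
  apply: seq_complete => e e0; have e20 : 0 < e / 2 by rewrite divr_gt0.
  have [N hN] := inv_small (e / 2) (nr y) e20 (nr_ge0 _).
  exists N => m n Nm Nn; rewrite (le_trans (gg _ _ _))// mulrDl [e]splitr lerD//;
  exact: hN.
have gS n y : nr (g n y - S y) <= n.+1%:R^-1 * nr y.
  apply/ler_addgt0Pl => e e0; have e20 : 0 < e / 2 by rewrite divr_gt0.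
  have [N hN] := inv_small (e / 2) (nr y) e20 (nr_ge0 _).
  have [N' hN'] := SP y _ e20.
  have h1 := hN (maxn N N') (leq_maxl _ _); have h2 := hN' (maxn N N') (leq_maxr _ _).
  rewrite (le_trans (nr_tri (g (maxn N N') y) _ _))//.
  rewrite (le_trans (lerD (gg _ _ _) h2))// mulrDl [e in leRHS]splitr.
  by rewrite -addrA addrC lerD2r lerD.
exists S.
  move=> e e0; have [N hN] := inv_small e 1 e0 ler01.
  exists (g N) => [|x]; first exact: (gP N).1.
  rewrite nrC (le_trans (gS _ _))// ler_wpM2r ?nr_ge0//.
  by rewrite -[leLHS]mulr1 hN.
move=> x y; apply: nr_eq => e e0.
have e20 : 0 < e / 2 by rewrite divr_gt0.
have [|N /(_ _ (leqnn N)) hN] := inv_small (e / 2) (nr x * nr y) e20.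
  by rewrite mulr_ge0 ?nr_ge0.
have -> : <| T x, y |> - <| x, S y |> = <| T x - f N x, y |> + <| x, g N y - S y |>.
  by rewrite adjfBl adjfBr (gP N).2 addrA subrK.
rewrite (le_trans (nrD _ _))// (le_trans (lerD (adjf_CS B _ _) (adjf_CS B _ _)))//.
rewrite [e]splitr lerD// (le_trans _ hN)//.
  by rewrite mulrA ler_wpM2r ?nr_ge0//; exact: (fP N).2.
by rewrite mulrCA ler_wpM2l ?nr_ge0.
Qed.

Lemma op_mem0 : op_mem 0.
Proof. exact/op_mem_core/oc0. Qed.

Lemma op_memZD k (f g : E -> E) : op_mem f -> op_mem g -> op_mem (k *: f + g).
Proof.
move=> Kf Kg e e0.
have c0 : 0 < nr k + 1 by rewrite ltr_wpDl// nr_ge0.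
have [|f' Kf' ff'] := Kf (e / (nr k + 1)); first by rewrite divr_gt0.
have [|g' Kg' gg'] := Kg (e / (nr k + 1)); first by rewrite divr_gt0.
exists (k *: f' + g') => [|x]; first exact: ocZD.
have -> : (k *: f + g) x - (k *: f' + g') x = k *: (f x - f' x) + (g x - g' x).
  by rewrite /= scalerBr [RHS]addrACA -opprD.
rewrite (le_trans (nrD _ _))// nrZ.
rewrite (le_trans (lerD (ler_wpM2l (nr_ge0 _) (ff' x)) (gg' x)))//.
rewrite -{2}[e / _ * nr x]mul1r -mulrDl mulrA.
by rewrite [_ * (e / _)]mulrC divfK// gt_eqF.
Qed.

Lemma op_mem_comp f g : op_mem f -> op_mem g -> op_mem (f \o g).
Proof.
move=> Kf Kg e e0.
have [C C0 gC] := op_mem_bd Kg.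
have [|f' Kf' ff'] := Kf (e / 2 / (C + 1)).
  by rewrite !divr_gt0// ltr_wpDl.
have [C' C'0 f'C] := oc_bd Kf'.
have [|g' Kg' gg'] := Kg (e / 2 / (C' + 1)).
  by rewrite !divr_gt0// ltr_wpDl.
exists (f' \o g') => [|x]; first exact: oc_comp.
have -> : (f \o g) x - (f' \o g') x = (f (g x) - f' (g x)) + f' (g x - g' x).
  have := oc_lin Kf' (-1) (g' x) (g x); rewrite !scaleN1r addrC [X in _ = X]addrC => ->.
  by rewrite addrA subrK.
rewrite (le_trans (nrD _ _))// [e]splitr mulrDl lerD//.
  rewrite (le_trans (ff' _))// (le_trans (ler_wpM2l _ (gC x)))//.
    by rewrite !divr_ge0 ?addr_ge0// ltW.
  rewrite mulrA ler_wpM2r ?nr_ge0// mulrAC ler_pdivrMr ?ltr_wpDl//.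
  by rewrite ler_wpM2l ?lerDl// divr_ge0// ltW.
rewrite (le_trans (f'C _))// (le_trans (ler_wpM2l C'0 (gg' x)))//.
have -> : C' * (e / 2 / (C' + 1) * nr x) = e / 2 * C' / (C' + 1) * nr x by ring.
rewrite ler_wpM2r ?nr_ge0// ler_pdivrMr ?ltr_wpDl//.
by rewrite ler_wpM2l ?lerDl// divr_ge0// ltW.
Qed.

Lemma op_closed T : (forall e, 0 < e -> exists2 g, op_mem g &
  forall s, nr (T s - g s) <= e * nr s) -> op_mem T.
Proof.
move=> KT e e0; have e20 : 0 < e / 2 by rewrite divr_gt0.
have [g Kg Tg] := KT _ e20; have [f Kf gf] := Kg _ e20.
exists f => // x; rewrite (le_trans (nr_tri (g x) _ _))//.
by rewrite [e]splitr mulrDl lerD.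
Qed.

Lemma op_mem_bounded f : op_mem f -> exists C, forall s, nr (f s) <= C * nr s.
Proof. by move=> /op_mem_bd[C _ fC]; exists C. Qed.

Definition op_bfspace : bfspace E E := BFSpace (@nr_ge0 R E) op_mem0
  op_memZD op_mem_bounded op_closed.

Definition opalg : Type := bf op_bfspace.

HB.instance Definition _ := CompleteNormedModule.copy opalg (bf op_bfspace).

Definition opval (T : opalg) : E -> E := bf_val T.
Definition mkop (T : E -> E) (KT : op_mem T) : opalg := @mkbf R E E op_bfspace T KT.

Lemma op_valP (T : opalg) : op_mem (opval T).
Proof. exact: (@bf_mem_val R E E op_bfspace T). Qed.

Lemma op_eq (S T : opalg) : opval S =1 opval T -> S = T.
Proof. exact: bf_eq. Qed.

Lemma opvalD (S T : opalg) x : opval (S + T) x = opval S x + opval T x.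
Proof. by []. Qed.
Lemma opvalZ k (S : opalg) x : opval (k *: S) x = k *: opval S x.
Proof. by []. Qed.
Lemma nr_op (T : opalg) x : nr (opval T x) <= nr T * nr x.
Proof. exact: nr_bf. Qed.

Lemma nr_op_le (T : opalg) C : 0 <= C -> (forall x, nr (opval T x) <= C * nr x) ->
  nr T <= C.
Proof. exact: nr_bf_le. Qed.

Lemma oplin (T : opalg) k x y : opval T (k *: x + y) = k *: opval T x + opval T y.
Proof. exact/op_mem_lin/op_valP. Qed.

Lemma op0 (T : opalg) : opval T 0 = 0.
Proof.
have := oplin T (-1) 0 0.
by rewrite scaler0 addr0 scaleN1r addNr.
Qed.

Lemma opD (T : opalg) x y : opval T (x + y) = opval T x + opval T y.
Proof. by have := oplin T 1 x y; rewrite !scale1r. Qed.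

Lemma opZ (T : opalg) k x : opval T (k *: x) = k *: opval T x.
Proof. by have := oplin T k x 0; rewrite !addr0 op0 addr0. Qed.

Lemma opB (T : opalg) x y : opval T (x - y) = opval T x - opval T y.
Proof. by rewrite opD -scaleN1r opZ scaleN1r. Qed.

Definition opmul (S T : opalg) : opalg :=
  mkop (op_mem_comp (op_valP S) (op_valP T)).

Definition opadj_sig (T : opalg) := cid2 (op_mem_adj (op_valP T)).
Definition opadj (T : opalg) : opalg := mkop (s2valP (opadj_sig T)).

Lemma opadjP (T : opalg) : adjoint (opval T) (opval (opadj T)).
Proof. exact: (s2valP' (opadj_sig T)). Qed.

Lemma opadj_eq (T : opalg) (S : opalg) :
  adjoint (opval T) (opval S) -> opadj T = S.
Proof.
by move=> TS; apply: op_eq => y; apply: adjf_inj => x; rewrite -opadjP TS.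
Qed.

Lemma adjoint_sym f g : adjoint f g -> adjoint g f.
Proof. by move=> fg x y; rewrite adjfC -fg -adjfC. Qed.

Let opmulA : associative opmul.
Proof. by move=> x y z; apply: op_eq. Qed.

Let opmulDl : left_distributive opmul +%R.
Proof. by move=> x y z; apply: op_eq => u. Qed.

Let opmulDr : right_distributive opmul +%R.
Proof. by move=> x y z; apply: op_eq => u; exact: opD. Qed.

Let opmulZl k x y : opmul (k *: x) y = k *: opmul x y.
Proof. by apply: op_eq => u. Qed.

Let opmulZr k x y : opmul x (k *: y) = k *: opmul x y.
Proof. by apply: op_eq => u; exact: opZ. Qed.

Let opadjK : involutive opadj.
Proof. by move=> T; apply: opadj_eq; apply: adjoint_sym; exact: opadjP. Qed.

Let opadjD : {morph opadj : x y / x + y}.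
Proof.
move=> S T; apply: opadj_eq => x y.
by rewrite !opvalD adjfDl adjfDr !opadjP.
Qed.

Let opadjZ (k : R[i]) T : opadj (k *: T) = Num.conj k *: opadj T.
Proof. by apply: opadj_eq => x y; rewrite !opvalZ adjfZ opadjP opZ. Qed.

Let opadjM S T : opadj (opmul S T) = opmul (opadj T) (opadj S).
Proof. by apply: opadj_eq => x y; rewrite /= /opval/= !opadjP. Qed.

Let norm_opmul S T : `|opmul S T| <= `|S| * `|T|.
Proof.
rewrite !nrE -rmorphM/= lecR; apply: nr_op_le => [|x].
  by rewrite mulr_ge0 ?nr_ge0.
rewrite (le_trans (nr_op S _))// -mulrA ler_wpM2l ?nr_ge0//; exact: nr_op.
Qed.

Let norm_opadj_le T : nr (opadj T) <= nr T.
Proof.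
apply: nr_op_le; first exact: nr_ge0.
apply: (adjoint_bounded (nr_ge0 _) (opadjP T)) => x; exact: nr_op.
Qed.

Let norm_opcstar T : `|opmul (opadj T) T| = `|T| ^+ 2.
Proof.
rewrite !nrE -rmorphXn; congr (_%:C); apply/eqP; rewrite eq_le; apply/andP; split.
  have := norm_opmul (opadj T) T; rewrite !nrE -rmorphM lecR => /le_trans -> //.
  by rewrite expr2 ler_wpM2r ?nr_ge0// norm_opadj_le.
(* Here [|T x|^2] is the norm of [<x, T^* T x>], hence at most [N |x|^2]. *)
set N := nr (opmul _ _); have N0 : 0 <= N by exact: nr_ge0.
rewrite -[leRHS](sqr_sqrtr N0) ler_sqr ?nnegrE ?nr_ge0 ?sqrtr_ge0//.
apply: nr_op_le => [|x]; first exact: sqrtr_ge0.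
rewrite -ler_sqr ?nnegrE ?mulr_ge0 ?sqrtr_ge0 ?nr_ge0// exprMn sqr_sqrtr//.
rewrite -(adjf_xx B) opadjP (le_trans (adjf_CS B _ _))//.
rewrite mulrC expr2 mulrA ler_wpM2r ?nr_ge0//; exact: (nr_op (opmul (opadj T) T)).
Qed.

HB.instance Definition _ := isCStarAlgebra.Build R opalg opmulA opmulDl opmulDr
  opmulZl opmulZr opadjK opadjD opadjZ opadjM norm_opmul norm_opcstar.

Lemma opval_star (T : opalg) : adjoint (opval T) (opval (star T)).
Proof. exact: opadjP. Qed.

Lemma star_op_eq (S T : opalg) : adjoint (opval T) (opval S) -> star T = S.
Proof. exact: opadj_eq. Qed.

End Operators.

(** * Completion of a pre-Hilbert space *)

Section Polarization.
Context (R : realType) (V : lmodType R[i]) (f : psd_form V).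
Context (E : normedModType R[i]) (j : V -> E).
Hypothesis jZD : forall k u v, j (k *: u + v) = k *: j u + j v.
Hypothesis jnorm : forall u, `|j u| ^+ 2 = form f u u.
Hypothesis jdense : forall (x : E) (e : R), 0 < e -> exists u, nr (x - j u) <= e.

Let j0 : j 0 = 0.
Proof.
have := jZD (-1) 0 0.
by rewrite scaler0 addr0 scaleN1r addNr.
Qed.

Let jD u v : j (u + v) = j u + j v.
Proof. by have := jZD 1 u v; rewrite !scale1r. Qed.

Let jZ k u : j (k *: u) = k *: j u.
Proof. by have := jZD k u 0; rewrite !addr0 j0 addr0. Qed.

Let jN u : j (- u) = - j u.
Proof. by rewrite -scaleN1r jZ scaleN1r. Qed.

Lemma dense_eq (F G : E -> R[i]^o) : continuous F -> continuous G ->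
  (forall u, F (j u) = G (j u)) -> forall x, F x = G x.
Proof.
move=> cF cG FG x; apply/eqP; rewrite -subr_eq0; apply/eqP.
have : closed ((fun x => F x - G x) @^-1` [set 0]).
  apply: closed_comp.
    by move=> y _; apply: cvgB; [exact: cF|exact: cG].
  exact/accessible_closed_set1/hausdorff_accessible/norm_hausdorff.
move=> /closed_nr; apply => e /(jdense x)[u xu]; exists (j u) => //=.
by rewrite FG subrr.
Qed.

(** The completion first carries only a norm. Its inner product is read off from the norm by
    polarization, which is visibly continuous; on the image of [V] it is the given form. *)
Definition polar (x y : E) : R[i] := 4^-1 * (`|x + y| ^+ 2 - `|x - y| ^+ 2 +
  'i%C * `|x + 'i%C *: y| ^+ 2 - 'i%C * `|x - 'i%C *: y| ^+ 2).

Lemma polar_emb u v : polar (j u) (j v) = form f u v.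
Proof.
have nE w : `|j w| ^+ 2 = form f w w.
  exact: jnorm.
rewrite /polar -!jZ -!jN -!jD !nE !(formDl, formDr, formNl, formNr).
rewrite !(formZl, formZr).
have i1 : 'i%C * 'i%C = -1 :> R[i] by rewrite -expr2 sqr_i.
have -> : ('i^*)%C = - 'i%C :> R[i] by apply/eqP; rewrite eq_complex/= oppr0 !eqxx.
set a := form f u u; set b := form f u v; set c := form f v u; set d := form f v v.
rewrite [_ + 'i%C * _ - 'i%C * _](_ : _ = (2 * b + 2 * c) + 2 * (- ('i%C * 'i%C) * b + 'i%C * 'i%C * c)).
  rewrite i1 opprK.
  have -> : 2 * b + 2 * c + 2 * (1 * b + -1 * c) = 4 * b by ring.
  by rewrite mulrA mulVf ?mul1r// pnatr_eq0.
by ring.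
Qed.

Lemma polar_contl y : continuous (fun x => polar x y : R[i]^o).
Proof.
move=> x; apply: cvgM; first exact: cvg_cst.
apply: cvgB; first apply: cvgD; first apply: cvgB.
- apply: cvgM; (apply: cvg_norm; apply: cvgD; [exact: cvg_id|exact: cvg_cst]).
- apply: cvgM; (apply: cvg_norm; apply: cvgB; [exact: cvg_id|exact: cvg_cst]).
- apply: cvgM; first exact: cvg_cst.
  apply: cvgM; (apply: cvg_norm; apply: cvgD; [exact: cvg_id|exact: cvg_cst]).
- apply: cvgM; first exact: cvg_cst.
  apply: cvgM; (apply: cvg_norm; apply: cvgB; [exact: cvg_id|exact: cvg_cst]).
Qed.

Let normri (x : E) : `|'i%C *: x| = `|x|.
Proof.
rewrite normrZ [X in X * _](_ : _ = 1) ?mul1r//.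
by rewrite normc_def/= expr0n expr1n/= add0r sqrtr1.
Qed.

Let i2 : 'i%C * 'i%C = -1 :> R[i].
Proof. by rewrite -expr2 sqr_i. Qed.

Lemma polar_conj x y : polar y x = (polar x y)^*%C.
Proof.
have nJ (z : E) : ((`|z| ^+ 2)^* = `|z| ^+ 2)%C.
  have -> : `|z| ^+ 2 = (nr z ^+ 2)%:C by rewrite nrE rmorphXn.
  exact: conjc_real.
have e1 : `|y + 'i%C *: x| = `|x - 'i%C *: y|.
  rewrite -[RHS]normri; congr `|_|.
  by rewrite scalerBr scalerA i2 scaleN1r opprK addrC.
have e2 : `|y - 'i%C *: x| = `|x + 'i%C *: y|.
  rewrite -[RHS]normri -normrN; congr `|_|.
  by rewrite scalerDr scalerA i2 scaleN1r opprB addrC.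
have iJ : ('i^*)%C = - 'i%C :> R[i] by apply/eqP; rewrite eq_complex/= oppr0 !eqxx.
have h4 : ((4^-1)^*)%C = 4^-1 :> R[i].
  by rewrite (_ : 4^-1 = (4^-1 : R)%:C) ?conjc_real// fmorphV rmorph_nat.
rewrite /polar e1 e2 (addrC y x) -[`|y - x|]distrC.
rewrite conjM h4 !(conjD, conjN) ![(('i * _)^*)%C]conjM !nJ iJ.
by ring.
Qed.

Lemma polar_contr x : continuous (fun y => polar x y : R[i]^o).
Proof.
rewrite (_ : (fun y => _) = fun y => (polar y x)^*%C); last first.
  by apply/funext => y; rewrite polar_conj.
move=> y; apply: (@continuous_comp _ _ _ (fun y => polar y x : R[i]^o)
  (fun a : R[i]^o => a^*%C : R[i]^o)); first exact: polar_contl.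
apply: (@continuous_nr R R[i]^o R[i]^o _ 1) => a b.
have -> : (a^*%C - b^*%C : R[i]^o) = (a - b : R[i])^*%C by rewrite conjD conjN.
by rewrite mul1r nr_conj.
Qed.

Lemma polar_norm x : `|x| ^+ 2 = polar x x.
Proof.
have -> : polar x x = 4^-1 * (`|x + x| ^+ 2).
  rewrite /polar subrr normr0 expr0n/= subr0.
  suff -> : `|x - 'i%C *: x| = `|x + 'i%C *: x| by rewrite addrK.
  by rewrite -[LHS]normri scalerBr scalerA i2 scaleN1r opprK addrC.
have -> : x + x = (2 : R[i]) *: x by rewrite scaler_nat mulr2n.
by rewrite normrZ normr_nat exprMn mulrA -natrX mulVf ?mul1r// pnatr_eq0.
Qed.

(** On the dense image of [V] this is linearity of the form, by [polar_emb]; the three variables are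
    then freed one at a time by continuity. *)
Lemma polar_linearl k x y z : polar (k *: x + y) z = k * polar x z + polar y z.
Proof.
have cl w : continuous (fun x => (k * polar x w : R[i]^o)).
  by move=> t; apply: cvgM; [exact: cvg_cst|exact: polar_contl].
have cA (F : E -> E) w : continuous F ->
    continuous (fun x => polar (F x) w : R[i]^o).
  move=> cF t; apply: (@continuous_comp _ _ _ F (fun x => polar x w : R[i]^o)).
    exact: cF.
  exact: polar_contl.
move: z; apply: dense_eq; first exact: polar_contr.
  move=> t; apply: cvgD; last exact: polar_contr.
  by apply: cvgM; [exact: cvg_cst|exact: polar_contr].
move=> w; move: y; apply: dense_eq.
- by apply: cA => t; apply: cvgD; [exact: cvg_cst|exact: cvg_id].
- by move=> t; apply: cvgD; [exact: cvg_cst|exact: polar_contl].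
move=> v; move: x; apply: dense_eq.
- apply: cA => t; apply: cvgD; last exact: cvg_cst.
  by apply: cvgZr; exact: cvg_id.
- by move=> t; apply: cvgD; [exact: cl|exact: cvg_cst].
by move=> u; rewrite -jZD !polar_emb form_linearl.
Qed.

End Polarization.

Section Completion.
Context (R : realType) (V : lmodType R[i]) (f : psd_form V).

Definition fnorm (v : V) : R := Num.sqrt (fnorm2 f v).

Lemma fnorm_ge0 v : 0 <= fnorm v.
Proof. exact: sqrtr_ge0. Qed.

Lemma fnormK v : fnorm v ^+ 2 = fnorm2 f v.
Proof. by rewrite sqr_sqrtr// form_ge0. Qed.

Lemma form_CSn u v : nr (form f u v) <= fnorm u * fnorm v.
Proof.
rewrite -ler_sqr ?nnegrE ?nr_ge0 ?mulr_ge0 ?fnorm_ge0//.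
by rewrite exprMn !fnormK form_CS.
Qed.

(** A vector of the completion is recorded by its inner products with the elements of [V], as a
    limit of functionals [form f u]. Null vectors of the form give the zero functional, so the
    quotient by them is automatic. *)
Definition compl_mem (g : V -> Cplx R) := forall e : R, 0 < e ->
  exists u, forall v, nr (g v - (form f u v : Cplx R)) <= e * fnorm v.

Lemma compl_mem_form u : compl_mem (form f u).
Proof.
move=> e e0; exists u => v; rewrite subrr nr0 mulr_ge0 ?fnorm_ge0//.
exact: ltW.
Qed.

Lemma compl_mem0 : compl_mem 0.
Proof.
move=> e e0; exists 0 => v.
by rewrite form0l subrr nr0 mulr_ge0 ?fnorm_ge0// ltW.
Qed.

Lemma compl_memZD (k : R[i]) (g h : V -> Cplx R) :
  compl_mem g -> compl_mem h -> compl_mem (k *: g + h).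
Proof.
move=> Mg Mh e e0.
have c0 : 0 < nr k + 1 by rewrite ltr_wpDl// nr_ge0.
have [u gu] := Mg _ (divr_gt0 e0 c0); have [u' hu] := Mh _ (divr_gt0 e0 c0).
exists (k *: u + u') => v.
have -> : (k *: g + h) v - (form f (k *: u + u') v : Cplx R) =
    k *: (g v - (form f u v : Cplx R)) + (h v - (form f u' v : Cplx R)).
  by rewrite form_linearl scalerBr [RHS]addrACA -opprD.
rewrite (le_trans (nrD _ _))// nrZ.
rewrite (le_trans (lerD (ler_wpM2l (nr_ge0 _) (gu v)) (hu v)))//.
rewrite -{2}[e / _ * fnorm v]mul1r -mulrDl mulrA.
by rewrite [_ * (e / _)]mulrC divfK// gt_eqF.
Qed.

Lemma compl_mem_bounded (g : V -> Cplx R) : compl_mem g ->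
  exists C, forall v, nr (g v) <= C * fnorm v.
Proof.
move=> /(_ 1 ltr01)[u gu]; exists (1 + fnorm u) => v.
rewrite -[g v](subrK (form f u v : Cplx R)) (le_trans (nrD _ _))// mulrDl.
by rewrite lerD// form_CSn.
Qed.

Lemma compl_mem_closed (g : V -> Cplx R) :
  (forall e, 0 < e -> exists2 h, compl_mem h &
    forall v, nr (g v - h v) <= e * fnorm v) -> compl_mem g.
Proof.
move=> Mg e e0; have e20 : 0 < e / 2 by rewrite divr_gt0.
have [h Mh gh] := Mg _ e20; have [u hu] := Mh _ e20.
exists u => v; rewrite (le_trans (nr_tri (h v) _ _))//.
by rewrite [e]splitr mulrDl lerD.
Qed.

Definition compl_bfspace : bfspace V (Cplx R) := BFSpace fnorm_ge0 compl_mem0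
  compl_memZD compl_mem_bounded compl_mem_closed.

Definition hcompl : Type := bf compl_bfspace.

HB.instance Definition _ := CompleteNormedModule.copy hcompl (bf compl_bfspace).

Implicit Types (x y z : hcompl) (u v w : V).

Definition hval x : V -> Cplx R := bf_val x.

Definition mkh (g : V -> Cplx R) (Mg : compl_mem g) : hcompl :=
  @mkbf R V (Cplx R) compl_bfspace g Mg.

Lemma hval_mem x : compl_mem (hval x).
Proof. exact: (@bf_mem_val R V (Cplx R) compl_bfspace x). Qed.

Lemma hval_eq x y : hval x =1 hval y -> x = y.
Proof. exact: bf_eq. Qed.

Lemma hvalZD k x y v : hval (k *: x + y) v = k *: hval x v + hval y v.
Proof. by rewrite /hval bf_valD bf_valZ. Qed.

Lemma hvalB x y v : hval (x - y) v = hval x v - hval y v.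
Proof. exact: (@bf_valB _ _ _ compl_bfspace x y v). Qed.

Lemma hval_mkh (g : V -> Cplx R) (Mg : compl_mem g) : hval (mkh Mg) = g.
Proof. by []. Qed.

Lemma nr_hval x v : nr (hval x v) <= nr x * fnorm v.
Proof. exact: (nr_bf (D := compl_bfspace)). Qed.

Lemma nr_hle x C : 0 <= C -> (forall v, nr (hval x v) <= C * fnorm v) -> nr x <= C.
Proof. exact: (nr_bf_le (D := compl_bfspace)). Qed.

Definition hemb u : hcompl := mkh (compl_mem_form u).

Lemma hembZD k u v : hemb (k *: u + v) = k *: hemb u + hemb v.
Proof. by apply: hval_eq => w; exact: form_linearl. Qed.

Lemma hembD u v : hemb (u + v) = hemb u + hemb v.
Proof. by apply: hval_eq => w; exact: formDl. Qed.

Lemma hembZ k u : hemb (k *: u) = k *: hemb u.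
Proof. by apply: hval_eq => w; exact: formZl. Qed.

Lemma nr_hemb u : nr (hemb u) = fnorm u.
Proof.
apply/eqP; rewrite eq_le nr_hle ?fnorm_ge0//=; last first.
  by move=> v; exact: form_CSn.
have [->|u0] := eqVneq (fnorm u) 0; first exact: nr_ge0.
have {}u0 : 0 < fnorm u by rewrite lt0r u0 fnorm_ge0.
rewrite -(ler_pM2r u0) -expr2 fnormK (le_trans _ (nr_hval _ _))//.
by rewrite /hval/= formxx nr_real ger0_norm ?lexx// form_ge0.
Qed.

Lemma hemb_norm u : `|hemb u| ^+ 2 = form f u u.
Proof. by rewrite nrE nr_hemb -rmorphXn/= fnormK formxx. Qed.

Lemma hemb_dense x (e : R) : 0 < e -> exists u, nr (x - hemb u) <= e.
Proof.
move=> e0; have [u xu] := hval_mem x e0.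
by exists u; apply: nr_hle; [exact: ltW|exact: xu].
Qed.

HB.instance Definition _ := isHilbert.Build R hcompl
  (polar_linearl hembZD hemb_norm hemb_dense) (@polar_conj R hcompl)
  (@polar_norm R hcompl).

Lemma inner_hemb u v : inner (hemb u) (hemb v) = form f u v.
Proof. exact: (polar_emb hembZD hemb_norm). Qed.

Section Operator.
Variables (L L' : V -> V) (C : R).
Hypothesis LL' : forall u v, form f (L u) v = form f u (L' v).
Hypothesis L'C : forall v, fnorm (L' v) <= C * fnorm v.

Lemma hop_mem x : compl_mem (fun v => hval x (L' v)).
Proof.
move=> e e0; have c0 : 0 < `|C| + 1 by rewrite ltr_wpDl.
have [u xu] := hval_mem x (divr_gt0 e0 c0).
exists (L u) => v; rewrite LL' (le_trans (xu _))//.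
have ec0 : 0 <= e / (`|C| + 1) by rewrite divr_ge0 ?ltW.
rewrite (le_trans (ler_wpM2l ec0 (L'C v)))// mulrA ler_wpM2r ?fnorm_ge0//.
rewrite mulrAC ler_pdivrMr// ler_wpM2l ?(ltW e0)//.
by rewrite (le_trans (ler_norm _))// lerDl.
Qed.

(** From [<L x, v> = <x, L' v>]: an operator acts on the functionals of the completion by
    precomposition with its formal adjoint, and only the bound on that adjoint enters. *)
Definition hop x : hcompl := mkh (hop_mem x).

Lemma hval_hop x v : hval (hop x) v = hval x (L' v).
Proof. by rewrite hval_mkh. Qed.

Lemma hop_linear k x y : hop (k *: x + y) = k *: hop x + hop y.
Proof. by apply: hval_eq => v; rewrite !(hvalZD, hval_hop). Qed.

Lemma hop_hemb u : hop (hemb u) = hemb (L u).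
Proof. by apply: hval_eq => v; rewrite hval_hop !hval_mkh LL'. Qed.

Lemma nr_hop x : nr (hop x) <= `|C| * nr x.
Proof.
apply: nr_hle => [|v]; first by rewrite mulr_ge0 ?nr_ge0.
rewrite (le_trans (nr_hval x (L' v)))//.
have -> : `|C| * nr x * fnorm v = nr x * (`|C| * fnorm v) by ring.
rewrite ler_wpM2l ?nr_ge0// (le_trans (L'C _))//.
by rewrite ler_wpM2r ?fnorm_ge0// ler_norm.
Qed.

Lemma hopB x y : hop (x - y) = hop x - hop y.
Proof. by apply: hval_eq => v; rewrite !(hvalB, hval_hop). Qed.

End Operator.

Lemma hcompl_eq (F G : hcompl -> R[i]) :
  (exists C, forall x y, nr (F x - F y) <= C * nr (x - y)) ->
  (exists C, forall x y, nr (G x - G y) <= C * nr (x - y)) ->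
  (forall u, F (hemb u) = G (hemb u)) -> forall x, F x = G x.
Proof.
move=> [C FC] [D GD]; apply: (dense_eq hemb_dense); exact: continuous_nr.
Qed.

Lemma hop_adj (L L' : V -> V) (C C' : R) LL' L'C L'L LC x y :
  inner (@hop L L' C LL' L'C x) y = inner x (@hop L' L C' L'L LC y).
Proof.
have iL z : exists C, forall x y, nr ((inner x z : R[i]) - inner y z) <= C * nr (x - y).
  by exists (nr z) => s t; rewrite -innerBl mulrC inner_CS.
have iR z : exists C, forall x y, nr ((inner z x : R[i]) - inner z y) <= C * nr (x - y).
  by exists (nr z) => s t; rewrite -innerBr inner_CS.
have opL z : exists C0, forall s t : hcompl,
    nr ((inner (hop LL' L'C s) z : R[i]) - inner (hop LL' L'C t) z) <= C0 * nr (s - t).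
  exists (nr z * `|C|) => s t; rewrite -innerBl (le_trans (inner_CS _ _))//.
  by rewrite -hopB mulrC -mulrA ler_wpM2l ?nr_ge0// nr_hop.
have opR z : exists C0, forall s t : hcompl,
    nr ((inner z (hop L'L LC s) : R[i]) - inner z (hop L'L LC t)) <= C0 * nr (s - t).
  exists (nr z * `|C'|) => s t; rewrite -innerBr (le_trans (inner_CS _ _))//.
  by rewrite -hopB -mulrA ler_wpM2l ?nr_ge0// nr_hop.
apply: (@hcompl_eq (fun x => inner (hop LL' L'C x) y)
  (fun x => inner x (hop L'L LC y)) (opL y) (iL _)) => u.
apply: (@hcompl_eq (fun y => inner (hop LL' L'C (hemb u)) y)
  (fun y => inner (hemb u) (hop L'L LC y)) (iR _) (opR _)) => v.
by rewrite !hop_hemb !inner_hemb LL'.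
Qed.

End Completion.

(** * Multipliers and a spectral element *)

Section Multipliers.
Context (R : realType) (A : cstarAlgType R).
Implicit Types x y z : A.
Local Notation "x ** y" := (cmul x y) (at level 40, left associativity).

Lemma mult_formDl x y z : star (x + y) ** z = star x ** z + star y ** z.
Proof. by rewrite starD cmulDl. Qed.
Lemma mult_formDr x y z : star z ** (x + y) = star z ** x + star z ** y.
Proof. by rewrite cmulDr. Qed.
Lemma mult_formC x y : star y ** x = star (star x ** y).
Proof. by rewrite starM starK. Qed.
Lemma mult_formZ (k : R[i]) x y : star (k *: x) ** y = star x ** (k^*%C *: y).
Proof. by rewrite starZ cmulZl cmulZr. Qed.
Lemma mult_form_CS x y : nr (star x ** y) <= nr x * nr y.
Proof. by rewrite (le_trans (nr_cmul _ _))// nr_star. Qed.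

(** [A] as a Hilbert module over itself; the algebra of its adjointable operators provides the unit
    for the functional calculus. *)
Definition mult_form : adj_form A := AdjForm mult_formC mult_formDl mult_formDr
  mult_formZ (@nr_cstar R A) mult_form_CS.

Definition multiplier (f : A -> A) :=
  [/\ forall (k : R[i]) x y, f (k *: x + y) = k *: f x + f y,
      exists2 C, 0 <= C & op_bounded f C & exists g, adjoint mult_form f g].

Lemma multiplier0 : multiplier 0.
Proof.
split.
- by move=> k x y; rewrite /= scaler0 addr0.
- by exists 0 => // x; rewrite /= nr0 mul0r.
- by exists 0 => x y; rewrite /= star0 cmul0x cmulx0.
Qed.

Lemma multiplierZD (k : R[i]) (f g : A -> A) :
  multiplier f -> multiplier g -> multiplier (k *: f + g).
Proof.
move=> [fl [C C0 fC] [f' ff']] [gens [D D0 gD] [g' gg']]; split.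
- move=> l x y.
  change (k *: f (l *: x + y) + g (l *: x + y) =
    l *: (k *: f x + g x) + (k *: f y + g y)).
  rewrite fl gens !scalerDr !scalerA.
  by rewrite (mulrC l k) addrACA.
- exists (nr k * C + D) => [|x]; first by rewrite addr_ge0 ?mulr_ge0 ?nr_ge0.
  rewrite (le_trans (nrD _ _))// mulrDl lerD//.
  by rewrite -mulrA (nrZ k (f x)) ler_wpM2l ?nr_ge0.
- exists (k^*%C *: f' + g') => x y.
  have h1 : star (f x) ** y = star x ** f' y := ff' x y.
  have h2 : star (g x) ** y = star x ** g' y := gg' x y.
  change (star (k *: f x + g x) ** y = star x ** (k^*%C *: f' y + g' y)).
  by rewrite starD starZ cmulDl cmulZl cmulDr cmulZr h1 h2.
Qed.

Lemma multiplier_comp (f g : A -> A) :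
  multiplier f -> multiplier g -> multiplier (f \o g).
Proof.
move=> [fl [C C0 fC] [f' ff']] [gens [D D0 gD] [g' gg']]; split.
- by move=> k x y /=; rewrite gens fl.
- exists (C * D) => [|x]; first by rewrite mulr_ge0.
  by rewrite /= (le_trans (fC _))// -mulrA ler_wpM2l.
- by exists (g' \o f') => x y; rewrite [LHS]ff' gg'.
Qed.

Lemma multiplier_adj (f : A -> A) : multiplier f ->
  exists2 g, multiplier g & adjoint mult_form f g.
Proof.
move=> [fl [C C0 fC] [g fg]]; exists g => //; split.
- move=> k x y; apply: (@adjf_inj _ _ mult_form) => z.
  have fg' u v : star (f u) ** v = star u ** g v := fg u v.
  change (star z ** g (k *: x + y) = star z ** (k *: g x + g y)).
  by rewrite cmulDr cmulZr -!fg' cmulDr cmulZr.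
- by exists C => //; exact: adjoint_bounded fg fC.
- by exists f; exact: adjoint_sym.
Qed.

Lemma multiplier_lin (f : A -> A) : multiplier f ->
  forall (k : R[i]) x y, f (k *: x + y) = k *: f x + f y.
Proof. by case. Qed.

Lemma multiplier_bd (f : A -> A) : multiplier f ->
  exists2 C, 0 <= C & op_bounded f C.
Proof. by case. Qed.

Definition mult_core : opcore mult_form := OpCore multiplier0 multiplierZD
  multiplier_comp multiplier_adj multiplier_lin multiplier_bd.

Definition mult_alg : cstarAlgType R := opalg mult_core.

Lemma multiplier_id : multiplier idfun.
Proof.
split=> //; first by exists 1 => // x; rewrite mul1r.
by exists idfun.
Qed.

Lemma multiplier_lmul a : multiplier (cmul a).
Proof.
split.
- by move=> k x y; rewrite cmulDr cmulZr.
- by exists (nr a) => [|x]; [exact: nr_ge0|exact: nr_cmul].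
- by exists (cmul (star a)) => x y; rewrite /= starM cmulA.
Qed.

Definition mult1 : mult_alg := mkop (@op_mem_core _ _ _ mult_core _ multiplier_id).
Definition lmul a : mult_alg :=
  mkop (@op_mem_core _ _ _ mult_core _ (multiplier_lmul a)).
Definition mval (m : mult_alg) : A -> A := opval m.

Lemma mval1 x : mval mult1 x = x. Proof. by []. Qed.
Lemma mval_lmul a x : mval (lmul a) x = a ** x. Proof. by []. Qed.
Lemma mvalM (m n : mult_alg) x : mval (cmul m n) x = mval m (mval n x).
Proof. by []. Qed.
Lemma mvalD (m n : mult_alg) x : mval (m + n) x = mval m x + mval n x.
Proof. by []. Qed.
Lemma mval_eq (m n : mult_alg) : mval m =1 mval n -> m = n.
Proof. exact: op_eq. Qed.
Lemma mval_star (m : mult_alg) x y :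
  star (mval m x) ** y = star x ** mval (star m) y.
Proof. exact: (opval_star m x y). Qed.
Lemma star_mult_eq (m n : mult_alg) :
  (forall x y, star (mval m x) ** y = star x ** mval n y) -> star m = n.
Proof. by move=> mn; exact: (@star_op_eq R A mult_form mult_core n m mn). Qed.
Lemma nr_mval_le (m : mult_alg) C : 0 <= C ->
  (forall x, nr (mval m x) <= C * nr x) -> nr m <= C.
Proof. exact: nr_op_le. Qed.

Lemma star_mult1 : star mult1 = mult1.
Proof. exact: star_mult_eq. Qed.

Lemma star_lmul a : star (lmul a) = lmul (star a).
Proof. by apply: star_mult_eq => x y; rewrite !mval_lmul starM cmulA. Qed.

Lemma mul1m (m : mult_alg) : cmul mult1 m = m.
Proof. exact: mval_eq. Qed.
Lemma mulm1 (m : mult_alg) : cmul m mult1 = m.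
Proof. exact: mval_eq. Qed.

(* [c + i s] is a unitary whose real part is [c]. *)
Lemma unitary_part (c s : mult_alg) : star c = c -> star s = s ->
  cmul c s = cmul s c -> cmul c c + cmul s s = mult1 -> nr c <= 1.
Proof.
move=> cs ss comm cssq.
have isom (k : R[i]) x : (k^* = - k)%C -> k * k = -1 ->
    nr (mval c x + k *: mval s x) = nr x.
  move=> kJ k2; apply/eqP; rewrite -(@eqrXn2 _ 2) ?nr_ge0//; apply/eqP.
  rewrite -!nr_cstar; congr nr.
  rewrite starD starZ cmulDl !cmulDr !cmulZl !cmulZr !mval_star cs ss.
  rewrite -!mvalM comm scalerA; have -> : Num.conj k = - k by exact: kJ.
  rewrite mulNr k2 opprK scale1r scaleNr addrA addrK.
  by rewrite -cmulDr -mvalD cssq mval1.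
apply: nr_mval_le => // x; rewrite mul1r.
have i2 : 'i%C * 'i%C = -1 :> R[i] by rewrite -expr2 sqr_i.
have iJ : ('i^*)%C = - 'i%C :> R[i] by apply/eqP; rewrite eq_complex/= oppr0 !eqxx.
have h1 := isom 'i%C x iJ i2.
have h2 : nr (mval c x - 'i%C *: mval s x) = nr x.
  rewrite -scaleNr isom//; last by rewrite mulrNN.
  by rewrite conjN iJ.
have : nr ((2 : R[i]) *: mval c x) <= nr x + nr x.
  rewrite -{1}h1 -h2 (le_trans _ (nrD _ _))//.
  by rewrite addrACA subrr addr0 scaler_nat mulr2n.
have n2 : nr (2 : R[i]) = 2.
  by rewrite -[LHS]/(nr (2%:R : R[i])) -(rmorph_nat (real_complex R)) nr_real ger0_norm.
rewrite nrZ n2.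
by move=> ?; clear n2; lra.
Qed.

End Multipliers.

Section SpectralElement.
Context (R : realType) (A : cstarAlgType R).
Local Notation "x ** y" := (cmul x y) (at level 40, left associativity).

(* [x] is [2 s^+ h] with [h = d^* d] and [s = h - eps], where [2 s^+] is [s] plus the
   square root of [s^2]. *)
Lemma spectral_element (d : A) (eps : R) : nr d <= 2^-1 -> 0 < eps <= 2^-1 ->
  exists x : A, forall (H : hilbertType R) (pi : A -> H -> H),
    star_representation pi ->
    (forall v, pi x v = 0) <-> (forall v, nr (pi d v) ^+ 2 <= eps * nr v ^+ 2).
Proof.
move=> d1 /andP[eps0 eps1].
pose h := star d ** d.
have hs : star h = h by rewrite starM starK.
pose s : mult_alg A := lmul h - eps%:C *: mult1 A.
have sE y : mval s y = h ** y - eps%:C *: y by [].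
have ss : star s = s by rewrite starB starZr star_lmul star_mult1 hs.
have s1 : nr s <= 1.
  apply: nr_mval_le => // y; rewrite sE (le_trans (nrB _ _))//.
  rewrite (le_trans (lerD (nr_cmul _ _) (lexx _)))// nr_cstar nrZr gtr0_norm//.
  rewrite -mulrDl ler_wpM2r ?nr_ge0//.
  have : nr d ^+ 2 <= 2^-1 ^+ 2 by rewrite ler_sqr ?nnegrE ?nr_ge0.
  by move=> ?; lra.
clearbody s.
have [|b1 [b1E _ b1c b1s]] := @sqrt_exists R (mult_alg A) (cmul s s).
  by rewrite (le_trans (nr_cmul _ _))// mulr_ile1 ?nr_ge0.
have {}b1s : star b1 = b1 by apply: b1s; rewrite starM ss.
have {}b1c : cmul s b1 = cmul b1 s by apply: b1c; rewrite cmulA.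
have comp1 (b : mult_alg A) : cmul (mult1 A - b) (mult1 A - b) =
    mult1 A - (b + b - cmul b b).
  by rewrite cmulBl !cmulBr !mul1m mulm1 -addrA -opprD addrA.
(* [c] is [sqrt (1 - s^2)]. The absolute value of [s] will be [sqrt (1 - u)] with
   [u = 1 - s^2 = c^2], and [sqrt_exists] wants the norm of this [u] to be at most 1; [unitary_part]
   gives that through [c]. *)
pose c := mult1 A - b1.
have c1 : nr c <= 1.
  apply: (@unitary_part _ _ c s) => //.
  - by rewrite /c starB star_mult1 b1s.
  - by rewrite /c cmulBl cmulBr mul1m mulm1 b1c.
  - by rewrite comp1 b1E subrK.
have [|b2 [b2E b21 b2c b2s]] := @sqrt_exists R (mult_alg A) (cmul c c).
  by rewrite (le_trans (nr_cmul _ _))// mulr_ile1 ?nr_ge0.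
have cs : star c = c by rewrite starB star_mult1 b1s.
have {}b2s : star b2 = b2 by apply: b2s; rewrite starM cs.
have sc : cmul s c = cmul c s by rewrite /c cmulBl cmulBr mul1m mulm1 b1c.
have {}b2c : cmul s b2 = cmul b2 s.
  by apply: b2c; rewrite cmulA sc -cmulA sc cmulA.
(* [B = 1 - b2] is the absolute value of [s]. Its own square root [B3] serves to witness
   positivity. *)
have [|b3 [b3E _ _ b3s]] := @sqrt_exists R (mult_alg A) b2; first by [].
have {}b3s := b3s b2s.
pose B := mult1 A - b2; pose B3 := mult1 A - b3.
have B3s : star B3 = B3 by rewrite starB star_mult1 b3s.
have B3B3 : cmul B3 B3 = B by rewrite comp1 b3E.
have Bs : star B = B by rewrite starB star_mult1 b2s.
have BB : cmul B B = cmul s s.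
  by rewrite comp1 b2E comp1 b1E opprB addrC subrK.
have Bsc : cmul B s = cmul s B by rewrite /B cmulBl cmulBr mul1m mulm1 b2c.
clearbody B B3.
pose x := mval (B + s) h.
(* Since [(B - s) (B + s) = 0], on the range of [x] the element [s] acts as its absolute value. *)
have Bx : mval B x = mval s x.
  rewrite /x -!mvalM; congr (mval _ _).
  by rewrite !cmulDr BB Bsc addrC.
have posB y : star (mval B3 y) ** mval B3 y = star y ** mval B y.
  by rewrite mval_star B3s -mvalM B3B3.
exists x => H pi pir.
(* Multipliers do not act on [H], but [(m y)^* (m y) = y^* (m^* m y)] shows that the kernel of [pi]
   is stable under them. *)
have pi_m (m : mult_alg A) y : (forall v, pi y v = 0) -> forall v, pi (mval m y) v = 0.
  move=> y0 v; apply: nr_le0; rewrite -(@ler_sqr R) ?nnegrE ?nr_ge0// expr0n/=.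
  rewrite -lecR -(rep_cstar pir) mval_star -mvalM.
  rewrite (rep_mul pir) (rep_star pir) starK y0 inner0r.
  exact: lexx.
have rep_sq y v : inner (pi (star y ** mval B y) v) v =
    (nr (pi (mval B3 y) v) ^+ 2)%:C.
  by rewrite -posB (rep_cstar pir).
have rep_h v w : inner (pi h v) w = inner (pi d v) (pi d w).
  by rewrite (rep_mul pir) (rep_star pir) starK.
split=> [x0 v|small v].
  have hB w : pi (mval B h) w = eps%:C *: pi h w - pi h (pi h w).
    have := x0 w; rewrite /x mvalD (repD pir) => /eqP; rewrite addr_eq0 => /eqP ->.
    by rewrite sE (repB pir) (repZ pir) (rep_mul pir) opprB.
  (* If [x] acts as 0 then [- s h = B h], and positivity of [B] bounds [d] on vectors of the form
     [h v]. Two applications of Cauchy-Schwarz carry the bound to [d v] and then to [v]. *)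
  have g32 : nr (pi d (pi h v)) ^+ 2 <= eps * nr (pi h v) ^+ 2.
    rewrite -subr_ge0 -[X in 0 <= X]/(complex.Re (eps * nr (pi h v) ^+ 2 - nr (pi d (pi h v)) ^+ 2)%:C).
    rewrite rcB rcM -!inner_xx -rep_h -innerZl -innerBl -hB.
    have := rep_sq h v; rewrite (rep_mul pir) hs => E.
    have -> : inner (pi (mval B h) v) (pi h v) = inner (pi h (pi (mval B h) v)) v :> R[i].
      by rewrite [RHS](rep_star pir) hs.
    by rewrite E /= sqr_ge0.
  have nE w : nr (pi d w) ^+ 2 = complex.Re (inner (pi h w) w) by rewrite rep_h inner_xx.
  have g21 : nr (pi h v) ^+ 2 <= eps * nr (pi d v) ^+ 2.
    have CS : nr (pi h v) ^+ 2 <= nr (pi d v) * nr (pi d (pi h v)).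
      have := inner_CS (pi d v) (pi d (pi h v)); rewrite -rep_h inner_xx.
      by rewrite nr_real ger0_norm ?sqr_ge0.
    have [->|n0] := eqVneq (nr (pi h v)) 0.
      by rewrite expr0n/= mulr_ge0 ?sqr_ge0 ?ltW.
    have {}n0 : 0 < nr (pi h v) ^+ 2 by rewrite exprn_gt0// lt0r n0 nr_ge0.
    rewrite -(ler_pM2r n0) -expr2.
    have := nr_ge0 (pi h v); have := nr_ge0 (pi d v); have := nr_ge0 (pi d (pi h v)).
    move: (nr (pi h v)) (nr (pi d v)) (nr (pi d (pi h v))) g32 CS {n0} => p q r.
    move=> g32 CS r0 q0 p0; have : (p ^+ 2) ^+ 2 <= (q * r) ^+ 2.
      by rewrite ler_sqr ?nnegrE ?mulr_ge0 ?sqr_ge0.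
    move=> h1; rewrite (le_trans h1)// exprMn.
    have -> : eps * q ^+ 2 * p ^+ 2 = q ^+ 2 * (eps * p ^+ 2) by ring.
    by rewrite ler_wpM2l ?sqr_ge0.
  have CS : nr (pi d v) ^+ 2 <= nr (pi h v) * nr v.
    by have := inner_CS (pi h v) v; rewrite rep_h inner_xx nr_real ger0_norm ?sqr_ge0.
  have [->|n0] := eqVneq (nr (pi d v)) 0.
    by rewrite expr0n/= mulr_ge0 ?sqr_ge0 ?ltW.
  have {}n0 : 0 < nr (pi d v) ^+ 2 by rewrite exprn_gt0// lt0r n0 nr_ge0.
  rewrite -(ler_pM2r n0) -expr2.
  have := nr_ge0 (pi h v); have := nr_ge0 (pi d v); have := nr_ge0 v.
  move: (nr (pi h v)) (nr (pi d v)) (nr v) g21 CS {n0} => p q r.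
  move=> g21 CS r0 q0 p0; have : (q ^+ 2) ^+ 2 <= (p * r) ^+ 2.
    by rewrite ler_sqr ?nnegrE ?mulr_ge0 ?sqr_ge0.
  move=> h1; rewrite (le_trans h1)// exprMn.
  have -> : eps * r ^+ 2 * q ^+ 2 = (eps * q ^+ 2) * r ^+ 2 by ring.
  by rewrite ler_wpM2r ?sqr_ge0.
(* The bound on [d] says that [s] acts as a nonpositive operator, whereas on the range of [x] it
   equals the positive [B]. So [B x] acts as 0, and [x^* x = h (B + s) x = 2 h B x] does too. *)
have B3x w : pi (mval B3 x) w = 0.
  apply: nr_le0; rewrite -(@ler_sqr R) ?nnegrE ?nr_ge0// expr0n/=.
  have := rep_sq x w; rewrite Bx sE (rep_mul pir) (rep_star pir) starK.
  rewrite (repB pir) (repZ pir) (rep_mul pir) innerBl innerZl rep_h !inner_xx.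
  rewrite -rcM -rcB => /complexI <-.
  by rewrite subr_le0 small.
have Bx0 w : pi (mval B x) w = 0 by rewrite -B3B3 mvalM; exact: pi_m.
apply: nr_le0; rewrite -(@ler_sqr R) ?nnegrE ?nr_ge0// expr0n/=.
rewrite -lecR -(rep_cstar pir) {2}/x.
have Dss : star (B + s) = B + s by rewrite starD Bs ss.
rewrite -{1}Dss -mval_star mvalD -Bx (rep_mul pir) (rep_star pir) starK.
by rewrite (repD pir) Bx0 addr0 inner0r lexx.
Qed.

End SpectralElement.

(** * Projections and extreme functionals *)

Lemma inv_small (R : realType) (e c : R) : 0 < e -> 0 <= c ->
  exists N, forall n, (N <= n)%N -> n.+1%:R^-1 * c <= e.
Proof.
move=> e0 c0; have c1 : 0 < c + 1 by rewrite ltr_wpDl.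
have [N] := ltr_add_invr (divr_gt0 e0 c1); rewrite add0r => hN.
exists N => n Nn; have h : n.+1%:R^-1 <= e / (c + 1).
  by rewrite (le_trans _ (ltW hN))// lef_pV2 ?posrE// ler_nat ltnS.
rewrite (le_trans (ler_wpM2r c0 h))// mulrAC ler_pdivrMr//.
by rewrite ler_wpM2l ?lerDl// ltW.
Qed.

Lemma inf_approx (R : realType) (E : set R) (e : R) : has_inf E -> 0 < e ->
  exists2 x, E x & x <= inf E + e.
Proof.
by move=> iE e0; have [x Ex /ltW] := inf_adherent e0 iE; exists x.
Qed.

Section Projection.
Context (R : realType) (H : hilbertType R) (N : set H).
Hypotheses (Nsub : is_subspace N) (Ncl : closed N).

Let N0 : N 0. Proof. by case: Nsub. Qed.

Let NZD (k : R[i]) x y : N x -> N y -> N (k *: x + y).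
Proof. by case: Nsub => _; exact. Qed.

Let NZ (k : R[i]) x : N x -> N (k *: x).
Proof. by move=> Nx; have := NZD k Nx N0; rewrite addr0. Qed.

Let ND x y : N x -> N y -> N (x + y).
Proof. by move=> Nx Ny; have := NZD 1 Nx Ny; rewrite scale1r. Qed.

Lemma projection x : exists2 p, N p & forall n, N n -> inner (x - p) n = 0 :> R[i].
Proof.
pose D := [set nr (x - n) ^+ 2 | n in N].
have iD : has_inf D.
  split; first by exists (nr (x - 0) ^+ 2), 0.
  by exists 0 => _ [n _ <-]; exact: sqr_ge0.
set d := inf D.
have dN n : N n -> d <= nr (x - n) ^+ 2.
  by move=> Nn; apply: ge_inf; [exact: iD.2|exists n].
have /choice[u uP] k : exists n, N n /\ nr (x - n) ^+ 2 <= d + k.+1%:R^-1.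
  have k0 : 0 < k.+1%:R^-1 :> R by rewrite invr_gt0.
  by have [_ [n Nn <-] h] := inf_approx iD k0; exists n.
have uu k l : nr (u k - u l) ^+ 2 <= (k.+1%:R^-1 + l.+1%:R^-1) *+ 2.
  have := parallelogram (x - u l) (x - u k).
  have -> : x - u l - (x - u k) = u k - u l.
    by rewrite opprB addrC addrA subrK.
  have -> : x - u l + (x - u k) = (2 : R[i]) *: (x - (2^-1 : R[i]) *: (u l + u k)).
    rewrite scalerBr scalerA mulfV ?scale1r ?pnatr_eq0//.
    by rewrite scaler_nat mulr2n addrACA -opprD.
  have n2 : nr (2 : R[i]) = 2.
    by rewrite -[LHS]/(nr (2%:R : R[i])) -(rmorph_nat (real_complex R)) nr_real ger0_norm.
  rewrite nrZ n2 exprMn.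
  have := dN ((2^-1 : R[i]) *: (u l + u k)) (NZ _ (ND (uP l).1 (uP k).1)).
  have := (uP k).2; have := (uP l).2; clear n2.
  move: (nr (x - u l) ^+ 2) (nr (x - u k) ^+ 2) (nr (u k - u l) ^+ 2) => A B C.
  move: (nr _ ^+ 2) k.+1%:R^-1 l.+1%:R^-1 => D0 s t; rewrite !mulr2n.
  lra.
have [p up] : exists p, cvgs u p.
  apply: seq_complete => e e0.
  have e20 : 0 < e ^+ 2 by rewrite exprn_gt0.
  have [M MP] := @inv_small R (e ^+ 2) 4 e20 (ler0n _ _).
  exists M => m n Mm Mn; rewrite -(@ler_sqr R) ?nnegrE ?nr_ge0 ?(ltW e0)//.
  rewrite (le_trans (uu _ _))//.
  have := MP _ Mm; have := MP _ Mn.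
  by move: m.+1%:R^-1 n.+1%:R^-1 (e ^+ 2) => s t E; rewrite mulr2n; lra.
have Np : N p.
  move/closed_nr : Ncl; apply => e e0; have [M /(_ _ (leqnn M)) MP] := up e e0.
  by exists (u M); [exact: (uP M).1|rewrite nrC].
have pd : nr (x - p) ^+ 2 <= d.
  suff h e : 0 < e -> nr (x - p) <= Num.sqrt d + e.
    have d0 : 0 <= d by apply: lb_le_inf iD.1 _ => _ [n _ <-]; exact: sqr_ge0.
    rewrite -[leRHS](sqr_sqrtr d0) ler_sqr ?nnegrE ?nr_ge0 ?sqrtr_ge0//.
    by apply/ler_addgt0Pr.
  move=> e0; have d0 : 0 <= d by apply: lb_le_inf iD.1 _ => _ [n _ <-]; exact: sqr_ge0.
  have e20 : 0 < e / 2 by rewrite divr_gt0.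
  have e4 : 0 < (e / 2) ^+ 2 by rewrite exprn_gt0.
  have [M1 M1P] := up _ e20; have [M2 M2P] := @inv_small R _ 1 e4 ler01.
  have h1 := M1P _ (leq_maxl M1 M2); have h2 := M2P _ (leq_maxr M1 M2).
  rewrite mulr1 in h2; have h3 := (uP (maxn M1 M2)).2.
  have h4 : nr (x - u (maxn M1 M2)) <= Num.sqrt d + e / 2.
    rewrite -ler_sqr ?nnegrE ?nr_ge0 ?addr_ge0 ?sqrtr_ge0 ?(ltW e20)//.
    rewrite (le_trans h3)// sqrrD sqr_sqrtr// -addrA lerD2l.
    by rewrite (le_trans h2)// lerDr mulrn_wge0// mulr_ge0 ?sqrtr_ge0 ?(ltW e20).
  rewrite (le_trans (nr_tri (u (maxn M1 M2)) _ _))//.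
  by rewrite [e]splitr addrA lerD.
exists p => // n Nn; set z := x - p in pd *; set c := inner z n.
pose Y := nr n ^+ 2; pose C := nr c ^+ 2.
have Y0 : 0 <= Y by exact: sqr_ge0.
have C0 : 0 <= C by exact: sqr_ge0.
have quad (t : R) : 0 <= - t * C *+ 2 + t ^+ 2 * C * Y.
  have h := le_trans pd (dN _ (ND (NZ (t%:C * c) Nn) Np)).
  have E : x - ((t%:C * c) *: n + p) = z - (t%:C * c) *: n.
    by rewrite opprD addrCA addrC.
  rewrite {}E in h.
  suff <- : nr (z - (t%:C * c) *: n) ^+ 2 - nr z ^+ 2 =
      - t * C *+ 2 + t ^+ 2 * C * Y by rewrite subr_ge0.
  have CE : C%:C = c * c^*%C by rewrite nr_sq.
  have YE : inner n n = Y%:C by rewrite inner_xx.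
  clear h; clearbody z C Y.
  apply/complexI; rewrite rcB -!inner_xx innerBl !innerBr !innerZl !innerZr.
  have -> : inner n z = c^*%C by rewrite innerC.
  rewrite -/c YE conjM conjc_real mulr2n !rcD !rcM CE.
  have -> : (- t)%:C = - t%:C :> R[i] by exact: rmorphN.
  by rewrite -?[(t ^+ 2)%:C]/((t * t)%:C) ?rcM; ring.
apply: nr_eq => e e0; rewrite subr0.
suff -> : nr c = 0 by exact: ltW.
(* The minimum over [t] is at [Y^-1]; using [Y + 1] covers the case where [n] is 0, and the value is
   still negative unless [C = 0]. *)
have := quad (Y + 1)^-1.
have Y10 : 0 < Y + 1 by rewrite ltr_wpDl.
have -> : - (Y + 1)^-1 * C *+ 2 + (Y + 1)^-1 ^+ 2 * C * Y =
   - C * (Y + 2) / (Y + 1) ^+ 2 by field; rewrite gt_eqF.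
rewrite ler_pdivlMr ?exprn_gt0// mul0r mulNr oppr_ge0 pmulr_lle0; last by lra.
move=> hC; apply/eqP; rewrite -(@sqrf_eq0 R) -/C eq_le hC; exact: C0.
Qed.

End Projection.

Section LexExtreme.
Context (R : realType) (V : lmodType R[i]).
Implicit Types (p q : V -> R) (x y b : V).

Definition sublinear p :=
  (forall x y, p (x + y) <= p x + p y) /\
  (forall (r : R) x, 0 < r -> p (r%:C *: x) <= r * p x).

Definition real_linear p :=
  (forall x y, p (x + y) = p x + p y) /\ (forall (r : R) x, p (r%:C *: x) = r * p x).

Lemma sublinearZ p (r : R) x : sublinear p -> 0 < r -> p (r%:C *: x) = r * p x.
Proof.
move=> [_ pZ] r0; apply/eqP; rewrite eq_le pZ//=.
have r0' : 0 < r^-1 by rewrite invr_gt0.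
have := pZ _ (r%:C *: x) r0'.
rewrite scalerA -rcM mulVf ?gt_eqF// scale1r => h.
by rewrite -ler_pdivlMl.
Qed.

Lemma sublinear0 p : sublinear p -> p 0 = 0.
Proof.
move=> ps; have := @sublinearZ p 2 0 ps (ltr0n _ _); rewrite scaler0 => h; lra.
Qed.

Lemma sublinearN p x : sublinear p -> 0 <= p x + p (- x).
Proof. by move=> ps; rewrite -(sublinear0 ps) -(subrr x); exact: ps.1. Qed.

(* The support function of the face of [{phi <= p}] on which [phi b] is maximal. *)
Definition face p b x := inf [set p (x + t%:C *: b) - t * p b | t in [set t : R | 0 <= t]].

Section Face.
Variables (p : V -> R) (b : V) (ps : sublinear p).

Let pos_ge x (t : R) : 0 <= t -> - p (- x) <= p (x + t%:C *: b) - t * p b.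
Proof.
rewrite le_eqVlt => /predU1P[<-|t0].
  rewrite scale0r addr0 mul0r subr0 lerNl -subr_ge0 opprK addrC.
  exact: sublinearN.
rewrite -(sublinearZ b ps t0).
have := ps.1 (x + t%:C *: b) (- x); rewrite [x + _]addrC addrK.
by lra.
Qed.

Let face_set x := [set p (x + t%:C *: b) - t * p b | t in [set t : R | 0 <= t]].

Let face_inf x : has_inf (face_set x).
Proof.
split; first by exists (p (x + 0%:C *: b) - 0 * p b), 0 => //=.
by exists (- p (- x)) => _ [t t0 <-]; exact: pos_ge.
Qed.

Lemma face_le x (t : R) : 0 <= t -> face p b x <= p (x + t%:C *: b) - t * p b.
Proof. by move=> t0; apply: ge_inf; [exact: (face_inf x).2|exists t]. Qed.

Lemma face_lep x : face p b x <= p x.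
Proof. by have := face_le x (lexx 0); rewrite scale0r addr0 mul0r subr0. Qed.

Lemma le_face x (c : R) :
  (forall t, 0 <= t -> c <= p (x + t%:C *: b) - t * p b) -> c <= face p b x.
Proof.
by move=> h; apply: lb_le_inf; [exact: (face_inf x).1|move=> _ [t t0 <-]; exact: h].
Qed.

Lemma face_sublinear : sublinear (face p b).
Proof.
split=> [x y|r x r0].
  rewrite -lerBlDr; apply: le_face => t t0; rewrite lerBlDr -lerBlDl.
  apply: le_face => s s0; rewrite lerBlDl.
  have := face_le (x + y) (addr_ge0 t0 s0); rewrite rcD scalerDl addrACA.
  by have := ps.1 (x + t%:C *: b) (y + s%:C *: b); rewrite mulrDl; lra.
rewrite mulrC -ler_pdivrMr//; apply: le_face => t t0; rewrite ler_pdivrMr//.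
have := face_le (r%:C *: x) (mulr_ge0 (ltW r0) t0).
rewrite rcM -scalerA -scalerDr (sublinearZ _ ps r0).
by rewrite mulrBl -[_ * r]mulrC -mulrA [t * _ * r]mulrC.
Qed.

Lemma faceN : face p b (- b) <= - p b.
Proof.
have := face_le (- b) ler01; rewrite scale1r addNr mul1r sublinear0//.
by rewrite sub0r.
Qed.

End Face.

Variables (q nV : V -> R) (a : nat -> V).
Hypothesis qs : sublinear q.
Hypothesis qn : forall x, q x <= nV x.
Hypothesis adense : forall x (e : R), 0 < e ->
  exists n, nV (x - a n) <= e /\ nV (a n - x) <= e.

(** Lexicographic maximisation: [qq n] is the support function of the functionals below [q] that are
    maximal at [a 0], then at [a 1], and so on up to [a n.-1]. The infimum of all [qq n] is additive
    on opposite pairs [a n], [- a n], hence linear by density. *)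
Let qq := fix qq n := if n is m.+1 then face (qq m) (a m) else q.

Let qqs n : sublinear (qq n).
Proof. by elim: n => [|n ih] //=; exact: face_sublinear. Qed.

Let qq_dec m n x : (m <= n)%N -> qq n x <= qq m x.
Proof.
elim: n => [|n ih]; first by rewrite leqn0 => /eqP->.
rewrite leq_eqVlt => /predU1P[->//|]; rewrite ltnS => /ih h.
by rewrite (le_trans _ h)//; exact: face_lep.
Qed.

Let rset x := [set qq n x | n in [set: nat]].
Let rho x := inf (rset x).

Let rinf x : has_inf (rset x).
Proof.
split; first by exists (q x), 0%N.
exists (- q (- x)) => _ [n _ <-].
have := sublinearN x (qqs n); have := @qq_dec 0%N n (- x) (leq0n _).
by rewrite /=; lra.
Qed.

Let rho_le n x : rho x <= qq n x.
Proof. by apply: ge_inf; [exact: (rinf x).2|exists n]. Qed.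

Let rho_approx x (e : R) : 0 < e -> exists n, qq n x <= rho x + e.
Proof. by move=> e0; have [_ [n _ <-] h] := inf_approx (rinf x) e0; exists n. Qed.

Let le_rho x c : (forall n, c <= qq n x) -> c <= rho x.
Proof. by move=> h; apply: lb_le_inf (rinf x).1 _ => _ [n _ <-]. Qed.

Let rhos : sublinear rho.
Proof.
split=> [x y|r x r0].
  apply/ler_addgt0Pr => e e0; have e20 : 0 < e / 2 by rewrite divr_gt0.
  have [m hm] := rho_approx x e20; have [n hn] := rho_approx y e20.
  rewrite (le_trans (rho_le (maxn m n) _))// (le_trans ((qqs _).1 _ _))//.
  have := @qq_dec _ _ x (leq_maxl m n); have := @qq_dec _ _ y (leq_maxr m n).
  by lra.
rewrite mulrC -ler_pdivrMr//; apply: le_rho => n; rewrite ler_pdivrMr//.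
by rewrite (le_trans (rho_le n _))// (sublinearZ _ (qqs n) r0) mulrC.
Qed.

Let rho_a n : rho (a n) + rho (- a n) = 0 /\ rho (a n) = qq n (a n).
Proof.
have h1 : rho (a n) <= qq n (a n) by exact: rho_le.
have h2 : rho (- a n) <= - qq n (a n).
  by rewrite (le_trans (rho_le n.+1 _))//; exact: faceN.
by have := sublinearN (a n) rhos; split; lra.
Qed.

Let rhoN x : rho (- x) = - rho x.
Proof.
apply/eqP; rewrite eq_le; apply/andP; split; last first.
  by have := sublinearN x rhos; lra.
apply/ler_addgt0Pr => e e0; have e20 : 0 < e / 2 by rewrite divr_gt0.
have [n [h1 h2]] := adense x e20.
have := rhos.1 (a n) (x - a n); have := rhos.1 (- a n) (a n - x).
have -> : a n + (x - a n) = x by rewrite addrC subrK.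
rewrite addKr => h3 h4.
have := (rho_a n).1.
have := le_trans (rho_le 0 (x - a n)) (qn _).
have := le_trans (rho_le 0 (a n - x)) (qn _).
by lra.
Qed.

(** Extremality: if [rho0] is a proper convex combination of functionals below [q], both must attain
    the maximum [qq n (a n)] at each stage, which puts both below [qq n.+1]. So [psi1 <= rho0], and
    linearity turns this into equality. *)
Lemma lex_extreme : exists rho0 : V -> R,
  [/\ real_linear rho0, forall x, rho0 x <= q x, rho0 (a 0%N) = q (a 0%N) &
   forall psi1 psi2 (t : R), 0 < t < 1 -> real_linear psi1 -> real_linear psi2 ->
     (forall x, psi1 x <= q x) -> (forall x, psi2 x <= q x) ->
     (forall x, rho0 x = t * psi1 x + (1 - t) * psi2 x) -> psi1 =1 rho0].
Proof.
have rhoD x y : rho (x + y) = rho x + rho y.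
  apply/eqP; rewrite eq_le rhos.1/=.
  have := rhos.1 (x + y) (- y); rewrite addrK rhoN; lra.
have rhoZ (r : R) x : rho (r%:C *: x) = r * rho x.
  have [r0|r0|->] := ltgtP r 0.
  - have Nr0 : 0 < - r by rewrite oppr_gt0.
    have := sublinearZ x rhos Nr0.
    have -> : (- r)%:C = - r%:C :> R[i] by exact: rmorphN.
    by rewrite scaleNr rhoN; lra.
  - exact: sublinearZ.
  - by rewrite scale0r sublinear0// mul0r.
exists rho; split.
- by [].
- by move=> x; exact: (rho_le 0).
- exact: (rho_a 0).2.
move=> psi1 psi2 t /andP[t0 t1] [l1D l1Z] [l2D l2Z] p1 p2 E x.
have step n : (forall x, psi1 x <= qq n x) /\ (forall x, psi2 x <= qq n x).
  elim: n => [//|n [ih1 ih2]].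
  have := (rho_a n).2; rewrite E => Ea.
  have h1 := ih1 (a n); have h2 := ih2 (a n).
  have e1 : psi1 (a n) = qq n (a n).
    apply/eqP; rewrite eq_le h1/=; have t10 : 0 <= 1 - t by lra.
    rewrite -(ler_pM2l t0); have := ler_wpM2l t10 h2; lra.
  have e2 : psi2 (a n) = qq n (a n).
    apply/eqP; rewrite eq_le h2/=; have t10 : 0 < 1 - t by lra.
    rewrite -(ler_pM2l t10); have := ler_wpM2l (ltW t0) h1; lra.
  split=> y; apply: le_face => //= s s0.
  - by rewrite lerBrDr -[X in _ * X]e1 -l1Z -l1D; exact: ih1.
  - by rewrite lerBrDr -[X in _ * X]e2 -l2Z -l2D; exact: ih2.
have le1 y : psi1 y <= rho y by apply: le_rho => n; exact: (step n).1.
apply/eqP; rewrite eq_le le1/=.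
have := le1 (- x); rewrite rhoN.
have -> : psi1 (- x) = - psi1 x.
  have := l1Z (-1) x; rewrite mulN1r => <-; congr psi1.
  by rewrite (_ : (-1)%:C = -1 :> R[i]) ?scaleN1r// rmorphN1.
by lra.
Qed.

End LexExtreme.

(** * Compact sets of primitive ideals *)

Lemma countable_cover_seq (T : choiceType) (D : set T) (t : T) : countable D ->
  exists g : nat -> T, forall x, D x -> exists n, g n = x.
Proof.
move=> /countable_injP[f fi].
exists (fun n => if pselect (exists2 x, D x & f x = n) is left e
  then projT1 (cid2 e) else t) => x Dx; exists (f x).
case: pselect => [e|[]]; last by exists x.
case: (cid2 e) => y Dy fyx /=; apply: fi => //; exact/mem_set.
Qed.

Lemma complex_dense (R : realType) (z : R[i]) (e : R) : 0 < e ->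
  exists p : rat * rat, nr (z - (ratr p.1 +i* ratr p.2) : R[i]^o) <= e.
Proof.
move=> e0; have e20 : 0 < e / 2 by rewrite divr_gt0.
have app (r : R) : exists p : rat, `|r - ratr p| <= e / 2.
  have h : r - e / 2 < r + e / 2 by rewrite ltrBlDr -addrA ltrDl addr_gt0.
  have [p] := rat_in_itvoo h; rewrite in_itv/= => /andP[h1 h2].
  by exists p; rewrite ler_distl; apply/andP; split; lra.
have [p hp] := app (complex.Re z); have [p' hp'] := app (complex.Im z).
exists (p, p'); rewrite (le_trans (nr_ReIm _))// [e]splitr.
by case: z hp hp' => a b /= hp hp'; exact: lerD.
Qed.

Section PrimRep.
Context (R : realType) (A : cstarAlgType R).

Definition prim_sig (P : Prim A) := cid (ideal_ofP P).
Definition primH (P : Prim A) : hilbertType R := projT1 (prim_sig P).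
Definition prim_pi (P : Prim A) : A -> primH P -> primH P :=
  projT1 (cid (projT2 (prim_sig P))).

Lemma prim_piP (P : Prim A) :
  [/\ star_representation (@prim_pi P), irreducible (@prim_pi P) &
      ideal_of P = rep_ker (@prim_pi P)].
Proof. exact: (projT2 (cid (projT2 (prim_sig P)))). Qed.

Lemma prim_rep (P : Prim A) : star_representation (@prim_pi P).
Proof. by case: (prim_piP P). Qed.

Lemma prim_kerP (P : Prim A) a : ideal_of P a <-> forall v, @prim_pi P a v = 0.
Proof. by case: (prim_piP P) => _ _ ->. Qed.

(** States that the operator norm of [pi d] has square at most [e]; thus [e] always stands for a
    squared norm. *)
Definition rep_small (H : hilbertType R) (pi : A -> H -> H) (d : A) (e : R) :=
  forall v, nr (pi d v) ^+ 2 <= e * nr v ^+ 2.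

(** Squared norm at least [e], as opposed to the strict inequality given by the negation of
    [rep_small] at [e]. The weak inequality is the one that survives passing to a cluster point. *)
Definition rep_big (P : Prim A) (d : A) (e : R) :=
  forall e', 0 < e' < e -> ~ rep_small (@prim_pi P) d e'.

End PrimRep.

Lemma prim_of_ideal (R : realType) (A : cstarAlgType R) (I : set A) :
  primitive_ideal I -> exists P : Prim A, ideal_of P = I.
Proof.
by move=> hI; exists (exist _ I (mem_set hI)); rewrite /ideal_of set_valE.
Qed.

Lemma prim_openE (R : realType) (A : cstarAlgType R) (U : set (Prim A)) :
  open U = hk_open U.
Proof. by []. Qed.

Section DenseEstimates.
Context (R : realType) (H : hilbertType R) (D : set H) (T : H -> H) (C : R).
Hypothesis Ddense : forall h (e : R), 0 < e -> exists2 u, D u & nr (h - u) <= e.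
Hypothesis TB : forall x y, T (x - y) = T x - T y.
Hypothesis TC : forall x, nr (T x) <= C * nr x.

Lemma dense_quad (c : R) :
  (forall u, D u -> complex.Re (inner (T u) u : R[i]) <= c * nr u ^+ 2) ->
  forall h, complex.Re (inner (T h) h : R[i]) <= c * nr h ^+ 2.
Proof.
move=> Du h; apply/ler_addgt0Pl => e e0.
have hn0 := nr_ge0 h.
(* [K] bounds the change of [Re <T h, h> - c |h|^2] per unit of [|h - u|], as long as
   [|h - u| <= 1]. *)
pose K := (`|C| + `|c|) * (2 * nr h + 1) + 1.
have K0 : 0 < K by rewrite /K ltr_wpDl// mulr_ge0// addr_ge0// mulr_ge0.
pose e' := Num.min 1 (e / K).
have e'0 : 0 < e' by rewrite lt_min ltr01 divr_gt0.
have [u uD hu] := Ddense h e'0.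
have e'1 : nr (h - u) <= 1 by rewrite (le_trans hu)// ge_min lexx.
have e'K : nr (h - u) * K <= e.
  rewrite -ler_pdivlMr// (le_trans hu)// ge_min lexx orbT//.
have un : nr u <= nr h + 1.
  by have := nr_sub u h; rewrite nrC; lra.
have n0 := nr_ge0 (h - u); have u0 := nr_ge0 u.
have E : inner (T h) h = inner (T u) u + (inner (T (h - u)) h + inner (T u) (h - u)).
  by rewrite TB innerBl innerBr subrKA addrC subrK.
have h1 : complex.Re (inner (T (h - u)) h : R[i]) <= `|C| * nr (h - u) * nr h.
  rewrite (le_trans (ler_norm _))// (le_trans (nr_Re _))//.
  rewrite (le_trans (inner_CS _ _))// ler_wpM2r// (le_trans (TC _))//.
  by rewrite ler_wpM2r// ler_norm.
have h2 : complex.Re (inner (T u) (h - u) : R[i]) <= `|C| * nr u * nr (h - u).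
  rewrite (le_trans (ler_norm _))// (le_trans (nr_Re _))//.
  rewrite (le_trans (inner_CS _ _))// ler_wpM2r// (le_trans (TC _))//.
  by rewrite ler_wpM2r// ler_norm.
have h3 : c * nr u ^+ 2 - c * nr h ^+ 2 <= `|c| * (nr (h - u) * (2 * nr h + 1)).
  rewrite -mulrBr (le_trans (ler_norm _))// normrM ler_wpM2l// subr_sqr normrM.
  apply: ler_pM => //.
    by rewrite ler_norml; have := nr_sub u h; have := nr_sub h u; rewrite (nrC u); lra.
  by rewrite ger0_norm ?addr_ge0//; lra.
rewrite E !ReD; have := Du u uD.
have : `|C| * nr u * nr (h - u) <= `|C| * (nr h + 1) * nr (h - u).
  by rewrite ler_wpM2r// ler_wpM2l.
by rewrite /K in e'K => h4 h5; clear E; lra.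
Qed.

Lemma dense_op_eq (T' : H -> H) (C' : R) :
  (forall x y, T' (x - y) = T' x - T' y) -> (forall x, nr (T' x) <= C' * nr x) ->
  (forall u, D u -> T u = T' u) -> T =1 T'.
Proof.
move=> T'B T'C Du h; apply: nr_eq => e e0.
have c0 : 0 < `|C| + `|C'| + 1 by rewrite ltr_wpDl// addr_ge0.
have [u uD hu] := Ddense h (divr_gt0 e0 c0).
have -> : T h - T' h = T (h - u) - T' (h - u).
  by rewrite TB T'B (Du u)// opprB addrA subrK.
rewrite (le_trans (nrB _ _))// (le_trans (lerD (TC _) (T'C _)))// -mulrDl.
have n0 := nr_ge0 (h - u).
rewrite (@le_trans _ _ ((`|C| + `|C'| + 1) * nr (h - u)))//.
  rewrite ler_wpM2r//; have := ler_norm C; have := ler_norm C'; lra.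
by rewrite mulrC -ler_pdivlMr.
Qed.

Lemma dense_orth z : (forall u, D u -> complex.Re (inner u z : R[i]) = 0) -> z = 0.
Proof.
move=> Dz; apply: nr_le0; apply/ler_addgt0Pl => e e0; rewrite addr0.
have [u uD zu] := Ddense z e0.
have [h|nz] := leP (nr z) 0; first by rewrite (le_trans h)// ltW.
rewrite -(ler_pM2r nz) -expr2 nr2E.
have -> : inner z z = inner (z - u) z + inner u z by rewrite -innerDl subrK.
rewrite ReD (Dz u uD) addr0 (le_trans (ler_norm _))// (le_trans (nr_Re _))//.
by rewrite (le_trans (inner_CS _ _))// ler_wpM2r ?nr_ge0.
Qed.

End DenseEstimates.

Section Compactness.
Context (R : realType) (A : cstarAlgType R) (F : set_system (Prim A)).
Context {FF : ProperFilter F}.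
Hypothesis sepA : cstar_separable A.
Variables (d : A) (eps : R).
Hypothesis d1 : nr d <= 2^-1.
Hypothesis eps01 : 0 < eps <= 2^-1.
Hypothesis Fbig : F [set P | rep_big P d eps].
Local Notation "x ** y" := (cmul x y) (at level 40, left associativity).

Let eps0 : 0 < eps. Proof. by case/andP: eps01. Qed.

(* The unitization of [A]. *)
Let V : lmodType R[i] := (A * R[i]^o)%type.
Implicit Types (x y u v : V) (P : Prim A).

Let umul x y : V := (x.1 ** y.1 + (x.2 *: y.1 + y.2 *: x.1), x.2 * y.2).
Let ustar x : V := (star x.1, x.2^*%C).
Let upi P x (xi : primH P) : primH P := prim_pi x.1 xi + x.2 *: xi.

Let upiM P x y xi : upi (umul x y) xi = upi x (@upi P y xi).
Proof.
have pr := prim_rep P.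
rewrite /upi /= !(repD pr) !(repZ pr) (rep_mul pr) (rep_opD pr) (rep_opZ pr).
by rewrite scalerDr scalerA !addrA; congr (_ + _); rewrite addrAC.
Qed.

Let upiZD P k x y xi : @upi P (k *: x + y) xi = k *: upi x xi + upi y xi.
Proof.
have pr := prim_rep P.
rewrite /upi (rep_linear pr) /= scalerDr scalerA scalerDl.
by rewrite addrACA.
Qed.

Let upi_opZD P x k xi zeta : @upi P x (k *: xi + zeta) = k *: upi x xi + upi x zeta.
Proof.
have pr := prim_rep P.
rewrite /upi (rep_op_linear pr) !scalerDr !scalerA (mulrC k).
by rewrite addrACA.
Qed.

Let upi_star P x xi zeta : inner (@upi P x xi) zeta = inner xi (upi (ustar x) zeta).
Proof.
have pr := prim_rep P.
rewrite /upi innerDl innerDr (rep_star pr) innerZl innerZr /=.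
by congr (_ + _); rewrite conjcK.
Qed.

Let upiD P x y xi : @upi P (x + y) xi = upi x xi + upi y xi.
Proof. by have := upiZD 1 x y xi; rewrite !scale1r. Qed.

Let upi0 P xi : @upi P 0 xi = 0.
Proof. by rewrite /upi /= (rep0 (prim_rep P)) scale0r addr0. Qed.

Let upiZ P k x xi : @upi P (k *: x) xi = k *: upi x xi.
Proof. by have := upiZD k x 0 xi; rewrite !addr0 upi0 addr0. Qed.

Let nV x : R := nr x.1 + nr (x.2 : R[i]).

Let upi_bd P x xi : nr (@upi P x xi) <= nV x * nr xi.
Proof.
rewrite (le_trans (nrD _ _))// nrZ mulrDl lerD//.
exact: rep_contractive (prim_rep P) _ _.
Qed.

Let rq P x (xi : primH P) : R := complex.Re (inner (upi x xi) xi).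
Let Q x := [set c : R | F [set P | forall xi : primH P, rq x xi <= c * nr xi ^+ 2]].
Let q x := inf (Q x).

Let rq_bd P x (xi : primH P) : `|rq x xi| <= nV x * nr xi ^+ 2.
Proof.
rewrite (le_trans (nr_Re _))// (le_trans (inner_CS _ _))// expr2 mulrA.
by rewrite ler_wpM2r ?nr_ge0.
Qed.

Let Q_nV x : Q x (nV x).
Proof.
apply: filterS filterT => P _ xi.
by rewrite (le_trans (ler_norm _))// rq_bd.
Qed.

Let unit_vec P : exists xi : primH P, nr xi = 1.
Proof.
have [_ [[a [v av]] _] _] := prim_piP P.
have v0 : nr v != 0.
  apply: contra av => /eqP/nr_eq0 ->.
  by rewrite (rep_op0 (prim_rep P)).
exists ((nr v)^-1%:C *: v); rewrite nrZr ger0_norm ?invr_ge0 ?nr_ge0//.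
by rewrite mulVf.
Qed.

Let Q_ex x c : Q x c -> exists P (xi : primH P), nr xi = 1 /\ rq x xi <= c.
Proof.
move=> /filter_ex[P Pc]; have [xi xi1] := unit_vec P.
by exists P, xi; split=> //; have := Pc xi; rewrite xi1 expr1n mulr1.
Qed.

Let Q_inf x : has_inf (Q x).
Proof.
split; first by exists (nV x).
exists (- nV x) => c /Q_ex[P [xi [xi1 h]]].
by have := rq_bd x xi; rewrite xi1 expr1n mulr1 ler_norml => /andP[h1 _]; lra.
Qed.

Let q_le x c : Q x c -> q x <= c.
Proof. by move=> h; apply: ge_inf => //; exact: (Q_inf x).2. Qed.

Let le_q x c : (forall c', Q x c' -> c <= c') -> c <= q x.
Proof. by move=> h; apply: lb_le_inf (Q_inf x).1 _. Qed.

Let rqD P x y (xi : primH P) : rq (x + y) xi = rq x xi + rq y xi.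
Proof. by rewrite /rq upiD innerDl ReD. Qed.

Let rqZ P (r : R) x (xi : primH P) : rq (r%:C *: x) xi = r * rq x xi.
Proof. by rewrite /rq upiZ innerZl ReZ. Qed.

Let qs : sublinear q.
Proof.
split=> [x y|r x r0].
  rewrite -lerBlDr; apply: le_q => c Qc; rewrite lerBlDr -lerBlDl.
  apply: le_q => c' Qc'; rewrite lerBlDl; apply: q_le.
  apply: filterS2 Qc Qc' => P h h' xi; rewrite rqD mulrDl; exact: lerD.
rewrite mulrC -ler_pdivrMr//; apply: le_q => c Qc; rewrite ler_pdivrMr//.
apply: q_le; apply: filterS Qc => P h xi.
by rewrite rqZ (mulrC c) -mulrA ler_wpM2l// ltW.
Qed.

Let q_nV x : q x <= nV x. Proof. exact: q_le. Qed.

Let dd : V := (star d ** d, 0).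
Let one : V := (0, 1).

Let rq_dd P (xi : primH P) : rq dd xi = nr (prim_pi d xi) ^+ 2.
Proof. by rewrite /rq /upi /= scale0r addr0 (rep_cstar (prim_rep P)). Qed.

Let q_dd : eps <= q dd.
Proof.
apply: le_q => c Qc.
have [P [Pb Pc]] := filter_ex (filterI Fbig Qc).
rewrite leNgt; apply/negP => ce.
pose e' := (Num.max c 0 + eps) / 2.
have h : Num.max c 0 < eps by rewrite gt_max ce eps0.
have h0 : 0 <= Num.max c 0 by rewrite le_max lexx orbT.
have hc : c <= Num.max c 0 by rewrite le_max lexx.
apply: (Pb e'); first by rewrite /e'; apply/andP; split; lra.
move=> v; have := Pc v; rewrite rq_dd => /le_trans -> //.
by rewrite ler_wpM2r ?sqr_ge0// /e'; lra.
Qed.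

Let dense_seq : exists a : nat -> V, a 0%N = dd /\
  forall x (e : R), 0 < e -> exists n, nV (x - a n) <= e /\ nV (a n - x) <= e.
Proof.
have [D [cD dD]] := sepA; have [g gD] := countable_cover_seq 0 cD.
(* [dd] is listed first so that the lexicographically maximal functional attains [q dd]; the other
   terms run through a countable dense family. *)
pose a n : V := if n is m.+1 then
  if unpickle m is Some (i, p, p') then (g i, ratr p +i* ratr p') else 0 else dd.
exists a; split=> // x e e0; have e20 : 0 < e / 2 by rewrite divr_gt0.
have [y [Dy xy]] : D `&` [set y | nr (x.1 - y) < e / 2] !=set0.
  rewrite setIC; apply: dD.
    by exists x.1; rewrite /= subrr nr0.
  rewrite openE => y /= xy; apply/nbhs_nr.
  exists ((e / 2 - nr (x.1 - y)) / 2); first by rewrite divr_gt0// subr_gt0.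
  move=> z yz /=; rewrite (le_lt_trans (nr_tri y _ _))//.
  by move: (nr (y - z)) (nr (x.1 - y)) yz xy => s t; lra.
have [i gi] := gD _ Dy; have [[p p'] hp] := complex_dense x.2 e20.
exists (pickle (i, p, p')).+1; rewrite /a pickleK gi.
have h : nV (x - (y, ratr p +i* ratr p')) <= e.
  by rewrite /nV /= [leRHS]splitr lerD// ltW.
have nVN z : nV (- z) = nV z.
  by congr (_ + _); [exact: (nrN z.1)|exact: (nrN (z.2 : R[i]^o))].
by split=> //; rewrite -opprB nVN.
Qed.

(** Identities in the unitization are only verified through the action in all [prim_pi]; functionals
    below [q] cannot see more than that. *)
Let ext x y := forall P (xi : primH P), upi x xi = upi y xi.

Lemma prim_cluster : exists P0, cluster F P0 /\ rep_big P0 d eps.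
Proof.
have [a [a0 adense]] := dense_seq.
have [rho [[rhoD rhoZ] rho_q rho_a rho_ext]] := lex_extreme qs q_nV adense.
rewrite a0 in rho_a.
have rhoN x : rho (- x) = - rho x.
  have := rhoZ (-1) x; rewrite mulN1r => <-; congr rho.
  by rewrite (_ : (-1)%:C = -1 :> R[i]) ?scaleN1r// rmorphN1.
have rho_le0 x : Q x 0 -> rho x <= 0.
  by move=> /q_le; apply: le_trans.
have rho_exteq x y : ext x y -> rho x = rho y.
  suff h u v : ext u v -> rho u <= rho v.
    by move=> xy; apply/eqP; rewrite eq_le !h// => P xi; rewrite xy.
  move=> uv; rewrite -subr_le0 -rhoN -rhoD rho_le0//.
  apply: filterS filterT => P _ xi; rewrite mul0r rqD.
  by rewrite -scaleN1r -[-1](rmorphN1 (real_complex R)) rqZ mulN1r /rq uv subrr.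
have rho_skew x : (forall P (xi : primH P), rq x xi = 0) -> rho x = 0.
  move=> x0; apply/eqP; rewrite eq_le rho_le0/=; last first.
    by apply: filterS filterT => P _ xi; rewrite mul0r x0.
  rewrite -oppr_le0 -rhoN rho_le0//.
  apply: filterS filterT => P _ xi; rewrite mul0r.
  by rewrite -scaleN1r -[-1](rmorphN1 (real_complex R)) rqZ x0 mulr0.
have rho_rq x y : (forall P (xi : primH P), rq x xi = rq y xi) -> rho x = rho y.
  move=> xy; apply/eqP; rewrite -subr_eq0 -rhoN -rhoD rho_skew// => P xi.
  rewrite rqD -scaleN1r -[-1](rmorphN1 (real_complex R)) rqZ mulN1r xy.
  by rewrite subrr.
(* The complex-linear functional with real part [rho]. *)
pose phi x : R[i] := (rho x) +i* (- rho ('i%C *: x)).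
have i2 : 'i%C * 'i%C = -1 :> R[i] by rewrite -expr2 sqr_i.
have phiD x y : phi (x + y) = phi x + phi y.
  by apply/eqP; rewrite eq_complex/= scalerDr !rhoD opprD !eqxx.
have phi_exteq x y : ext x y -> phi x = phi y.
  move=> xy; rewrite /phi (rho_exteq _ _ xy); congr (_ +i* - _).
  by apply: rho_exteq => P xi; rewrite !upiZ xy.
have phiZ k x : phi (k *: x) = k * phi x.
  rewrite {1}[k]complexE scalerDl phiD.
  have r1 (r : R) z : phi (r%:C *: z) = r%:C * phi z.
    have -> : phi (r%:C *: z) = (r * rho z) +i* (- (r * rho ('i%C *: z))).
      by rewrite /phi -!rhoZ !scalerA (mulrC r%:C).
    by apply/eqP; rewrite eq_complex/= !mul0r subr0 addr0 mulrN !eqxx.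
  have r2 z : phi ('i%C *: z) = 'i%C * phi z.
    apply/eqP; rewrite eq_complex/= scalerA i2 scaleN1r rhoN opprK.
    by rewrite !mul0r !mul1r sub0r opprK add0r !eqxx.
  by rewrite -scalerA r2 !r1 [in RHS](complexE k); ring.
have inner_ustar P x (xi : primH P) :
    inner (upi (ustar x) xi) xi = (inner (upi x xi) xi)^*%C.
  by rewrite [in RHS]upi_star -innerC.
have phi_star x : phi (ustar x) = (phi x)^*%C.
  apply/eqP; rewrite eq_complex/= opprK; apply/andP; split; apply/eqP.
    by apply: rho_rq => P xi; rewrite /rq inner_ustar Re_conj.
  apply/eqP; rewrite eqr_oppLR -rhoN; apply/eqP; apply: rho_rq => P xi.
  rewrite /rq -scaleN1r !upiZ !innerZl inner_ustar.
  by case: (inner _ _) => z z' /=; ring.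
have phi_Re x : complex.Re (phi x) = rho x by [].
pose f0 u v : R[i] := phi (umul (ustar v) u).
have f0l k x y z : f0 (k *: x + y) z = k * f0 x z + f0 y z.
  rewrite /f0 -phiZ -phiD; apply: phi_exteq => P xi.
  by rewrite upiM upiZD upi_opZD upiZD !upiM.
have ustarP P x y (xi : primH P) : upi (ustar (umul x y)) xi =
    upi (ustar y) (upi (ustar x) xi).
  by apply: inner_inj => z; rewrite [LHS]innerC -upi_star upiM ![in LHS]upi_star -innerC.
have ustarKP P x (xi : primH P) : upi (ustar (ustar x)) xi = upi x xi.
  by rewrite /upi /ustar /= starK conjcK.
have f0c x y : f0 y x = (f0 x y)^*%C.
  rewrite /f0 -phi_star; apply: phi_exteq => P xi.
  by rewrite ustarP !upiM ustarKP.
have rq_sq P u (xi : primH P) : rq (umul (ustar u) u) xi = nr (upi u xi) ^+ 2.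
  by rewrite /rq upiM upi_star ustarKP -nr2E.
have f0p x : 0 <= complex.Re (f0 x x).
  rewrite phi_Re -oppr_le0 -rhoN rho_le0//; apply: filterS filterT => P _ xi.
  rewrite -scaleN1r -[-1](rmorphN1 (real_complex R)) rqZ rq_sq mul0r.
  by rewrite mulN1r oppr_le0 sqr_ge0.
pose f : psd_form V := PsdForm f0l f0c f0p.
pose L x u := umul x u.
have ustarK x : ustar (ustar x) = x by case: x => a1 l1; rewrite /ustar /= starK conjcK.
have LL x u v : form f (L x u) v = form f u (L (ustar x) v).
  by apply: phi_exteq => P xi; rewrite !upiM ustarP !ustarK.
(* An upper bound [c] on the form of [x] along [F] is preserved by compression with [u]; it is the
   reason why the vector functionals of the GNS space stay below [q]. *)
have quad x u c : Q x c ->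
    rho (umul (ustar u) (umul x u)) <= c * rho (umul (ustar u) u).
  move=> Qc; rewrite -subr_le0 -rhoZ -rhoN -rhoD rho_le0//.
  apply: filterS Qc => P Pc xi; rewrite rqD -scaleN1r -[-1](rmorphN1 (real_complex R)).
  rewrite !rqZ rq_sq mulN1r mul0r subr_le0 (le_trans _ (Pc _))//.
  by rewrite /rq !upiM upi_star ustarK.
pose C x := Num.sqrt (nV (umul (ustar x) x)).
have nV0 x : 0 <= nV x by rewrite addr_ge0 ?nr_ge0.
have Lb x u : fnorm f (L x u) <= C x * fnorm f u.
  rewrite -ler_sqr ?nnegrE ?mulr_ge0 ?fnorm_ge0 ?sqrtr_ge0// exprMn.
  rewrite !fnormK sqr_sqrtr//; apply: le_trans (quad _ u _ (Q_nV _)).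
  rewrite le_eqVlt; apply/orP; left; apply/eqP; apply: rho_exteq => P xi.
  by rewrite !upiM ustarP.
pose T x : hcompl f -> hcompl f := hop (LL x) (Lb (ustar x)).
have TB x g h : T x (g - h) = T x g - T x h by exact: hopB.
have TC x h : nr (T x h) <= C (ustar x) * nr h.
  have := nr_hop (LL x) (Lb (ustar x)) h; rewrite ger0_norm//; exact: sqrtr_ge0.
have Themb x u : T x (hemb f u) = hemb f (L x u) by exact: hop_hemb.
have Tlin x k g h : T x (k *: g + h) = k *: T x g + T x h by exact: hop_linear.
have Tadj x g h : inner (T x g) h = inner g (T (ustar x) h).
  have LL' u v : form f (L (ustar x) u) v = form f u (L x v).
    by have := LL (ustar x) u v; rewrite ustarK.
  rewrite (hop_adj (LL x) (Lb (ustar x)) LL' (Lb x)); congr inner.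
  by apply: hval_eq => v; rewrite !hval_hop ustarK.
have Ddense h (e : R) : 0 < e -> exists2 u, range (hemb f) u & nr (h - u) <= e.
  by move=> /(hemb_dense h)[u hu]; exists (hemb f u) => //; exists u.
have hemb_ext u v : ext u v -> hemb f u = hemb f v.
  move=> uv; apply: hval_eq => w; rewrite !hval_mkh.
  by apply: phi_exteq => P xi; rewrite !upiM uv.
have Text x y h : ext x y -> T x h = T y h.
  move=> xy; move: h; apply: (dense_op_eq Ddense (TB x) (TC x) (TB y) (TC y)).
  by move=> _ [u _ <-]; rewrite !Themb; apply: hemb_ext => P xi; rewrite !upiM xy.
have TD x y h : T (x + y) h = T x h + T y h.
  move: h; apply: (dense_op_eq (C' := C (ustar x) + C (ustar y)) Ddense (TB _) (TC _)).
  - by move=> g g'; rewrite !TB addrACA -opprD.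
  - by move=> g; rewrite (le_trans (nrD _ _))// mulrDl lerD ?TC.
  - move=> _ [u _ <-]; rewrite !Themb -hembD; apply: hemb_ext => P xi.
    by rewrite !upiM !upiD !upiM.
have TZ k x h : T (k *: x) h = k *: T x h.
  move: h; apply: (dense_op_eq (C' := nr k * C (ustar x)) Ddense (TB _) (TC _)).
  - by move=> g g'; rewrite !TB scalerBr.
  - by move=> g; rewrite nrZ -mulrA ler_wpM2l ?nr_ge0 ?TC.
  - move=> _ [u _ <-]; rewrite !Themb -hembZ; apply: hemb_ext => P xi.
    by rewrite !upiM !upiZ upiM.
have TM x y h : T (umul x y) h = T x (T y h).
  move: h; apply: (dense_op_eq (C' := C (ustar x) * C (ustar y)) Ddense (TB _) (TC _)).
  - by move=> g g'; rewrite !TB.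
  - by move=> g; rewrite (le_trans (TC _ _))// -mulrA ler_wpM2l ?sqrtr_ge0 ?TC.
  - move=> _ [u _ <-]; rewrite !Themb; apply: hemb_ext => P xi.
    by rewrite !upiM.
pose pi a := T (a, 0).
have TE x h : T x h = pi x.1 h + x.2 *: h.
  have T1 : T one h = h.
    move: h; apply: (dense_op_eq (C' := 1) (T' := idfun) Ddense (TB _) (TC _)) => //.
      by move=> g; rewrite mul1r.
    move=> _ [u _ <-]; rewrite Themb; apply: hemb_ext => P xi.
    by rewrite upiM /upi /= scale1r (rep0 (prim_rep P)) add0r.
  rewrite -[X in _ *: X]T1 -TZ -TD; apply: Text => P xi.
  rewrite upiD upiZ /upi /= scale0r addr0 (rep0 (prim_rep P)) add0r.
  by rewrite scale1r.
have pir : star_representation pi.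
  split.
  - by move=> a1 k x y; exact: Tlin.
  - move=> a1; apply: (@continuous_nr _ _ _ _ (C (ustar (a1, 0)))) => x y.
    by rewrite -TB TC.
  - move=> k a1 b1 h; rewrite /pi -TZ -TD; apply: Text => P xi.
    rewrite upiD upiZ /upi /= !scale0r !addr0.
    exact: (rep_linear (prim_rep P)).
  - move=> a1 b1 h; rewrite /pi -TM; apply: Text => P xi.
    by rewrite upiM /upi /= !scale0r !addr0 (rep_mul (prim_rep P)).
  - move=> a1 x y; rewrite /pi.
    have <- : ustar (a1, 0) = (star a1, 0) by congr pair; exact: conjc0.
    exact: Tadj.
have rho1 : rho one = 1.
  apply/eqP; rewrite eq_le; apply/andP; split.
    rewrite (le_trans (rho_q _))// q_le//; apply: filterS filterT => P _ xi.
    by rewrite /rq /upi /= (rep0 (prim_rep P)) scale1r add0r mul1r -nr2E.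
  rewrite -lerN2 -rhoN (le_trans (rho_q _))// q_le//; apply: filterS filterT => P _ xi.
  rewrite -scaleN1r -[-1](rmorphN1 (real_complex R)) rqZ mulN1r mulN1r lerN2.
  by rewrite /rq /upi /= (rep0 (prim_rep P)) scale1r add0r -nr2E.
pose xi0 := hemb f one.
have Txi0 x : T x xi0 = hemb f x.
  rewrite Themb; apply: hemb_ext => P xi.
  by rewrite upiM [in X in upi _ X]/upi /= scale1r (rep0 (prim_rep P)) add0r.
have innerTxi0 x : complex.Re (inner (T x xi0) xi0 : R[i]) = rho x.
  rewrite Txi0 inner_hemb phi_Re; apply: rho_exteq => P xi.
  rewrite upiM; have -> : ustar one = one by congr pair; [exact: star0|exact: conjc1].
  by rewrite /upi /= scale1r (rep0 (prim_rep P)) add0r.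
have nxi0 : nr xi0 = 1.
  have T1 : T one xi0 = xi0 by rewrite Txi0.
  have : nr xi0 ^+ 2 = 1 by rewrite nr2E -{1}T1 innerTxi0.
  by move=> /eqP; rewrite sqrp_eq1 ?nr_ge0// => /eqP.
have Tq x h : complex.Re (inner (T x h) h : R[i]) <= q x * nr h ^+ 2.
  apply: (dense_quad Ddense (TB x) (TC x)) => _ [u _ <-].
  rewrite Themb inner_hemb nr_hemb fnormK.
  have -> : complex.Re (form f (L x u) u) = rho (umul (ustar u) (umul x u)) by [].
  have := form_ge0 f u; rewrite -/(fnorm2 f u) le_eqVlt => /predU1P[u0|u0].
    have [c Qc] := (Q_inf x).1; have := quad x u c Qc.
    by rewrite -[rho (umul (ustar u) u)]/(fnorm2 f u) -u0 !mulr0.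
  rewrite -ler_pdivrMr//; apply: le_q => c Qc; rewrite ler_pdivrMr//.
  exact: quad.
have irr : irreducible pi.
  split.
    exists d, xi0; apply/eqP => dx.
    have : rho dd = 0.
      have -> : dd = (star d ** d, 0) by [].
      by rewrite -innerTxi0 -/(pi _) (rep_mul pir) dx (rep_op0 pir) inner0l.
    by move=> q0; have := q_dd; rewrite -rho_a q0 leNgt eps0.
  move=> N Nsub Ncl Ninv.
  have N0 : N 0 by case: Nsub.
  have NZD (k : R[i]) (x y : hcompl f) : N x -> N y -> N (k *: x + y) by case: Nsub => _; exact.
  have NZ (k : R[i]) (x : hcompl f) : N x -> N (k *: x).
    by move=> Nx; have := NZD k x 0 Nx N0; rewrite addr0.
  have NT x h : N h -> N (T x h).
    move=> Nh; rewrite TE addrC; apply: NZD => //; exact: Ninv.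
  (* Splitting the cyclic vector along [N] splits [rho] into a convex combination of the normalised
     vector functionals of [eta] and [eta'], both below [q]. *)
  have [eta Neta etaN] := projection Nsub Ncl xi0.
  set eta' := xi0 - eta in etaN.
  have xiE : xi0 = eta + eta' by rewrite addrC subrK.
  clearbody eta'.
  have cross x : inner (T x eta) eta' = 0 :> R[i].
    by rewrite innerC etaN ?conjc0//; exact: NT.
  have cross' x : inner (T x eta') eta = 0 :> R[i].
    by rewrite Tadj etaN//; exact: NT.
  have Nfull : N xi0 -> N = setT.
    move=> Nxi; apply/seteqP; split=> // h _.
    move/closed_nr : Ncl; apply => e /(hemb_dense h)[u hu].
    by exists (hemb f u) => //; rewrite -Txi0; exact: NT.
  pose t := nr eta ^+ 2; pose t' := nr eta' ^+ 2.
  have tt' : t + t' = 1.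
    have c0 : inner eta eta' = 0 :> R[i].
      by rewrite innerC (etaN eta Neta) conjc0.
    have E2 : inner (eta + eta') (eta + eta') = inner eta eta + inner eta' eta' :> R[i].
      by rewrite innerDl !innerDr c0 (etaN eta Neta) addr0 add0r.
    have : nr (eta + eta') ^+ 2 = 1 by rewrite -xiE nxi0 expr1n.
    by rewrite nr2E E2 ReD -!nr2E.
  have [t0|t0] := eqVneq t 0.
    left; have eta0 : eta = 0.
      by apply: nr_eq0; apply/eqP; rewrite -(@sqrf_eq0 R) -/t t0.
    apply/seteqP; split=> [n Nn|n ->//].
    apply: (dense_orth Ddense) => _ [x _ <-].
    by rewrite -Txi0 Tadj xiE eta0 add0r etaN//; exact: NT.
  right; apply: Nfull.
  have {}t0 : 0 < t by rewrite lt0r t0 sqr_ge0.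
  have [t'0|t'0] := eqVneq t' 0.
    have eta'0 : eta' = 0.
      by apply: nr_eq0; apply/eqP; rewrite -(@sqrf_eq0 R) -/t' t'0.
    by rewrite xiE eta'0 addr0.
  have {}t'0 : 0 < t' by rewrite lt0r t'0 sqr_ge0.
  pose psi (h : hcompl f) (s : R) x := s^-1 * complex.Re (inner (T x h) h : R[i]).
  have psi_lin h s : real_linear (psi h s).
    split=> [x y|r x]; first by rewrite /psi TD innerDl ReD mulrDr.
    by rewrite /psi TZ innerZl ReZ mulrCA.
  have psi_q h : 0 < nr h ^+ 2 -> forall x, psi h (nr h ^+ 2) x <= q x.
    by move=> h0 x; rewrite /psi mulrC ler_pdivrMr.
  have E x : rho x = t * psi eta t x + (1 - t) * psi eta' t' x.
    have -> : 1 - t = t' by rewrite -tt' addrC addKr.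
    rewrite /psi !mulVKf ?gt_eqF// -innerTxi0 {1}xiE.
    have -> : T x (eta + eta') = T x eta + T x eta'.
      by have := Tlin x 1 eta eta'; rewrite !scale1r.
    rewrite {1}xiE innerDl !innerDr cross cross' addr0 add0r.
    exact: ReD.
  have t01 : 0 < t < 1 by rewrite t0 -tt' ltrDl.
  have psi_rho := rho_ext _ _ t t01 (psi_lin eta t) (psi_lin eta' t')
    (psi_q eta t0) (psi_q eta' t'0) E.
  (* By extremality the functional of [eta] is [t rho]. Hence [eta - t xi0] is orthogonal to the
     dense orbit of [xi0], and [xi0] is a multiple of [eta], which lies in [N]. *)
  have orth x : complex.Re (inner (hemb f x) (eta - t%:C *: xi0) : R[i]) = 0.
    rewrite innerBr innerZr conjc_real ReB ReZ -Txi0 innerTxi0 -psi_rho.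
    rewrite /psi mulVKf ?gt_eqF// {1}xiE.
    have -> : T x (eta + eta') = T x eta + T x eta'.
      by have := Tlin x 1 eta eta'; rewrite !scale1r.
    by rewrite innerDl cross' addr0 subrr.
  have z0 : eta - t%:C *: xi0 = 0.
    by apply: (dense_orth Ddense) => _ [x _ <-]; exact: orth.
  have -> : xi0 = t^-1%:C *: eta.
    move/eqP : z0; rewrite subr_eq0 => /eqP ->.
    by rewrite scalerA -rcM mulVf ?scale1r// gt_eqF.
  exact: NZ.
have prim : primitive_ideal (rep_ker pi) by exists (hcompl f), pi.
have [P0 P0E] := prim_of_ideal prim.
exists P0; split.
  move=> S U FS /=; rewrite nbhsE => -[W [oW WP0] WU].
  apply: contrapT => SU.
  have SW : S `<=` ~` W by move=> P SP WP; apply: SU; exists P; split=> //; exact: WU.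
  rewrite prim_openE /hk_open in oW.
  have [b kb Pb] : exists2 b, Defs.kernel (~` W) b & ~ ideal_of P0 b.
    apply: contrapT => nb; apply: (oW P0) => // b kb.
    by apply: contrapT => Pb; apply: nb; exists b.
  apply: Pb; rewrite P0E => h.
  (* At every [P] in [S] the element [b] acts as 0, so [(b u)^* (b u)] has upper bound 0 along [F]
     and [rho] is at most 0 on it. *)
  have small u : nr (pi b (hemb f u)) = 0.
    have : nr (pi b (hemb f u)) ^+ 2 <= 0.
      rewrite /pi Themb nr_hemb fnormK.
      have -> : fnorm2 f (L (b, 0) u) = rho (umul (ustar (L (b, 0) u)) (L (b, 0) u)) by [].
      apply: rho_le0; apply: filterS FS => P SP xi.
      have b0 := (prim_kerP P b).1 (kb P (SW P SP)).
      rewrite rq_sq upiM [upi (b, 0) _]/upi /= b0 scale0r addr0 nr0 expr0n/=.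
      by rewrite mul0r.
    move=> h2; apply/eqP; rewrite -(@sqrf_eq0 R) eq_le h2; exact: sqr_ge0.
  apply: (dense_op_eq (C' := 0) (T' := fun=> 0) Ddense (TB _) (TC _)).
  - by move=> *; rewrite subr0.
  - by move=> *; rewrite nr0 mul0r.
  - by move=> _ [u _ <-]; apply: nr_eq0; exact: small.
move=> e' /andP[e'0 e'eps] sm.
(* [prim_pi] at [P0] is a chosen representation and [pi] another one with the same kernel; the bound
   on [d] is transferred through membership of [x] in that kernel. *)
have [|x xP] := @spectral_element R A d e' d1.
  by rewrite e'0/= (le_trans (ltW e'eps))//; case/andP: eps01.
have : rep_small pi d e'.
  apply/(xP _ _ pir) => v.
  have : ideal_of P0 x by apply/prim_kerP; apply/(xP _ _ (prim_rep P0)).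
  by rewrite P0E; exact.
move=> /(_ xi0); rewrite nxi0 expr1n mulr1.
have -> : nr (pi d xi0) ^+ 2 = rho dd.
  rewrite -innerTxi0 (_ : T dd xi0 = pi (star d ** d) xi0)//.
  by rewrite (rep_cstar pir).
by rewrite rho_a => /(le_trans q_dd); rewrite leNgt e'eps.
Qed.

End Compactness.

(* Countable families of compact sets [K i] and open sets [O i] that together
   express that the space is locally compact and second countable. *)
Definition lc2 (Z : topologicalType) (K W : nat -> set Z) :=
  [/\ forall i, compact (K i), forall i, open (W i), forall i, W i `<=` K i &
      forall U z, open U -> U z -> exists i, W i z /\ K i `<=` U].

Lemma prim_lc2 (R : realType) (A : cstarAlgType R) : cstar_separable A ->
  exists K W : nat -> set (Prim A), lc2 K W.
Proof.
move=> sepA; have [D [cD dD]] := sepA; have [g gD] := countable_cover_seq 0 cD.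
(* Starting at a quarter, an element within [del n] of one of norm at most [4^-1] has norm at most
   [2^-1], and [ep n] is at most [2^-1], as [spectral_element] requires. *)
pose del (n : nat) : R := n.+4%:R^-1.
pose ep n : R := (2 * del n) ^+ 2.
have del0 n : 0 < del n by rewrite invr_gt0.
have del4 n : del n <= 4^-1 by rewrite lef_pV2 ?posrE// ler_nat.
have ep01 n : 0 < ep n <= 2^-1.
  rewrite exprn_gt0 ?mulr_gt0//=.
  have h : 2 * del n <= 2^-1 by have := del4 n; lra.
  have h0 : 0 <= 2 * del n by rewrite mulr_ge0// ltW.
  rewrite (@le_trans _ _ ((2^-1) ^+ 2))//; last by lra.
  by rewrite ler_sqr ?nnegrE.
pose K i := if unpickle i is Some (j, n) then
  [set P : Prim A | nr (g j) <= 2^-1 /\ rep_big P (g j) (ep n)] else set0.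
pose W i := if unpickle i is Some (j, n) then
  [set P : Prim A | nr (g j) <= 2^-1 /\ ~ rep_small (@prim_pi _ _ P) (g j) (ep n)]
  else set0.
exists K, W; split.
- move=> i; rewrite /K; case: (unpickle i) => [[j n]|]; last exact: compact0.
  move=> F FF FK.
  have [P [d1 _]] := filter_ex FK.
  have FB : F [set P | rep_big P (g j) (ep n)] by apply: filterS FK => Q [].
  have [P0 [cP bP]] := prim_cluster sepA d1 (ep01 n) FB.
  by exists P0.
- move=> i; rewrite /W; case: (unpickle i) => [[j n]|]; last exact: open0.
  have [d1|d1] := pselect (nr (g j) <= 2^-1); last first.
    rewrite (_ : [set _ | _] = set0); first exact: open0.
    by apply/seteqP; split=> // P [].
  have [x xP] := spectral_element d1 (ep01 n).
  rewrite prim_openE => Q hQ [_]; apply.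
  apply/(xP _ _ (prim_rep Q))/prim_kerP/hQ => P /= nP.
  apply/prim_kerP/(xP _ _ (prim_rep P)).
  by apply: contrapT => h; apply: nP.
- move=> i P; rewrite /W /K; case: (unpickle i) => [[j n]|//] [d1 ns].
  split=> // e' /andP[e'0 e'e] sm; apply: ns => v.
  by rewrite (le_trans (sm v))// ler_wpM2r ?sqr_ge0// ltW.
move=> U P oU UP.
have [a0 ka0 Pa0] : exists2 b, Defs.kernel (~` U) b & ~ ideal_of P b.
  move: oU; rewrite prim_openE => oU; apply: contrapT => nb; apply: (oU P) => // b kb.
  by apply: contrapT => Pb; apply: nb; exists b.
(* Rescales [a0] to norm at most [4^-1]; adding 1 avoids a case distinction on [a0 = 0]. *)
pose s := (4 * (nr a0 + 1))^-1.
have a1 : 0 < nr a0 + 1 by rewrite ltr_wpDl// nr_ge0.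
have s0 : 0 < s by rewrite invr_gt0 mulr_gt0.
pose a := s%:C *: a0.
have an : nr a <= 4^-1.
  rewrite nrZr gtr0_norm// /s invfM -mulrA ler_piMr//.
  by rewrite mulrC ler_pdivrMr// mul1r lerDl.
have Qa Q : (~` U) Q -> forall v, prim_pi a v = 0 :> primH Q.
  move=> UQ v; rewrite (repZ (prim_rep Q)).
  by rewrite ((prim_kerP Q a0).1 (ka0 Q UQ) v) scaler0.
have [v av] : exists v, prim_pi a v != 0 :> primH P.
  apply: contrapT => nv; apply: Pa0; apply/prim_kerP => v.
  apply/eqP/negPn/negP => pv; apply: nv; exists v.
  rewrite (repZ (prim_rep P)) scaler_eq0 negb_or pv andbT.
  by apply/eqP => /complexI s00; rewrite s00 ltxx in s0.
have pr := prim_rep P.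
have v0 : 0 < nr v.
  rewrite lt0r nr_ge0 andbT; apply: contra av => /eqP/nr_eq0 ->.
  by rewrite (rep_op0 pr).
have av0 : 0 < nr (prim_pi a v).
  rewrite lt0r nr_ge0 andbT; apply: contra av => /eqP/nr_eq0 ->.
  by [].
(* If [d] is within [del n] of [a], then [|pi_P(d) v| > 2 del n |v|], which puts [P] in the open
   set; off [U], where [a] acts as 0, the norm of [d] is at most [del n]. The threshold
   [ep n = (2 del n)^2] separates the two. *)
have [n hn] : exists n, 3 * del n * nr v < nr (prim_pi a v).
  have e0 : 0 < nr (prim_pi a v) / 2 by rewrite divr_gt0.
  have [N hN] := @inv_small R _ (3 * nr v) e0 (mulr_ge0 (ler0n _ _) (ltW v0)).
  exists N; have := hN N.+3 (leq_trans (leqnSn _) (leq_trans (leqnSn _) (leqnSn _))).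
  rewrite -/(del N) => h; rewrite (@le_lt_trans _ _ (nr (prim_pi a v) / 2))//.
    by rewrite (le_trans _ h)// mulrA [del N * 3]mulrC.
  by rewrite ltr_pdivrMr// ltr_pMr// ltr1n.
have [d [Dd ad]] : D `&` [set y | nr (a - y) < del n] !=set0.
  rewrite setIC; apply: dD; first by exists a; rewrite /= subrr nr0.
  rewrite openE => y /= ay; apply/nbhs_nr.
  exists ((del n - nr (a - y)) / 2); first by rewrite divr_gt0// subr_gt0.
  move=> z yz /=; rewrite (le_lt_trans (nr_tri y _ _))//.
  by move: (nr (y - z)) (nr (a - y)) (del n) yz ay => t t' t''; lra.
have [j gj] := gD d Dd.
have d1 : nr d <= 2^-1.
  have := nr_sub d a; rewrite (nrC d); move: ad; rewrite /= => ad.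
  by have := del4 n; lra.
exists (pickle (j, n)); rewrite /W /K pickleK gj; split.
  split=> // /(_ v); rewrite /ep -exprMn ler_sqr ?nnegrE ?nr_ge0 ?mulr_ge0 ?(ltW (del0 _)) ?nr_ge0//.
  have : nr (prim_pi a v) <= nr (prim_pi (a - d) v) + nr (prim_pi d v).
    by rewrite -{1}(subrK d a) (repD pr) nrD.
  have := rep_contractive pr (a - d) v.
  have : nr (a - d) * nr v <= del n * nr v by rewrite ler_wpM2r ?nr_ge0// ltW.
  move: (nr (prim_pi a v)) (nr (prim_pi (a - d) v)) (nr (prim_pi d v)) (nr (a - d) * nr v) hn.
  by move=> x y z w; lra.
move=> Q [_ Qbig]; apply: contrapT => UQ.
apply: (Qbig (del n ^+ 2)).
  rewrite exprn_gt0//=.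
  rewrite ltr_sqr ?nnegrE ?mulr_ge0// ?ltW// ltr_pMl// ltr1n//.
move=> w; rewrite -exprMn ler_sqr ?nnegrE ?mulr_ge0 ?nr_ge0 ?(ltW (del0 _))//.
have -> : prim_pi d w = - prim_pi (a - d) w :> primH Q.
  by rewrite (repB (prim_rep Q)) (Qa Q UQ) sub0r opprK.
rewrite nrN (le_trans (rep_contractive (prim_rep Q) _ _))//.
by rewrite ler_wpM2r ?nr_ge0// ltW.
Qed.

(** * k_omega spaces *)

Section Separation.
Context (X : topologicalType).

(** Otherwise the traces of the closures on [P] would cluster at a point of [P], against [sep]. The
    filter is left general so that it can be the neighbourhoods of a point and then those of a
    compact set, giving separation in two rounds. *)
Lemma compact_avoids_closure (F : set_system X) (P : set X) : Filter F -> compact P ->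
  (forall x, P x -> exists A B, [/\ nbhs x A, F B & A `&` B = set0]) ->
  exists2 B, F B & P `&` closure B = set0.
Proof.
move=> FF cP sep; apply: contrapT => nB.
have ne B : F B -> P `&` closure B !=set0.
  by move=> FB; apply/set0P/eqP => PB0; apply: nB; exists B.
pose G := filter_from F (fun B => P `&` closure B).
have PG : ProperFilter G.
  apply: filter_from_proper => //; apply: filter_from_filter.
    by exists setT; exact: filterT.
  move=> B B' FB FB'; exists (B `&` B'); first exact: filterI.
  move=> x [Px cx]; split; split=> //; apply: closureS cx; first exact: subIsetl.
  exact: subIsetr.
have GP : G P by exists setT; [exact: filterT|exact: subIsetl].
have [x [Px xG]] := cP G PG GP.
have [A [B [xA FB AB]]] := sep x Px.
have [|y [[_ cBy] Ay]] := xG (P `&` closure B) A° _ (nbhs_interior xA).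
  by exists B.
have [z [Bz Az]] := cBy A Ay.
by rewrite -[False]/(set0 z) -AB.
Qed.

Hypothesis hX : hausdorff_space X.

Lemma hausdorff_sep (x y : X) : x <> y ->
  exists A B, [/\ nbhs x A, nbhs y B & A `&` B = set0].
Proof.
move=> xy; apply: contrapT => nAB; apply: xy; apply: hX => A B xA yB.
by apply/set0P/eqP => AB; apply: nAB; exists A, B.
Qed.

Lemma compact_sep (P Q : set X) : compact P -> compact Q -> P `&` Q = set0 ->
  exists V, [/\ open V, Q `<=` V & P `&` closure V = set0].
Proof.
move=> cP cQ PQ.
have [|B QB PB] := @compact_avoids_closure (set_nbhs Q) P _ cP.
  move=> x Px; have [|B xB QB] := @compact_avoids_closure (nbhs x) Q _ cQ.
    move=> y Qy; have [|A [B [yA xB AB]]] := @hausdorff_sep y x.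
      by move=> yx; rewrite -[False]/(set0 x) -PQ; split=> //; rewrite -yx.
    by exists A, B.
  exists B, (~` closure B); split=> //.
    move=> y Qy; apply: open_nbhs_nbhs; split; last first.
      by move=> cy; rewrite -[False]/(set0 y) -QB.
    by apply: closed_openC; exact: closed_closure.
  by apply/seteqP; split=> // z [Bz]; apply; exact: subset_closure.
move/set_nbhsP : QB => [V [oV QV VB]]; exists V; split=> //.
by apply/seteqP; split=> // z [Pz /(closureS VB) cz]; rewrite -PB.
Qed.

End Separation.

Section KOmega.
Context (R : realType) (X : topologicalType) (K : nat -> set X).
Hypotheses (hX : hausdorff_space X) (KT : \bigcup_n K n = setT).
Hypotheses (Kinc : forall n, K n `<=` K n.+1) (Kc : forall n, compact (K n)).
Hypothesis Kcl : forall F : set X, (forall n, closed (F `&` K n)) -> closed F.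

Let Kmono m n : (m <= n)%N -> K m `<=` K n.
Proof.
elim: n => [|n ih]; first by rewrite leqn0 => /eqP ->.
rewrite leq_eqVlt => /predU1P[->//|]; rewrite ltnS => /ih h.
by apply: (subset_trans h); exact: Kinc.
Qed.

Let Kclosed n : closed (K n).
Proof. exact: compact_closed. Qed.

Let sub_compact n (C : set X) : closed C -> C `<=` K n -> compact C.
Proof. move=> cC CK; exact: (@subclosed_compact _ C (K n) cC (Kc (n := n)) CK). Qed.

Section Normal.
Variables A B : set X.
Hypotheses (cA : closed A) (cB : closed B) (AB : A `&` B = set0).

(** Disjoint closed sets inside [K n], enlarged step by step. The space need not be locally compact,
    so openness is reached only in the union: each set is contained in the interior, relative to
    [K n.+1], of the next one. Keeping each set off the opposite closed set allows the remaining
    traces of [A] and [B] to be added later. *)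
Let inv n (C : set X * set X) := [/\ closed C.1 /\ closed C.2,
  C.1 `<=` K n /\ C.2 `<=` K n, C.1 `&` C.2 = set0,
  C.1 `&` B = set0 /\ C.2 `&` A = set0 &
  A `&` K n `<=` C.1 /\ B `&` K n `<=` C.2].

Let nbd n (C C' : set X) := exists U, [/\ open U, C `<=` U & U `&` K n `<=` C'].

Let disj (S T : set X) : S `&` T = set0 -> forall x, S x -> T x -> False.
Proof. by move=> ST x Sx Tx; rewrite -[False]/(set0 x) -ST. Qed.

Let step n C : inv n C -> exists C', [/\ inv n.+1 C', nbd n.+1 C.1 C'.1 &
  nbd n.+1 C.2 C'.2].
Proof.
case: C => C D [] /= [cC cD] [CK DK] CD [CB DA] [AC BD].
pose P := C `|` (A `&` K n.+1); pose Q := D `|` (B `&` K n.+1).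
have clP : closed P by apply: closedU => //; exact: closedI.
have clQ : closed Q by apply: closedU => //; exact: closedI.
have PK : P `<=` K n.+1 by move=> x [/CK/Kinc//|[]].
have QK : Q `<=` K n.+1 by move=> x [/DK/Kinc//|[]].
have PQ : P `&` Q = set0.
  apply/seteqP; split=> // x [[Cx|[Ax Kx]] [Dx|[Bx _]]].
  - exact: disj CD x Cx Dx.
  - exact: disj CB x Cx Bx.
  - exact: disj DA x Dx Ax.
  - exact: disj AB x Ax Bx.
have [V [oV QV PV]] := compact_sep hX (sub_compact clP PK) (sub_compact clQ QK) PQ.
pose C' := K n.+1 `&` ~` V.
have clC' : closed C' by apply: closedI => //; exact: open_closedC.
have C'K : C' `<=` K n.+1 by exact: subIsetl.
have C'Q : C' `&` Q = set0 by apply/seteqP; split=> // x [[_ nV] /QV].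
have PC' : P `<=` C'.
  move=> x Px; split; first exact: PK.
  by move=> /subset_closure cx; exact: disj PV x Px cx.
have [V' [oV' C'V' QV']] := compact_sep hX (sub_compact clQ QK)
  (sub_compact clC' C'K) (etrans (setIC _ _) C'Q).
pose D' := K n.+1 `&` ~` V'.
exists (C', D'); split.
- split=> /=.
  + by split=> //; apply: closedI => //; exact: open_closedC.
  + by split=> //; exact: subIsetl.
  + by apply/seteqP; split=> // x [/C'V' V'x []].
  + split; apply/seteqP; split=> // x [].
      by move=> C'x Bx; apply: (disj C'Q C'x); right; split=> //; exact: C'K.
    by move=> [Kx nV'] Ax; apply/nV'/C'V'/PC'; right.
  + split=> x [h Kx]; first by apply: PC'; right.
    split=> // V'x; have Qx : Q x by right.
    exact: disj QV' x Qx (subset_closure V'x).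
- exists (~` closure V); split=> /=.
  + by apply: closed_openC; exact: closed_closure.
  + by move=> x Cx cx; apply: (disj PV (x := x)) cx; left.
  + by move=> x [nV Kx]; split=> // Vx; apply: nV; exact: subset_closure.
- exists (~` closure V'); split=> /=.
  + by apply: closed_openC; exact: closed_closure.
  + by move=> x Dx cx; apply: (disj QV' (x := x)) cx; left.
  + by move=> x [nV Kx]; split=> // Vx; apply: nV; exact: subset_closure.
Qed.

Let base : exists C, inv 0 C.
Proof.
exists (A `&` K 0%N, B `&` K 0%N); split=> /=.
- by split; exact: closedI.
- by split; exact: subIsetr.
- by apply/seteqP; split=> // x [[Ax _] [Bx _]]; exact: (disj AB Ax Bx).
- split; apply/seteqP; split=> // x.
    by move=> [[Ax _] Bx]; exact: (disj AB Ax Bx).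
  by move=> [[Bx _] Ax]; exact: (disj AB Ax Bx).
- by split=> x.
Qed.

(** Openness may be tested on each [K n], and there the union coincides with the union of the open
    sets [U m] for [m >= n]. *)
Let union_open (C : nat -> set X) : (forall n, C n `<=` K n) ->
  (forall n, nbd n.+1 (C n) (C n.+1)) -> open (\bigcup_n C n).
Proof.
move=> CK CC.
have /choice[U UP] n : exists U, [/\ open U, C n `<=` U & U `&` K n.+1 `<=` C n.+1].
  exact: CC.
have Cm m n : (m <= n)%N -> C m `<=` C n.
  elim: n => [|n ih]; first by rewrite leqn0 => /eqP ->.
  rewrite leq_eqVlt => /predU1P[->//|]; rewrite ltnS => /ih h.
  apply: (subset_trans h) => x Cx; have [_ CU UC] := UP n; apply: UC; split.
    exact: CU.
  by apply: Kinc; exact: CK.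
rewrite -[X in open X]setCK; apply: closed_openC; apply: Kcl => n.
pose O' := \bigcup_(m in [set m | (n <= m)%N]) U m.
have oO : open O' by apply: bigcup_open => m _; case: (UP m).
suff -> : ~` (\bigcup_n0 C n0) `&` K n = ~` O' `&` K n.
  by apply: closedI => //; exact: open_closedC.
apply/seteqP; split=> x [nx Kx]; split=> //.
- move=> [m /= nm Um]; apply: nx; exists m.+1 => //.
  have [_ _ UC] := UP m; apply: UC; split=> //.
  exact: Kmono (leq_trans nm (leqnSn _)) _ Kx.
- move=> [m _ Cx]; apply: nx; exists (maxn n m); first exact: leq_maxl.
  by have [_ CU _] := UP (maxn n m); apply: CU; exact: Cm (leq_maxr _ _) _ Cx.
Qed.

Lemma komega_separate :
  exists U V, [/\ open U, open V, A `<=` U, B `<=` V & U `&` V = set0].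
Proof.
have [C0 C0P] := base.
have /choice[nx nxP] (p : nat * (set X * set X)) : exists C', inv p.1 p.2 ->
    [/\ inv p.1.+1 C', nbd p.1.+1 p.2.1 C'.1 & nbd p.1.+1 p.2.2 C'.2].
  have [/step[C' h]|h] := pselect (inv p.1 p.2); first by exists C'.
  by exists (set0, set0).
pose C := fix C n := if n is m.+1 then nx (m, C m) else C0.
have iC n : inv n (C n) by elim: n => [//|n ih]; case: (nxP (n, C n) ih).
have CS n : nbd n.+1 (C n).1 (C n.+1).1 /\ nbd n.+1 (C n).2 (C n.+1).2.
  by case: (nxP (n, C n) (iC n)).
have mono (j : set X * set X -> set X) : (forall n, j (C n) `<=` K n) ->
    (forall n, nbd n.+1 (j (C n)) (j (C n.+1))) ->
    forall m n, (m <= n)%N -> j (C m) `<=` j (C n).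
  move=> jK jC m; elim=> [|n ih]; first by rewrite leqn0 => /eqP ->.
  rewrite leq_eqVlt => /predU1P[->//|]; rewrite ltnS => /ih h.
  apply: (subset_trans h) => x jx; have [U [_ CU UC]] := jC n; apply: UC; split.
    exact: CU.
  by apply: Kinc; exact: jK.
have K1 n : (C n).1 `<=` K n by case: (iC n) => _ [].
have K2 n : (C n).2 `<=` K n by case: (iC n) => _ [].
exists (\bigcup_n (C n).1), (\bigcup_n (C n).2); split.
- by apply: union_open => // n; case: (CS n).
- by apply: union_open => // n; case: (CS n).
- move=> x Ax; have [n _ Kx] : (\bigcup_n K n) x by rewrite KT.
  by exists n => //; have [_ _ _ _ [h _]] := iC n; exact: h.
- move=> x Bx; have [n _ Kx] : (\bigcup_n K n) x by rewrite KT.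
  by exists n => //; have [_ _ _ _ [_ h]] := iC n; exact: h.
apply/seteqP; split=> // x [[m _ Cx] [n _ Dx]].
have [_ _ CD _ _] := iC (maxn m n); apply: (disj CD (x := x)).
  by apply: (@mono fst) (leq_maxl _ _) _ Cx => // k; case: (CS k).
by apply: (@mono snd) (leq_maxr _ _) _ Dx => // k; case: (CS k).
Qed.

End Normal.

Lemma komega_normal : normal_space X.
Proof. by apply/(@normal_openP R) => A B cA cB AB; exact: komega_separate. Qed.

Lemma komega_tychonoff (x : X) (F : set X) : closed F -> ~ F x ->
  exists f : X -> R, [/\ continuous f, forall y, 0 <= f y <= 1, f x = 0 &
    forall y, F y -> f y = 1].
Proof.
move=> cF Fx; have cx : closed [set x].
  exact: (accessible_closed_set1 (hausdorff_accessible hX)).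
have xF : [set x] `&` F = set0 by apply/seteqP; split=> // y [-> /Fx].
have /(@uniform_separatorP _ R)[f [cf f01 fx fF]] :=
  (@normal_separatorP R X).1 komega_normal _ _ cx cF xF.
exists f; split=> //.
- by move=> y; have /f01 : range f (f y) by exists y.
- by apply: fx; exists x.
- by move=> y Fy; apply: fF; exists y.
Qed.

End KOmega.

(** * Metrizability of compact spaces with a countable network *)

Section NetworkMetrizable.
Context (R : realType) (T : topologicalType) (N : nat -> set T).
Hypotheses (hT : hausdorff_space T) (cT : compact [set: T]).
Hypothesis netN : forall U x, open U -> U x -> exists i, N i x /\ N i `<=` U.

(** The threshold [3^-1] lies strictly between the values 0 and 1 of a Urysohn function, so that
    network members around two distinct points can be found on its two sides. *)
Let good (p : set T * set T) (f : T -> R) := [/\ continuous f,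
  forall y, 0 <= f y <= 1, forall y, p.1 y -> f y < 3^-1 & forall y, p.2 y -> 3^-1 <= f y].

Let sep (n : nat) : T -> R := if unpickle n is Some (i, j) then
  if pselect (exists f, good (N i, N j) f) is left e then projT1 (cid e) else fun=> 0
  else fun=> 0.

Let sep_cont n : continuous (sep n).
Proof.
rewrite /sep; case: (unpickle n) => [[i j]|]; last by move=> x; exact: cvg_cst.
case: pselect => [e|_]; last by move=> x; exact: cvg_cst.
by case: (cid e) => f [].
Qed.

Let sep01 n x : 0 <= sep n x <= 1.
Proof.
rewrite /sep; case: (unpickle n) => [[i j]|]; last by rewrite lexx ler01.
case: pselect => [e|_]; last by rewrite lexx ler01.
by case: (cid e) => f [].
Qed.

Let sepP x y : (forall n, sep n x = sep n y) -> x = y.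
Proof.
move=> xy; apply: contrapT => nxy.
have [f [cf f01 fx fy]] : exists f : T -> R, [/\ continuous f,
    forall y, 0 <= f y <= 1, f x = 0 & forall z, [set y] z -> f z = 1].
  apply: (@komega_tychonoff R T (fun=> setT)) => //.
  - by apply/seteqP; split=> // z _; exists 0%N.
  - by move=> F h; have := h 0%N; rewrite setIT.
  - exact: (accessible_closed_set1 (hausdorff_accessible hT)).
have ox : open (f @^-1` [set r | r < 3^-1]).
  by apply: open_comp => [z _|]; [exact: cf|exact: open_lt].
have oy : open (f @^-1` [set r | 3^-1 < r]).
  by apply: open_comp => [z _|]; [exact: cf|exact: open_gt].
have [|i [Nx Ni]] := netN (x := x) ox; first by rewrite /= fx invr_gt0.
have [|j [Ny Nj]] := netN (x := y) oy; first by rewrite /= fy// invf_lt1// ltr1n.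
have e : exists f, good (N i, N j) f.
  by exists f; split=> // z /Nj/ltW.
have := xy (pickle (i, j)); rewrite /sep pickleK; case: pselect => [e'|/(_ e)//].
case: (cid e') => g /= [_ _ gi gj] gxy.
by have := gi x Nx; have := gj y Ny; rewrite gxy leNgt => /negbTE ->.
Qed.

(** A weighted supremum over the countable separating family; since the weights tend to 0, finitely
    many terms determine the distance up to a given error. *)
Let dset x y := [set `|sep n x - sep n y| / n.+1%:R | n in [set: nat]].
Let dist x y := sup (dset x y).

Let dset1 x y n : `|sep n x - sep n y| / n.+1%:R <= n.+1%:R^-1.
Proof.
rewrite ler_piMl ?invr_ge0// ler_norml.
by have /andP[? ?] := sep01 n x; have /andP[? ?] := sep01 n y; apply/andP; split; lra.
Qed.

Let dset_sup x y : has_sup (dset x y).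
Proof.
split; first by exists (`|sep 0 x - sep 0 y| / 1), 0%N.
exists 1 => _ [n _ <-]; rewrite (le_trans (dset1 _ _ _))// invf_le1// ler1n//.
Qed.

Let dist_ge n x y : `|sep n x - sep n y| / n.+1%:R <= dist x y.
Proof. by apply: ub_le_sup; [exact: (dset_sup x y).2|exists n]. Qed.

Let dist_le x y c : (forall n, `|sep n x - sep n y| / n.+1%:R <= c) -> dist x y <= c.
Proof. by move=> h; apply: ge_sup; [exact: (dset_sup x y).1|move=> _ [n _ <-]]. Qed.

Let dist_ge0 x y : 0 <= dist x y.
Proof. by apply: le_trans (dist_ge 0 x y); rewrite divr_ge0. Qed.

Let distxx x : dist x x = 0.
Proof.
apply/eqP; rewrite eq_le dist_ge0 andbT; apply: dist_le => n.
by rewrite subrr normr0 mul0r.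
Qed.

Let dist_pos x y : dist x y = 0 -> x = y.
Proof.
move=> xy; apply: sepP => n; apply/eqP; rewrite -subr_eq0 -normr_eq0.
have := dist_ge n x y; rewrite xy ler_pdivrMr// mul0r => h.
by rewrite eq_le h normr_ge0.
Qed.

Let dist_sym x y : dist x y = dist y x.
Proof.
by apply/eqP; rewrite eq_le; apply/andP; split; apply: dist_le => n;
  rewrite distrC dist_ge.
Qed.

Let dist_tri y x z : dist x z <= dist x y + dist y z.
Proof.
apply: dist_le => n; rewrite (le_trans _ (lerD (dist_ge n x y) (dist_ge n y z)))//.
by rewrite -mulrDl ler_wpM2r ?invr_ge0// -[X in `|X|](subrKA (sep n y)) ler_normD.
Qed.

Definition net_metric : Type := T.
HB.instance Definition _ := Choice.on net_metric.
HB.instance Definition _ := @isMetric.Build R net_metric dist distxx dist_pos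
  dist_sym dist_tri.

(** The identity is continuous, only finitely many terms of [dist] being able to exceed [e / 2]; as
    a map from a compact space to a Hausdorff one it is closed. *)
Lemma network_metrizable : metrizable R T.
Proof.
exists (net_metric : metricType R).
pose f : T -> net_metric := idfun; pose g : net_metric -> T := idfun.
have cf : continuous f.
  move=> x A /nbhs_ballP[e /= e0 eA].
  change (nbhs x A).
  have e20 : 0 < e / 2 by rewrite divr_gt0.
  have [M hM] := @inv_small R (e / 2) 1 e20 ler01.
  have near_n n : \forall y \near x, `|sep n x - sep n y| <= e / 2.
    by have /cvgrPdist_le/(_ _ e20) := @sep_cont n x.
  have near_M : \forall y \near x, forall n, (n < M)%N -> `|sep n x - sep n y| <= e / 2.
    elim: (M) => [|m ih]; first by apply: filterS filterT.
    apply: filterS2 ih (near_n m) => y h h' n; rewrite ltnS leq_eqVlt => /predU1P[->//|].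
    exact: h.
  apply: filterS near_M => y hy; apply: eA; rewrite ballEmdist /=.
  have : dist x y <= e / 2.
    apply: dist_le => n; have [nM|Mn] := ltnP n M.
      rewrite (le_trans _ (hy n nM))// ler_piMr// invf_le1// ler1n//.
    by rewrite (le_trans (dset1 _ _ _))// -[leLHS]mulr1 hM.
  by move=> h; rewrite (le_lt_trans h)// ltr_pdivrMr// ltr_pMr// ltr1n.
exists f, g; split=> //.
apply/continuousP => U oU; rewrite -[X in open X]setCK; apply: closed_openC.
have -> : ~` (g @^-1` U) = f @` (~` U).
  by apply/seteqP; split=> [x nx|_ [x nx <-]] //; exists x.
apply: compact_closed; first exact: metric_hausdorff.
apply: continuous_compact; first exact/continuous_subspaceT.
by apply: subclosed_compact (open_closedC oU) cT _.
Qed.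

End NetworkMetrizable.

Lemma set_type_compact (Y : topologicalType) (K : set Y) : compact K ->
  compact [set: set_type K].
Proof.
move=> cK F FF _.
have FK : (set_val @ F) K.
  apply: (@filterS _ F _ setT) => [x _|]; last exact: filterT.
  by change (K (set_val x)); rewrite set_valE; exact: set_mem (valP x).
have [y [Ky yF]] := cK (set_val @ F) _ FK.
exists (exist _ y (mem_set Ky)); split=> // A B FA.
rewrite nbhsE => -[G [[W oW WG] Gy] GB].
have [||z [[x Ax xz] Wz]] := yF (set_val @` A) W.
+ by apply: (@filterS _ F _ A) => // x Ax; exists x.
+ apply: open_nbhs_nbhs; split=> //.
  have Wy : W (set_val (exist _ y (mem_set Ky) : set_type K)).
    by rewrite -WG in Gy.
  by rewrite set_valE in Wy.
by exists x; split=> //; apply: GB; rewrite -WG /= xz.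
Qed.

Lemma subset_metrizable (R : realType) (Y : topologicalType) (N : nat -> set Y)
    (K : set Y) : hausdorff_space Y -> compact K ->
  (forall U y, open U -> U y -> exists i, N i y /\ N i `<=` U) ->
  metrizable R (set_type K).
Proof.
move=> hY cK netN.
have vc : continuous (set_val : set_type K -> Y) by exact: initial_continuous.
apply: (@network_metrizable R _ (fun i => set_val @^-1` N i)).
- move=> p q pq; apply/val_inj/hY => A B pA qB.
  have [|//|z [Az Bz]] := pq (set_val @^-1` A) (set_val @^-1` B).
  + exact: vc.
  + exact: vc.
  by exists (set_val z).
- exact: set_type_compact.
- move=> U x [W oW <-] Wx; have [i [Ni NW]] := netN W _ oW Wx.
  by exists i; split=> // y /NW.
Qed.

Definition komega (R : realType) (X : topologicalType) (K : nat -> set X) :=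
  [/\ \bigcup_n K n = setT, forall n, K n `<=` K n.+1,
      forall n, compact (K n) /\ metrizable R (set_type (K n)) &
      forall F : set X, closed F <-> forall n, closed (F `&` K n)].

Lemma quotient_komega (R : realType) (Z Y : topologicalType) (K W : nat -> set Z)
    (f : Z -> Y) : lc2 K W -> quotient_map f -> hausdorff_space Y ->
  exists K' : nat -> set Y, komega R K'.
Proof.
move=> [Kc Wo WK base] [fsurj fq] hY.
have cf : continuous f.
  by apply/continuousP => U; move/fq.
pose C n := \bigcup_(i in [set i | (i <= n)%N]) (f @` K i).
have fK i : compact (f @` K i).
  by apply: continuous_compact => //; exact/continuous_subspaceT.
have netf U y : open U -> U y -> exists i, (f @` K i) y /\ f @` K i `<=` U.
  move=> oU Uy; have [z zy] := fsurj y; move/fq : oU => oU.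
  have [|i [Wz KU]] := base _ z oU; first by rewrite /= zy.
  exists i; split; first by exists z => //; exact: WK.
  by move=> _ [w /KU Uw <-].
have Cc n : compact (C n).
  rewrite (_ : C n = \big[setU/set0]_(i < n.+1) (f @` K i)).
    by apply: bigsetU_compact.
  by rewrite -(bigcup_mkord n.+1 (fun i => f @` K i)).
exists C; split.
- apply/seteqP; split=> // y _.
  have [i [Ky _]] := netf setT y openT I.
  by exists i => //; exists i => /=.
- by move=> n y [i /= ni Ky]; exists i => //=; exact: leq_trans ni _.
- by move=> n; split=> //; exact: subset_metrizable netf.
move=> F; split=> [cF n|cF].
  by apply: closedI => //; exact: compact_closed.
rewrite -[F]setCK; apply: open_closedC; apply/fq.
rewrite openE => z nz.
have [i [Wz _]] := base setT z openT I.
(* On [W i] the map [f] takes values in [C i], so there membership in [F] is the same as membership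
   in the closed set [F] cut with [C i]. *)
have oV : open (W i `&` f @^-1` (~` (F `&` C i))).
  apply: openI => //; apply/fq; exact: closed_openC.
apply: filterS (open_nbhs_nbhs (conj oV _)); last by split=> // -[].
move=> w [Ww nw] Fw; apply: nw; split=> //; exists i => //=.
by exists w => //; exact: WK.
Qed.

Lemma lc2_second_countable (Z : topologicalType) :
  locally_compact [set: Z] -> hausdorff_space Z -> @second_countable Z ->
  exists K W : nat -> set Z, lc2 K W.
Proof.
move=> lcZ hZ [B cB [Bo Bb]].
have [g gB] := @countable_cover_seq (set Z) B set0 cB.
pose ok i := B (g i) /\ compact (closure (g i)).
(* Basic sets without compact closure are replaced by the empty set. *)
pose W i := if pselect (ok i) then g i else set0.
exists (fun i => closure (W i)), W; split.
- move=> i; rewrite /W; case: pselect => [[_ //]|h].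
  by rewrite closure0; exact: compact0.
- by move=> i; rewrite /W; case: pselect => [[/Bo]|h] //; exact: open0.
- by move=> i; exact: subset_closure.
move=> U z oU Uz.
have [C] := lcZ z I; rewrite withinET => zC [cC clC].
have rz := compact_regular hZ cC zC.
have [V zV VU] : filter_from (nbhs z) closure (U `&` C).
  by apply: rz; apply: filterI => //; exact: open_nbhs_nbhs.
have [D [BD Dz] DV] := Bb z V zV.
have [i gi] := gB D BD.
have DU : closure D `<=` U `&` C by apply: (subset_trans (closureS DV)).
have oki : ok i.
  split; rewrite gi//; apply: subclosed_compact cC _; first exact: closed_closure.
  by move=> x /DU[].
exists i; rewrite /W; case: pselect => // h; rewrite gi; split=> //.
by move=> x /DU[].
Qed.

(** * The Glimm space *)

Section GlimmTopology.
Context (R : realType) (A : cstarAlgType R).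

Definition glimm_pi (P : Prim A) : glimm_quot A := (\pi_({eq_quot (glimm_equiv A)})%qT P).

Lemma glimm_piP (P Q : Prim A) : glimm_pi P = glimm_pi Q <-> glimm_rel P Q.
Proof.
split=> [PQ|PQ]; last exact/eqmodP.
by have /eqmodP := PQ : \pi_({eq_quot (glimm_equiv A)})%qT P =
  \pi_({eq_quot (glimm_equiv A)})%qT Q.
Qed.

Definition glimm_repr (x : glimm_quot A) : Prim A :=
  repr (x : {eq_quot (glimm_equiv A)}%qT).

Lemma glimm_reprK x : glimm_pi (glimm_repr x) = x.
Proof. exact: reprK. Qed.

Lemma glimm_fun_continuous (f : Prim A -> R[i]^o) : Cb f ->
  continuous (glimm_fun f : Glimm A -> R[i]^o).
Proof.
move=> Cf x.
pose i : Cb (A := A) := exist _ f (mem_set Cf).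
have xi := (@cvg_sup _ _ (fun f : Cb (A := A) =>
    Topological.class (initial_topology (glimm_fun (set_val f))))
  (nbhs (x : Glimm A)) x _).1 (@cvg_id _ _) i.
have := @initial_continuous _ _ (glimm_fun (set_val i)) x.
have -> : glimm_fun (set_val i) = glimm_fun f by rewrite set_valE.
by move=> fx U /fx /xi.
Qed.

Lemma to_glimm_continuous (X : topologicalType) (G : X -> Glimm A) :
  (forall f, Cb f -> continuous (fun x => glimm_fun f (G x))) -> continuous G.
Proof.
move=> Gf x; apply/cvg_sup => i.
apply: (@continuous_comp_initial _ _ _ (glimm_fun (set_val i))
  (G : X -> initial_topology (glimm_fun (set_val i)))).
by apply: Gf; rewrite set_valE; exact: set_mem (valP i).
Qed.

End GlimmTopology.

Lemma continuous_real_complex (R : realType) (X : topologicalType) (f : X -> R) :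
  continuous f -> continuous (fun x => (f x)%:C : R[i]^o).
Proof.
move=> cf x U /nbhs_nr[e e0 eU].
have /cvgrPdist_le/(_ _ e0) := cf x; apply: filterS => y fy; apply: eU.
have -> : ((f x)%:C - (f y)%:C : R[i]^o) = (f x - f y)%:C by rewrite rcB.
by rewrite nr_real.
Qed.

Definition tychonoff_separated (R : realType) (X : topologicalType) :=
  forall (x : X) (F : set X), closed F -> ~ F x ->
  exists f : X -> R, [/\ continuous f, forall y, 0 <= f y <= 1, f x = 0 &
    forall y, F y -> f y = 1].

Lemma real_Cb (R : realType) (A : cstarAlgType R) (X : topologicalType)
    (Phi : Prim A -> X) (f : X -> R) : continuous Phi -> continuous f ->
  (forall y, 0 <= f y <= 1) -> Cb (fun P => (f (Phi P))%:C : R[i]^o).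
Proof.
move=> cPhi cf f01; split.
  apply: (@continuous_real_complex R (Prim A) (f \o Phi)) => P.
  by apply: continuous_comp; [exact: cPhi|exact: cf].
exists 1; split; first exact: real1.
move=> M M1 P _ /=; apply: le_trans (ltW M1); rewrite nrE nr_real -[1]/(1%:C) lecR.
by have /andP[h0 h1] := f01 (Phi P); rewrite ger0_norm.
Qed.

(** Recognises the complete regularization: functions from [X] separate points and closed sets, and
    every function in [Cb] comes from [X]. It is applied both to the quotient of [Prim A] in the
    separable case and to the [X] realised by an AF algebra. *)
Lemma glimm_homeo (R : realType) (A : cstarAlgType R) (X : topologicalType)
    (Phi : Prim A -> X) : hausdorff_space X -> tychonoff_separated R X ->
  continuous Phi -> (forall x, exists P, Phi P = x) ->
  (forall f, Cb f -> exists2 g : X -> R[i]^o, continuous g & forall P, f P = g (Phi P)) ->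
  exists (F : Glimm A -> X) (G : X -> Glimm A),
    [/\ cancel F G, cancel G F, continuous F, continuous G &
        forall P, F (glimm_pi P) = Phi P].
Proof.
move=> hX tX cPhi sPhi fPhi.
have PhiE P Q : glimm_rel P Q <-> Phi P = Phi Q.
  split=> [/asboolP PQ|PQ]; last first.
    by apply/asboolP => f /fPhi[g _ fg]; rewrite !fg PQ.
  apply: contrapT => nPQ.
  have [|f [cf f01 fP fQ]] := tX (Phi P) [set Phi Q] _ nPQ.
    exact: (accessible_closed_set1 (hausdorff_accessible hX)).
  have /complexI := PQ _ (real_Cb cPhi cf f01).
  by rewrite fP fQ// => /eqP; rewrite eq_sym oner_eq0.
have /choice[s sP] := sPhi.
pose F (c : Glimm A) : X := Phi (glimm_repr c).
pose G (x : X) : Glimm A := glimm_pi (s x).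
have Fpi P : F (glimm_pi P) = Phi P.
  by apply/PhiE/glimm_piP; rewrite glimm_reprK.
exists F, G; split=> //.
- move=> c; rewrite /G -[RHS]glimm_reprK; apply/glimm_piP/PhiE.
  by rewrite sP.
- by move=> x; rewrite /G Fpi sP.
- move=> c U; rewrite nbhsE => -[W [oW Wc] WU].
  have [||f [cf f01 fc fW]] := tX (F c) (~` W).
  + exact: open_closedC.
  + by apply.
  have Cf := real_Cb cPhi cf f01.
  (* Radius [2^-1] separates the value 0 at [c] from the value 1 off [W]. *)
  pose S := [set z | nr (glimm_fun (fun P => (f (Phi P))%:C : R[i]^o) c - z) <= 2^-1].
  have NS : nbhs c (glimm_fun (fun P => (f (Phi P))%:C : R[i]^o) @^-1` S).
    apply: (glimm_fun_continuous Cf); apply/nbhs_nr.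
    by exists 2^-1 => //; rewrite invr_gt0.
  change (nbhs c (F @^-1` U)); apply: filterS NS => c'.
  rewrite /S /= {1}/glimm_fun -/(glimm_repr c) -/(F c) fc => h.
  apply: WU; apply: contrapT => nW.
  move: h; rewrite /glimm_fun -/(glimm_repr c') -/(F c') fW//.
  have -> : (0%:C - 1%:C : R[i]^o) = (- 1 : R)%:C by rewrite -rcB sub0r.
  by rewrite nr_real normrN1 leNgt invf_lt1// ltr1n.
- apply: to_glimm_continuous => f Cf; have [g cg fg] := fPhi f Cf.
  have -> : (fun x => glimm_fun f (G x)) = g.
    apply/funext => x; rewrite /glimm_fun -/(glimm_repr (G x)) fg -/(F (G x)).
    by rewrite /G Fpi sP.
  exact: cg.
Qed.

Lemma quotient_map_homeo (Z Y X : topologicalType) (q : Z -> Y)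
    (f : Y -> X) (g : X -> Y) : quotient_map q -> cancel f g -> cancel g f ->
  continuous f -> continuous g -> quotient_map (f \o q).
Proof.
move=> [sq oq] fg gf cf cg; split=> [x|U].
  by have [z zx] := sq (g x); exists z; rewrite /= zx gf.
split=> [oU|oU].
  have /oq : open (f @^-1` U) by apply: open_comp => // y _; exact: cf.
  by [].
have /oq oU' : open (q @^-1` (f @^-1` U)) by [].
have -> : U = g @^-1` (f @^-1` U) by apply/seteqP; split=> x /=; rewrite gf.
by apply: open_comp => // y _; exact: cg.
Qed.

Section SeparableGlimm.
Context (R : realType) (A : cstarAlgType R).
Hypothesis sepA : cstar_separable A.

Let Q : topologicalType := quotient_topology {eq_quot (glimm_equiv A)}%qT.
Let qpi (P : Prim A) : Q := (\pi_({eq_quot (glimm_equiv A)})%qT P).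

Let qpi_quotient : quotient_map qpi.
Proof.
split=> [y|U]; last by split.
by exists (repr (y : {eq_quot (glimm_equiv A)}%qT)); rewrite /qpi reprK.
Qed.

Let Cb_factor f : Cb f -> exists2 g : Q -> R[i]^o, continuous g &
  forall P, f P = g (qpi P).
Proof.
move=> Cf; exists (glimm_fun f); last by move=> P; rewrite (glimm_funE P Cf).
apply/quotient_continuous.
have -> : glimm_fun f \o \pi_(quotient_topology {eq_quot (glimm_equiv A)}%qT)%qT = f.
  by apply/funext => P; exact: glimm_funE P Cf.
by case: Cf.
Qed.

(** Functions in [Cb] descend continuously to the quotient and, by the definition of the relation,
    separate its points. *)
Let Q_hausdorff : hausdorff_space Q.
Proof.
move=> x y xy; have [P Px] := qpi_quotient.1 x; have [P' Py] := qpi_quotient.1 y.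
rewrite -Px -Py; apply/eqmodP/asboolP => f Cf.
have [g cg fg] := Cb_factor Cf; rewrite !fg Px Py.
apply: norm_hausdorff => B C gB gC.
have [z [Bz Cz]] := xy _ _ (cg x _ gB) (cg y _ gC).
by exists (g z).
Qed.

Lemma separable_glimm_quotient (X : topologicalType) : hausdorff_space X ->
  homeomorphic X (Glimm A) -> exists K : nat -> set X, komega R K.
Proof.
move=> hX [h [h' [hh' h'h ch ch']]].
have [K0 [W0 KW]] := prim_lc2 sepA.
have [K [KT Kinc Kcm Kcl]] := quotient_komega R KW qpi_quotient Q_hausdorff.
have tQ : tychonoff_separated R Q.
  move=> x F; apply: (komega_tychonoff R Q_hausdorff KT Kinc) => [n|E].
    by case: (Kcm n).
  by move/Kcl.
have cq : continuous qpi by exact: pi_continuous.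
have [F [G [FG GF cF cG _]]] := glimm_homeo Q_hausdorff tQ cq qpi_quotient.1 Cb_factor.
have q1 : quotient_map (h' \o G \o qpi).
  apply: (quotient_map_homeo (g := F \o h)) => //.
  - by move=> x; rewrite /= h'h GF.
  - by move=> x; rewrite /= FG hh'.
  - by move=> x; apply: continuous_comp; [exact: cG|exact: ch'].
  - by move=> x; apply: continuous_comp; [exact: ch|exact: cF].
exact: quotient_komega KW q1 hX.
Qed.

End SeparableGlimm.

(** * Quotients of a sum of Cantor spaces *)

Definition cantor_sum : Type := {_ : nat & cantor_space}.
HB.instance Definition _ := Topological.copy cantor_sum {_ : nat & cantor_space}.

Definition pref (m : nat) (x : cantor_space) : seq bool := mkseq x m.

Definition cyl (p : nat * seq bool) : set cantor_sum :=
  [set z | projT1 z = p.1 /\ pref (size p.2) (projT2 z) = p.2].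

Lemma size_pref m x : size (pref m x) = m.
Proof. exact: size_mkseq. Qed.

Lemma pref_eqP m (x y : cantor_space) :
  pref m x = pref m y <-> forall i, (i < m)%N -> x i = y i.
Proof.
split=> [xy i im|xy]; first by rewrite -(nth_mkseq true x im) -(nth_mkseq true y im) -/(pref m x) xy.
apply: (@eq_from_nth _ true); rewrite !size_mkseq// => i im.
by rewrite !nth_mkseq// xy.
Qed.

Lemma pref_le m n (x y : cantor_space) : (m <= n)%N -> pref n x = pref n y ->
  pref m x = pref m y.
Proof. by move=> mn /pref_eqP xy; apply/pref_eqP => i im; apply: xy; exact: leq_trans mn. Qed.

Lemma mem_cyl z m : cyl (projT1 z, pref m (projT2 z)) z.
Proof. by split=> //=; rewrite size_pref. Qed.

Lemma open_coord (i : nat) (b : bool) : open [set x : cantor_space | x i = b].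
Proof.
have : open (proj i @^-1` [set b] : set cantor_space).
  by apply: open_comp => [x _|]; [exact: proj_continuous|exact: discrete_open].
by congr open.
Qed.

Lemma open_pref m (s : seq bool) : open [set x : cantor_space | pref m x = s].
Proof.
elim: m s => [|m ih] s.
  have [->|s0] := eqVneq s [::].
    rewrite (_ : [set _ | _] = setT); first exact: openT.
    by apply/seteqP; split.
  rewrite (_ : [set _ | _] = set0); first exact: open0.
  by apply/seteqP; split=> // x /= xs; rewrite -xs eqxx in s0.
case/lastP: s => [|s b].
  rewrite (_ : [set _ | _] = set0); first exact: open0.
  by apply/seteqP; split=> // x /= xs; have := size_pref m.+1 x; rewrite xs.
rewrite (_ : [set _ | _] = [set x | pref m x = s] `&` [set x | x m = b]).
  by apply: openI => //; exact: open_coord.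
apply/seteqP; split=> x /=; rewrite /pref mkseqS.
  by move=> /eqP; rewrite eqseq_rcons => /andP[/eqP ? /eqP ?].
by move=> [-> ->].
Qed.

Lemma cyl_open p : open (cyl p).
Proof.
apply/sigT_openP => i; have [->|ip] := eqVneq i p.1.
  rewrite (_ : _ @^-1` _ = [set x | pref (size p.2) x = p.2]); first exact: open_pref.
  by apply/seteqP; split=> x /=; [case|split].
rewrite (_ : _ @^-1` _ = set0); first exact: open0.
by apply/seteqP; split=> // x [/= h]; rewrite h eqxx in ip.
Qed.

(** If every cylinder around [x] met the complement of [U], compactness would give a cluster point
    of such points; it agrees with [x] in all coordinates, so it is [x], and the neighbourhood [U]
    would meet its own complement. *)
Lemma pref_base (x : cantor_space) (U : set cantor_space) : nbhs x U ->
  exists m, forall y, pref m y = pref m x -> U y.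
Proof.
move=> xU; apply: contrapT => nm.
have ne m : exists y, pref m y = pref m x /\ ~ U y.
  apply: contrapT => ny; apply: nm; exists m => y yx.
  by apply: contrapT => nU; apply: ny; exists y.
pose G := filter_from [set: nat] (fun m => [set y | pref m y = pref m x /\ ~ U y]).
have PG : ProperFilter G.
  apply: filter_from_proper => [|m _]; last exact: ne m.
  apply: filter_from_filter; first by exists 0%N.
  move=> m n _ _; exists (maxn m n) => // y [yx nU].
  by split; split=> //; apply: pref_le yx; [exact: leq_maxl|exact: leq_maxr].
have [y [_ yG]] : [set: cantor_space] `&` cluster G !=set0.
  by apply: cantor_space_compact; exact: filterT.
have yx : y = x.
  apply/funext => i.
  have [|z [[zx _] /= zi]] := yG [set y | pref i.+1 y = pref i.+1 x /\ ~ U y]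
    [set z | z i = y i] _ (open_nbhs_nbhs (conj (open_coord i (y i)) erefl)).
    by exists i.+1.
  by rewrite -zi; move/pref_eqP : zx; exact.
have [||z [[_ nU] Uz]] := yG [set y | pref 0 y = pref 0 x /\ ~ U y] U.
- by exists 0%N.
- by rewrite yx.
by [].
Qed.

Lemma cyl_base (U : set cantor_sum) z : open U -> U z ->
  exists m, cyl (projT1 z, pref m (projT2 z)) `<=` U.
Proof.
case: z => n x /= oU Ux; have /sigT_openP/(_ n) oUn := oU.
have [|m mU] := @pref_base x (existT _ n @^-1` U).
  by apply: open_nbhs_nbhs; split.
exists m => -[n' y] [/= nn]; rewrite size_pref; subst n' => /mU; exact.
Qed.

Lemma cantor_sum_hausdorff : hausdorff_space cantor_sum.
Proof.
move=> [n x] [n' x'] pq.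
have h m : n = n' /\ pref m x = pref m x'.
  have [||z [[/= z1 z2] [/= z1' z2']]] := pq (cyl (n, pref m x)) (cyl (n', pref m x')).
  - apply: open_nbhs_nbhs; split; first exact: cyl_open.
    exact: (mem_cyl (existT _ n x) m).
  - apply: open_nbhs_nbhs; split; first exact: cyl_open.
    exact: (mem_cyl (existT _ n' x') m).
  by rewrite !size_pref in z2 z2'; rewrite -z1 -z1' -z2 -z2'.
have [nn _] := h 0%N; subst n'; congr existT; apply/funext => i.
by have [_ /pref_eqP] := h i.+1; apply.
Qed.

Lemma cantor_sum_locally_compact : locally_compact [set: cantor_sum].
Proof.
move=> [n x] _; rewrite withinET.
have cn : compact (existT _ n @` [set: cantor_space] : set cantor_sum).
  apply: continuous_compact; last exact: cantor_space_compact.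
  by apply/continuous_subspaceT; exact: existT_continuous.
exists (existT _ n @` [set: cantor_space]); last first.
  by split=> //; apply: compact_closed cn; exact: cantor_sum_hausdorff.
exact: (@existT_nbhs _ (fun=> cantor_space) n x setT filterT).
Qed.

Lemma cantor_sum_second_countable : @second_countable cantor_sum.
Proof.
exists (range cyl).
  by apply: (card_le_trans (card_image_le _ _)); exact: countableP.
split=> [_ [p _ <-]|z U]; first exact: cyl_open.
rewrite nbhsE => -[W [oW Wz] WU]; have [m mW] := cyl_base oW Wz.
exists (cyl (projT1 z, pref m (projT2 z))).
  by split; [exists (projT1 z, pref m (projT2 z))|exact: mem_cyl].
exact: (subset_trans mW).
Qed.

Section PointedMetric.
Context (R : realType) (M : metricType R) (p : M).
Definition pointed_metric : Type := M.
HB.instance Definition _ := PseudoMetric.copy pointed_metric M.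
HB.instance Definition _ := isPointed.Build pointed_metric p.

Lemma metric_cantor_surj : compact [set: M] -> exists f : cantor_space -> M,
  continuous f /\ forall y, exists x, f x = y.
Proof.
move=> cM.
have [f cf] := @cantor_surj R (pointed_metric : pseudoPMetricType R) cM
  (@metric_hausdorff _ M).
exists f; split=> // y; have [x _ fx] := @surj _ _ _ _ f y I.
by exists x.
Qed.

End PointedMetric.

Lemma cantor_cover (R : realType) (X : topologicalType) (K : set X) (x0 : X) :
  K x0 -> compact K -> metrizable R (set_type K) ->
  exists f : cantor_space -> X, continuous f /\ range f = K.
Proof.
move=> Kx0 cK [M [h [g [hg gh ch cg]]]].
have cM : compact [set: M].
  have -> : [set: M] = h @` setT.
    by apply/seteqP; split=> // m _; exists (g m).
  apply: continuous_compact; last exact: set_type_compact.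
  by apply/continuous_subspaceT.
have [f [cf sf]] := metric_cantor_surj (h (exist _ x0 (mem_set Kx0))) cM.
exists (fun x => set_val (g (f x))); split.
  move=> x; apply: (@continuous_comp _ _ _ f (fun m => set_val (g m))).
    exact: cf.
  apply: (@continuous_comp _ _ _ g set_val); first exact: cg.
  exact: initial_continuous.
apply/seteqP; split=> [_ [x _ <-]|x Kx].
  by rewrite set_valE; exact: set_mem (valP (g (f x))).
have [y fy] := sf (h (exist _ x (mem_set Kx))).
by exists y => //; rewrite fy hg set_valE.
Qed.

Lemma komega_cantor (R : realType) (X : topologicalType) (K : nat -> set X) (x0 : X) :
  hausdorff_space X -> komega R K ->
  exists q : cantor_sum -> X, quotient_map q.
Proof.
move=> hX [KT Kinc Kcm Kcl].
have Kmono m n : (m <= n)%N -> K m `<=` K n.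
  elim: n => [|n ih]; first by rewrite leqn0 => /eqP ->.
  rewrite leq_eqVlt => /predU1P[->//|]; rewrite ltnS => /ih h.
  by apply: (subset_trans h); exact: Kinc.
have [N _ KN] : (\bigcup_n K n) x0 by rewrite KT.
(* The index is shifted by [N] because a nonempty Cantor space maps onto [K n] only if [K n] is
   nonempty. *)
have /choice[f fP] n : exists f : cantor_space -> X, continuous f /\ range f = K (n + N)%N.
  apply: (@cantor_cover R _ _ x0); first exact: Kmono (leq_addl _ _) _ KN.
    by case: (Kcm (n + N)%N).
  by case: (Kcm (n + N)%N).
exists (fun z : cantor_sum => f (projT1 z) (projT2 z)); split.
  move=> x; have [n _ Kx] : (\bigcup_n K n) x by rewrite KT.
  have : range (f n) x by rewrite (fP n).2; exact: Kmono (leq_addr _ _) _ Kx.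
  by move=> [y _ fy]; exists (existT _ n y).
move=> U; split=> [oU|oU].
  apply/sigT_openP => n; apply: (@open_comp _ _ (f n)) => // x _; exact: (fP n).1.
have cnN n : closed (~` U `&` K (n + N)%N).
  have -> : ~` U `&` K (n + N)%N = f n @` (~` (f n @^-1` U)).
    rewrite -(fP n).2; apply/seteqP; split=> [x [nU [y _ fy]]|_ [y nU <-]].
      by exists y => //; rewrite /= fy.
    by split=> //; exists y.
  apply: compact_closed => //; apply: continuous_compact.
    by apply/continuous_subspaceT; exact: (fP n).1.
  have /sigT_openP/(_ n) oUn := oU.
  exact: subclosed_compact (open_closedC oUn) cantor_space_compact _.
rewrite -[U]setCK; apply: closed_openC; apply/Kcl => n.
have -> : ~` U `&` K n = (~` U `&` K (n + N)%N) `&` K n.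
  by apply/seteqP; split=> x [nU Kx]; [do 2!split=> //; exact: Kmono (leq_addr _ _) _ Kx|split=> //; case: nU].
by apply: closedI => //; apply: compact_closed => //; case: (Kcm n).
Qed.

(** * Invariant subspaces and l2 spaces *)

Definition lspan (R : realType) (V : lmodType R[i]) (n : nat) (e : 'I_n -> V) : set V :=
  [set x | exists c : 'I_n -> R[i], x = \sum_(i < n) c i *: e i].

Section Span.
Context (R : realType) (V : lmodType R[i]) (n : nat) (e : 'I_n -> V).

Lemma lspan0 : lspan e 0.
Proof. by exists (fun=> 0); rewrite big1// => i _; rewrite scale0r. Qed.

Lemma lspanZD k x y : lspan e x -> lspan e y -> lspan e (k *: x + y).
Proof.
move=> [c ->] [c' ->]; exists (fun i => k * c i + c' i).
rewrite scaler_sumr -big_split; apply: eq_bigr => i _ /=.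
by rewrite scalerA scalerDl.
Qed.

Lemma lspan_mem i : lspan e (e i).
Proof.
exists (fun j => (j == i)%:R); rewrite (bigD1 i)//= eqxx scale1r big1 ?addr0//.
by move=> j /negbTE ->; rewrite scale0r.
Qed.

Lemma lspan_ind (P : V -> Prop) : P 0 ->
  (forall k x y, P x -> P y -> P (k *: x + y)) -> (forall i, P (e i)) ->
  forall x, lspan e x -> P x.
Proof.
move=> P0 PZD Pe _ [c ->]; elim/big_ind: _ => [//|x y Px Py|i _].
  by have := PZD 1 x y Px Py; rewrite scale1r.
by have := PZD (c i) (e i) 0 (Pe i) P0; rewrite addr0.
Qed.

End Span.

Section FiniteDimClosed.
Context (R : realType) (V : completeNormedModType R[i]).

(** Induction on the number of generators. If the first one has distance [d > 0] from the closed
    span of the others, its coefficient is bounded by [d^-1] times the norm, so coefficients of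
    convergent sequences converge; otherwise it is redundant. *)
Lemma lspan_closed n (e : 'I_n -> V) : closed (lspan e).
Proof.
elim: n e => [|n ih] e.
  rewrite (_ : lspan e = [set 0]).
    exact: (accessible_closed_set1 (hausdorff_accessible (@norm_hausdorff _ V))).
  apply/seteqP; split=> [x [c ->]|_ ->]; first by rewrite big_ord0.
  by exists (fun=> 0); rewrite big_ord0.
pose e' i := e (lift ord0 i); pose v := e ord0.
have cW := ih e'; set W := lspan e' in cW.
have WZD (k : R[i]) x y : W x -> W y -> W (k *: x + y) by exact: lspanZD.
have W0 : W 0 by exact: lspan0.
have spanE x : lspan e x <-> exists k w, W w /\ x = k *: v + w.
  split=> [[c ->]|[k [_ [[c ->] ->]]]].
    rewrite big_ord_recl; exists (c ord0), (\sum_(i < n) c (lift ord0 i) *: e' i).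
    by split=> //; exists (fun i => c (lift ord0 i)).
  exists (fun i => if unlift ord0 i is Some j then c j else k).
  rewrite big_ord_recl unlift_none; congr (_ + _); apply: eq_bigr => i _.
  by rewrite liftK.
have [Wv|Wv] := pselect (W v).
  rewrite (_ : lspan e = W)//; apply/seteqP; split=> x.
    by move=> /spanE[k [w [Ww ->]]]; exact: WZD.
  by move=> Wx; apply/spanE; exists 0, x; rewrite scale0r add0r.
have [d d0 dv] : exists2 d : R, 0 < d & forall w, W w -> d <= nr (v - w).
  apply: contrapT => nd; apply: Wv; move/closed_nr : cW; apply => t t0.
  apply: contrapT => nw; apply: nd; exists t => // w Ww.
  by rewrite leNgt; apply/negP => h; apply: nw; exists w => //; exact: ltW.
have dk k w : W w -> d * nr k <= nr (k *: v + w).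
  have [->|k0] := eqVneq k 0; first by rewrite nr0 mulr0 nr_ge0.
  move=> Ww; have -> : k *: v + w = k *: (v - (- k^-1) *: w).
    by rewrite scaleNr opprK scalerDr scalerA divff// scale1r.
  rewrite nrZ mulrC ler_wpM2l ?nr_ge0// dv//.
  by have := WZD (- k^-1) w 0 Ww W0; rewrite addr0.
apply/closed_nr => x ax.
have /choice[a aP] m : exists kw : R[i] * V, W kw.2 /\
    nr (x - (kw.1 *: v + kw.2)) <= m.+1%:R^-1.
  have m0 : 0 < m.+1%:R^-1 :> R by rewrite invr_gt0.
  by have [y /spanE[k [w [Ww ->]]] xy] := ax _ m0; exists (k, w).
have adist m n' : nr ((a m).1 - (a n').1) <= d^-1 * (m.+1%:R^-1 + n'.+1%:R^-1).
  rewrite ler_pdivlMl//.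
  have Wd : W ((a m).2 - (a n').2).
    by have := WZD (-1) _ _ (aP n').1 (aP m).1; rewrite scaleN1r addrC.
  rewrite (le_trans (dk _ _ Wd))// scalerBl addrACA -opprD.
  by rewrite (le_trans (nr_tri x _ _))// nrC lerD// (aP _).2.
have [k ak] : exists k : Cplx R, cvgs (fun m => (a m).1 : Cplx R) k.
  apply: seq_complete => t t0; have t20 : 0 < t / 2 by rewrite divr_gt0.
  have d10 : 0 <= d^-1 by rewrite invr_ge0 ltW.
  have [M hM] := @inv_small R _ d^-1 t20 d10.
  exists M => m n' Mm Mn; rewrite (le_trans (adist m n'))// mulrDr [t]splitr.
  by rewrite mulrC lerD ?hM// [d^-1 * _]mulrC hM.
apply/spanE; exists k, (x - k *: v); split; last by rewrite addrC subrK.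
move/closed_nr : cW; apply => t t0; have t20 : 0 < t / 2 by rewrite divr_gt0.
have v0 : 0 < nr v + 1 by rewrite ltr_wpDl// nr_ge0.
have [M1 hM1] := ak _ (divr_gt0 t20 v0); have [M2 hM2] := @inv_small R _ 1 t20 ler01.
pose M := maxn M1 M2; exists (a M).2; first exact: (aP M).1.
have -> : x - k *: v - (a M).2 = (x - ((a M).1 *: v + (a M).2)) + ((a M).1 - k) *: v.
  rewrite scalerBl opprD !addrA; set p := _ *: v; set q := _ *: v.
  by rewrite [x - q - _]addrAC subrK addrAC.
rewrite (le_trans (nrD _ _))// [t]splitr lerD//.
  by rewrite (le_trans (aP M).2)// -[leLHS]mulr1 hM2// leq_maxr.
rewrite nrZ (@le_trans _ _ (nr ((a M).1 - k) * (nr v + 1)))//.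
  by rewrite ler_wpM2l ?nr_ge0// lerDl.
by rewrite -ler_pdivlMr// hM1// leq_maxl.
Qed.

End FiniteDimClosed.

Section SubHilbert.
Context (R : realType) (H : hilbertType R) (N : set H).
Hypotheses (Nsub : is_subspace N) (Ncl : closed N).

(** A closed subspace is encoded as functions on a one-point set with weight 1, which makes it a
    [bfspace] and hence complete. *)
Let Nf (f : unit -> H) := N (f tt).

Let Nf0 : Nf 0. Proof. by case: Nsub. Qed.

Let NfZD (k : R[i]) f g : Nf f -> Nf g -> Nf (k *: f + g).
Proof. by case: Nsub => _ h; exact: h. Qed.

Let Nf_bd (f : unit -> H) : Nf f -> exists C, forall s, nr (f s) <= C * 1.
Proof. by move=> _; exists (nr (f tt)) => -[]; rewrite mulr1. Qed.

Let Nf_cl f : (forall e, 0 < e -> exists2 g, Nf g &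
  forall s, nr (f s - g s) <= e * 1) -> Nf f.
Proof.
move=> h; move/closed_nr : Ncl; apply => e /h[g Ng fg].
by exists (g tt) => //; have := fg tt; rewrite mulr1.
Qed.

Let one_ge0 (s : unit) : (0 : R) <= 1. Proof. exact: ler01. Qed.

Definition sub_bfspace : bfspace unit H := BFSpace one_ge0 Nf0 NfZD Nf_bd Nf_cl.

Definition subhilb : Type := bf sub_bfspace.
HB.instance Definition _ := CompleteNormedModule.copy subhilb (bf sub_bfspace).

Definition shval (x : subhilb) : H := bf_val x tt.
Definition mksh h (Nh : N h) : subhilb := @mkbf R unit H sub_bfspace (fun=> h) Nh.

Lemma shvalP x : N (shval x).
Proof. exact: (@bf_mem_val R unit H sub_bfspace x). Qed.

Lemma shval_inj : injective shval.
Proof. by move=> x y xy; apply: bf_eq => -[]. Qed.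

Lemma shvalZD k x y : shval (k *: x + y) = k *: shval x + shval y.
Proof. by []. Qed.
Lemma shvalB x y : shval (x - y) = shval x - shval y.
Proof. by []. Qed.
Lemma shval0 : shval 0 = 0.
Proof. by []. Qed.
Lemma nr_shval x : nr x = nr (shval x).
Proof.
apply/eqP; rewrite eq_le; apply/andP; split.
  by apply: (nr_bf_le (D := sub_bfspace)); [exact: nr_ge0|case; rewrite mulr1].
by have := nr_bf (D := sub_bfspace) x tt; rewrite mulr1.
Qed.

Let sinner (x y : subhilb) : R[i] := inner (shval x) (shval y).

Let sinner_lin k x y z : sinner (k *: x + y) z = k * sinner x z + sinner y z.
Proof. by rewrite /sinner shvalZD inner_linearl. Qed.
Let sinner_conj x y : sinner y x = Num.conj (sinner x y).
Proof. exact: inner_conj. Qed.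
Let sinner_norm x : `|x| ^+ 2 = sinner x x.
Proof. by rewrite nrE nr_shval -nrE norm_inner. Qed.

HB.instance Definition _ := isHilbert.Build R subhilb sinner_lin sinner_conj sinner_norm.

Lemma shinner (x y : subhilb) : inner x y = inner (shval x) (shval y) :> R[i].
Proof. by []. Qed.

Context (A : cstarAlgType R) (pi : A -> H -> H) (pir : star_representation pi).
Hypothesis Ninv : forall a h, N h -> N (pi a h).

Definition subrep (a : A) (x : subhilb) : subhilb := mksh (Ninv a (shvalP x)).

Lemma shval_subrep a x : shval (subrep a x) = pi a (shval x).
Proof. by []. Qed.

Lemma subrepP : star_representation subrep.
Proof.
split.
- move=> a k x y; apply: shval_inj.
  by rewrite shvalZD !shval_subrep shvalZD (rep_op_linear pir).
- move=> a; apply: (@continuous_nr _ _ _ _ (nr a)) => x y.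
  rewrite !nr_shval !shvalB !shval_subrep -(rep_opB pir).
  exact: rep_contractive.
- move=> k a b x; apply: shval_inj.
  by rewrite shvalZD !shval_subrep (rep_linear pir).
- by move=> a b x; apply: shval_inj; rewrite !shval_subrep (rep_mul pir).
- by move=> a x y; rewrite !shinner !shval_subrep (rep_star pir).
Qed.

Lemma primitive_sub : (exists a h, N h /\ pi a h != 0) ->
  (forall M, is_subspace M -> closed M -> M `<=` N -> (forall a h, M h -> M (pi a h)) ->
     M = [set 0] \/ N `<=` M) ->
  primitive_ideal [set a | forall h, N h -> pi a h = 0].
Proof.
move=> [a [h [Nh ah]]] irr; exists subhilb, subrep; split.
- exact: subrepP.
- split.
    exists a, (mksh Nh); apply: contra ah => /eqP ax.
    by rewrite -[pi a h]/(shval (subrep a (mksh Nh))) ax shval0.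
  move=> M [M0 MZD] cM Minv.
  have [||||M1|NM] := irr (shval @` M).
  + split; first by exists 0.
    by move=> k _ _ [x Mx <-] [y My <-]; exists (k *: x + y) => //; exact: MZD.
  + apply/closed_nr => x hx.
    have Nx : N x.
      move/closed_nr : Ncl; apply => e /hx[_ [y My <-] xy].
      by exists (shval y) => //; exact: shvalP.
    exists (mksh Nx) => //; move/closed_nr : cM; apply => e /hx[_ [y My <-] xy].
    by exists y => //; rewrite nr_shval shvalB.
  + by move=> _ [x _ <-]; exact: shvalP.
  + by move=> b _ [x Mx <-]; exists (subrep b x) => //; exact: Minv.
  + left; apply/seteqP; split=> [x Mx|_ ->//].
    by apply: shval_inj; rewrite shval0; have : [set 0] (shval x) by rewrite -M1; exists x.
  + right; apply/seteqP; split=> // x _.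
    by have [y My /shval_inj <-] := NM _ (shvalP x).
- apply/seteqP; split=> b bP.
    by move=> x; apply: shval_inj; rewrite shval_subrep bP// ; exact: shvalP.
  by move=> g Ng; rewrite -[pi b g]/(shval (subrep b (mksh Ng))) bP.
Qed.

End SubHilbert.

(** * The Hilbert space l2 over an arbitrary index set *)

Section L2.
Context (R : realType) (J : choiceType).

Definition fsup_pred : {pred J -> R[i]^o} :=
  fun f => `[< exists s : seq J, forall j, j \notin s -> f j = 0 >].

Lemma fsup_submod : submod_closed fsup_pred.
Proof.
split; first by apply/asboolP; exists [::].
move=> k f g /asboolP[s fs] /asboolP[t gt]; apply/asboolP; exists (s ++ t) => j.
rewrite mem_cat negb_or => /andP[/fs fj /gt gj].
have -> : (k *: f + g) j = k *: f j + g j by [].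
by rewrite fj gj scaler0 addr0.
Qed.

HB.instance Definition _ := GRing.isSubmodClosed.Build R[i] (J -> R[i]^o) fsup_pred
  fsup_submod.

Record fsup := Fsup { fsv : J -> R[i]^o ; fsvP : fsv \in fsup_pred }.
HB.instance Definition _ := [isSub for fsv].
HB.instance Definition _ := [Choice of fsup by <:].
HB.instance Definition _ := [SubChoice_isSubLmodule of fsup by <:].

Implicit Types f g h : fsup.

Definition covers (s : seq J) f := uniq s /\ forall j, j \notin s -> fsv f j = 0.

Lemma fsup_cover f : exists s, covers s f.
Proof.
have /asboolP[s fs] := fsvP f; exists (undup s); split; first exact: undup_uniq.
by move=> j; rewrite mem_undup => /fs.
Qed.

Definition cover f := projT1 (cid (fsup_cover f)).
Lemma coverP f : covers (cover f) f.
Proof. exact: projT2 (cid (fsup_cover f)). Qed.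

Lemma sum_covers (F : J -> R[i]) (s t : seq J) : uniq s -> uniq t ->
  (forall j, j \notin s -> F j = 0) -> (forall j, j \notin t -> F j = 0) ->
  \sum_(j <- s) F j = \sum_(j <- t) F j.
Proof.
move=> us ut sF tF.
have h (u v : seq J) : (forall j, j \notin v -> F j = 0) ->
    \sum_(j <- u) F j = \sum_(j <- [seq j <- u | j \in v]) F j.
  move=> vF; have e : \sum_(j <- u | j \notin v) F j = 0.
    by apply: big1 => j; exact: vF.
  by rewrite big_filter [LHS](bigID (mem v))/= e addr0.
rewrite (h s t)// [RHS](h t s)//; apply: perm_big; apply: uniq_perm.
- exact: filter_uniq.
- exact: filter_uniq.
- by move=> j; rewrite !mem_filter andbC.
Qed.

Definition l2dot f g : R[i] := \sum_(j <- cover f) fsv f j * (fsv g j)^*%C.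

Lemma l2dotE s f g : covers s f -> l2dot f g = \sum_(j <- s) fsv f j * (fsv g j)^*%C.
Proof.
move=> [us sf]; have [uc cf] := coverP f.
by apply: sum_covers => // j; [move=> /cf ->|move=> /sf ->]; rewrite mul0r.
Qed.

Lemma covers2 f g : exists s, covers s f /\ covers s g.
Proof.
exists (undup (cover f ++ cover g)).
by split; split; rewrite ?undup_uniq// => j; rewrite mem_undup mem_cat negb_or =>
  /andP[h1 h2]; [exact: (coverP f).2|exact: (coverP g).2].
Qed.

Lemma fsvZD k f g j : fsv (k *: f + g) j = k * fsv f j + fsv g j.
Proof. by []. Qed.

Lemma l2dot_linear k f g h : l2dot (k *: f + g) h = k * l2dot f h + l2dot g h.
Proof.
have [s [sf sg]] := covers2 f g.
have sfg : covers s (k *: f + g).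
  split; first exact: sf.1.
  by move=> j js; rewrite fsvZD sf.2// sg.2// mulr0 addr0.
rewrite (l2dotE _ sfg) (l2dotE _ sf) (l2dotE _ sg) mulr_sumr -big_split.
by apply: eq_bigr => j _; rewrite fsvZD mulrDl mulrA.
Qed.

Lemma l2dot_conj f g : l2dot g f = (l2dot f g)^*%C.
Proof.
have [s [sf sg]] := covers2 f g.
rewrite (l2dotE _ sf) (l2dotE _ sg).
have -> : (\sum_(j <- s) fsv f j * (fsv g j)^*)^*%C =
    \sum_(j <- s) (fsv f j * (fsv g j)^*)^*%C :> R[i] by exact: rmorph_sum.
by apply: eq_bigr => j _; rewrite conjM conjcK mulrC.
Qed.

Lemma l2dotff f s : covers s f -> l2dot f f = (\sum_(j <- s) nr (fsv f j) ^+ 2)%:C.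
Proof.
move=> sf; rewrite (l2dotE _ sf).
have -> : (\sum_(j <- s) nr (fsv f j) ^+ 2)%:C =
    \sum_(j <- s) (nr (fsv f j) ^+ 2)%:C :> R[i] by exact: rmorph_sum.
by apply: eq_bigr => j _; exact: nr_sq.
Qed.

Lemma l2dot_ge0 f : 0 <= complex.Re (l2dot f f).
Proof. by rewrite (l2dotff (coverP f))/= sumr_ge0// => j _; exact: sqr_ge0. Qed.

Definition l2form : psd_form fsup := PsdForm l2dot_linear l2dot_conj l2dot_ge0.

Definition l2 : hilbertType R := hcompl l2form.

Lemma delta_mem (j : J) : (fun i => (i == j)%:R : R[i]^o) \in fsup_pred.
Proof. by apply/asboolP; exists [:: j] => i; rewrite inE => /negbTE ->. Qed.

Definition delta (j : J) : fsup := Fsup (delta_mem j).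

Lemma delta_cover j : covers [:: j] (delta j).
Proof. by split=> // i; rewrite inE => /negbTE h; rewrite /= h. Qed.

Lemma l2dot_delta f j : l2dot f (delta j) = fsv f j.
Proof.
rewrite l2dot_conj (l2dotE _ (delta_cover j)) big_seq1 /= eqxx mul1r.
exact: conjcK.
Qed.

Definition ebase (j : J) : l2 := hemb l2form (delta j).

Lemma ebase_orth i j : inner (ebase i) (ebase j) = (i == j)%:R :> R[i].
Proof. by rewrite inner_hemb [LHS]l2dot_delta /= eq_sym. Qed.

Lemma nr_ebase j : nr (ebase j) = 1.
Proof.
have : nr (ebase j) ^+ 2 = 1 by rewrite nr2E ebase_orth eqxx.
by move=> /eqP; rewrite sqrp_eq1 ?nr_ge0// => /eqP.
Qed.

Lemma fsup_sum f : f = \sum_(j <- cover f) fsv f j *: delta j.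
Proof.
apply/val_inj/funext => i.
have vs (s : seq J) : val (\sum_(j <- s) fsv f j *: delta j) i =
    \sum_(j <- s) fsv f j * (i == j)%:R.
  elim: s => [|j s ih]; first by rewrite !big_nil.
  by rewrite !big_cons -ih.
rewrite [RHS]vs; have [uc fc] := coverP f.
have [ic|ic] := boolP (i \in cover f).
  rewrite (bigD1_seq i)//= eqxx mulr1 big1 ?addr0// => j ji.
  by rewrite eq_sym (negbTE ji) mulr0.
rewrite big_seq big1; first exact: fc.
move=> j jc; rewrite (_ : (i == j) = false) ?mulr0//.
by apply/eqP => ij; rewrite ij jc in ic.
Qed.

Lemma hemb_sum f : hemb l2form f = \sum_(j <- cover f) fsv f j *: ebase j.
Proof.
rewrite {1}[f]fsup_sum; elim: (cover f) => [|j s ih].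
  rewrite !big_nil; have := hembZ l2form 0 0; rewrite !scale0r; exact.
by rewrite !big_cons hembD hembZ ih.
Qed.

Section Diagonal.
Variable phi : pred J.

Lemma diag_mem f : (fun j => (phi j)%:R * fsv f j : R[i]^o) \in fsup_pred.
Proof.
apply/asboolP; exists (cover f) => j jc.
by rewrite (coverP f).2// mulr0.
Qed.

Definition fdiag f : fsup := Fsup (diag_mem f).

Lemma fdiag_covers s f : covers s f -> covers s (fdiag f).
Proof. by move=> [us sf]; split=> // j /sf /= ->; rewrite mulr0. Qed.

Lemma fdiag_adj f g : form l2form (fdiag f) g = form l2form f (fdiag g).
Proof.
rewrite [LHS](l2dotE _ (fdiag_covers (coverP f))) [RHS](l2dotE _ (coverP f)).
apply: eq_bigr => j _ /=; have -> : ((phi j)%:R : R[i])= (phi j)%:R%:C by case: (phi j).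
by rewrite conjM conjc_real mulrCA mulrA.
Qed.

Lemma fdiag_bound f : fnorm l2form (fdiag f) <= 1 * fnorm l2form f.
Proof.
rewrite mul1r -(@ler_sqr R) ?nnegrE ?fnorm_ge0// !fnormK /fnorm2.
have -> : form l2form (fdiag f) (fdiag f) = l2dot (fdiag f) (fdiag f) by [].
have -> : form l2form f f = l2dot f f by [].
rewrite (l2dotff (fdiag_covers (coverP f))) (l2dotff (coverP f)) /=.
apply: ler_sum => j _ /=; rewrite nrcM exprMn.
by case: (phi j); rewrite ?nrc1 ?nr0 ?expr1n ?expr0n ?mul1r ?mul0r// sqr_ge0.
Qed.

Definition diagop : l2 -> l2 := hop fdiag_adj fdiag_bound.

Lemma diagop_ebase j : diagop (ebase j) = (phi j)%:R *: ebase j.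
Proof.
rewrite /diagop hop_hemb -hembZ; congr hemb; apply/val_inj/funext => i.
have e : (phi i)%:R * (i == j)%:R = (phi j)%:R * (i == j)%:R :> R[i].
  by have [->//|_] := eqVneq i j; rewrite !mulr0.
exact: e.
Qed.

Lemma diagop_linear k x y : diagop (k *: x + y) = k *: diagop x + diagop y.
Proof. exact: hop_linear. Qed.

Lemma nr_diagop x : nr (diagop x) <= 1 * nr x.
Proof. by have := nr_hop fdiag_adj fdiag_bound x; rewrite normr1. Qed.

Lemma diagop_adj x y : inner (diagop x) y = inner x (diagop y) :> R[i].
Proof. exact: hop_adj. Qed.

End Diagonal.

Lemma l2_dense x (e : R) : 0 < e ->
  exists2 u, range (hemb l2form) u & nr (x - u) <= e.
Proof. by move=> /(hemb_dense x)[u hu]; exists (hemb l2form u) => //; exists u. Qed.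

Lemma l2_op_eq (T T' : l2 -> l2) (C C' : R) :
  (forall k x y, T (k *: x + y) = k *: T x + T y) -> (forall x, nr (T x) <= C * nr x) ->
  (forall k x y, T' (k *: x + y) = k *: T' x + T' y) -> (forall x, nr (T' x) <= C' * nr x) ->
  (forall j, T (ebase j) = T' (ebase j)) -> T =1 T'.
Proof.
move=> Tl TC T'l T'C TT.
have linB (S : l2 -> l2) : (forall k x y, S (k *: x + y) = k *: S x + S y) ->
    forall x y, S (x - y) = S x - S y.
  by move=> Sl x y; have := Sl (-1) y x; rewrite !scaleN1r addrC [X in _ = X]addrC.
have lin0 (S : l2 -> l2) : (forall k x y, S (k *: x + y) = k *: S x + S y) -> S 0 = 0.
  by move=> Sl; have := linB S Sl 0 0; rewrite !subrr.
apply: (dense_op_eq l2_dense (linB _ Tl) TC (linB _ T'l) T'C) => _ [f _ <-].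
rewrite hemb_sum; elim: (cover f) => [|j s ih].
  by rewrite !big_nil !lin0.
by rewrite !big_cons Tl T'l TT ih.
Qed.

End L2.

(** * Inductive limits of finite-dimensional algebras *)

Lemma fctZD (K : pzRingType) (T : Type) (V : lmodType K) (k : K) (f g : T -> V) x :
  (k *: f + g) x = k *: f x + g x.
Proof. by []. Qed.

Section InductiveLimit.
Context (R : realType) (E : completeNormedModType R[i]) (B : adj_form E).
Context (G : eqType) (gen_op : G -> E -> E) (gens : nat -> seq G).

Definition gspan (m : nat) : set (E -> E) :=
  lspan (fun i : 'I_(size (gens m)) => gen_op (tnth (in_tuple (gens m)) i)).

Lemma gspan_gen m g : g \in gens m -> gspan m (gen_op g).
Proof.
move=> /(@tnthP _ _ (in_tuple (gens m)))[i ->]; exact: lspan_mem.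
Qed.

Lemma gspan_ind m (P : (E -> E) -> Prop) : P 0 ->
  (forall k x y, P x -> P y -> P (k *: x + y)) -> (forall g, g \in gens m -> P (gen_op g)) ->
  forall x, gspan m x -> P x.
Proof.
by move=> P0 PZD Pg; apply: lspan_ind => // i; apply: Pg; exact: mem_tnth.
Qed.

Hypothesis gS : forall m g, g \in gens m -> gspan m.+1 (gen_op g).
Hypothesis gM : forall m g h, g \in gens m -> h \in gens m -> gspan m (gen_op g \o gen_op h).
Hypothesis gA : forall m g, g \in gens m -> exists2 T, gspan m T & adjoint B (gen_op g) T.
Hypothesis gL : forall g k x y, gen_op g (k *: x + y) = k *: gen_op g x + gen_op g y.
Hypothesis gC : forall g, exists2 C, 0 <= C & op_bounded (gen_op g) C.

Lemma gspanS m : gspan m `<=` gspan m.+1.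
Proof.
move=> f; apply: gspan_ind; [exact: lspan0|move=> k x y; exact: lspanZD|exact: gS].
Qed.

Lemma gspan_le m n : (m <= n)%N -> gspan m `<=` gspan n.
Proof.
move=> /subnKC <-; elim: (n - m)%N => [|d ih]; first by rewrite addn0.
by rewrite addnS => f /ih; exact: gspanS.
Qed.

Lemma gspan_lin m f : gspan m f -> forall k x y, f (k *: x + y) = k *: f x + f y.
Proof.
move: f; apply: gspan_ind => [k x y|c f g fl gl' k x y|g _]; last exact: gL.
  by rewrite /= scaler0 addr0.
by rewrite !fctZD fl gl' !scalerDr !scalerA mulrC addrACA.
Qed.

Lemma gspan_bd m f : gspan m f -> exists2 C, 0 <= C & op_bounded f C.
Proof.
move: f; apply: gspan_ind => [|c f g [C C0 fC] [D D0 gD]|g _]; last exact: gC.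
  by exists 0 => // x; rewrite mul0r nr0.
exists (nr c * C + D) => [|x]; first by rewrite addr_ge0 ?mulr_ge0 ?nr_ge0.
rewrite fctZD (le_trans (nrD _ _))// mulrDl lerD//.
by rewrite nrZ -mulrA ler_wpM2l ?nr_ge0.
Qed.

Lemma gspan_comp m f h : gspan m f -> gspan m h -> gspan m (f \o h).
Proof.
move=> mf mh; have := mf; move: f {mf}; apply: gspan_ind.
- exact: lspan0.
- by move=> k f f' hf hf'; exact: (lspanZD k hf hf').
move=> g gm; move: h mh; apply: gspan_ind; last by move=> h; exact: gM.
  rewrite (_ : _ \o _ = 0); first exact: lspan0.
  apply/funext => x; have := gL g (-1) 0 0.
  by rewrite scaler0 addr0 scaleN1r addNr.
move=> k f f' hf hf'; rewrite (_ : _ \o _ = k *: (gen_op g \o f) + (gen_op g \o f')).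
  exact: lspanZD.
by apply/funext => x; exact: gL.
Qed.

Lemma gspan_adj m f : gspan m f -> exists2 h, gspan m h & adjoint B f h.
Proof.
move: f; apply: gspan_ind => [|c f g [f' mf' ff'] [g' mg' gg']|g gm]; last exact: gA.
  exists 0; first exact: lspan0.
  by move=> x y; have := adjfBr B y y x; have := adjfBl B x x y; rewrite !subrr => -> ->.
exists (c^*%C *: f' + g') => [|x y]; first exact: lspanZD.
rewrite !fctZD adjfDl adjfDr adjfZ ff' gg'; congr (_ + _).
have f'0 : f' 0 = 0.
  by have := gspan_lin mf' (-1) 0 0; rewrite scaler0 addr0 scaleN1r addNr.
by have := gspan_lin mf' c^*%C y 0; rewrite !addr0 f'0 addr0 => ->.
Qed.

Definition lim_core : opcore B.
Proof.
refine (@OpCore R E B (\bigcup_m gspan m) _ _ _ _ _ _).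
- by exists 0%N => //; exact: lspan0.
- move=> k f g [m _ mf] [n _ ng]; exists (maxn m n) => //; apply: lspanZD.
    exact: gspan_le (leq_maxl _ _) _ mf.
  exact: gspan_le (leq_maxr _ _) _ ng.
- move=> f g [m _ mf] [n _ ng]; exists (maxn m n) => //; apply: gspan_comp.
    exact: gspan_le (leq_maxl _ _) _ mf.
  exact: gspan_le (leq_maxr _ _) _ ng.
- by move=> f [m _ /gspan_adj[h mh fh]]; exists h => //; exists m.
- by move=> f [m _ mf]; exact: gspan_lin mf.
- by move=> f [m _ mf]; exact: gspan_bd mf.
Defined.

Lemma lim_core_mem m f : gspan m f -> op_mem lim_core f.
Proof. by move=> mf; apply: op_mem_core; exists m. Qed.

Lemma lim_AF : is_AF (opalg lim_core).
Proof.
pose S m := [set T : opalg lim_core | gspan m (opval T)].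
have Sfin m : S m = lspan (fun i : 'I_(size (gens m)) =>
    mkop (lim_core_mem (gspan_gen (mem_tnth i (in_tuple (gens m)))))).
  apply/seteqP; split=> T [c Tc]; exists c.
    apply: op_eq => x; rewrite Tc.
    apply: (big_ind2 (fun (f : E -> E) (F : opalg lim_core) => f x = opval F x)) => //.
    by move=> f F g D fF gD; rewrite opvalD -fF -gD.
  rewrite Tc; apply/funext => x.
  apply: (big_ind2 (fun (F : opalg lim_core) (f : E -> E) => opval F x = f x)) => //.
  by move=> f F g D fF gD; rewrite opvalD fF gD.
exists S; split.
- move=> m; split; last by rewrite Sfin; exists (size (gens m)); eexists.
  split.
  + by rewrite Sfin; split; [exact: lspan0|move=> k x y; exact: lspanZD].
  + by move=> x y; exact: gspan_comp.
  + move=> x /gspan_adj[h mh xh].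
    by rewrite [S m _]/(gspan m (opval (star x)))
      (@star_op_eq _ _ _ _ (mkop (lim_core_mem mh)) x xh).
  + by rewrite Sfin; exact: lspan_closed.
- by move=> m T; exact: gspanS.
- apply/seteqP; split=> // T _; apply/closure_nr => e e0.
  have [f [m _ mf] Tf] := op_valP T e0.
  exists (mkop (lim_core_mem mf)); first by exists m.
  by apply: nr_op_le => //; exact: ltW.
Qed.

End InductiveLimit.

(** * The AF algebra of a quotient of a sum of Cantor spaces *)

Definition inner_adj_form (R : realType) (H : hilbertType R) : adj_form H.
Proof.
refine (@AdjForm R H (Cplx R) (fun x y => inner x y : Cplx R)
  (fun t : Cplx R => (t : R[i])^*%C : Cplx R) _ _ _ _ _ _).
- by move=> x y; exact: innerC.
- by move=> x y z; exact: innerDl.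
- by move=> x y z; exact: innerDr.
- by move=> k x y; rewrite innerZl innerZr conjcK.
- move=> x; rewrite inner_xx; have := nr_real (nr x ^+ 2).
  by rewrite ger0_norm ?sqr_ge0.
- exact: inner_CS.
Defined.

Definition cylb (p : nat * seq bool) (x : cantor_sum) : bool :=
  (projT1 x == p.1) && (pref (size p.2) (projT2 x) == p.2).

Lemma cylbP p x : reflect (cyl p x) (cylb p x).
Proof. by apply: (iffP andP) => -[/eqP ? /eqP ?]. Qed.

Lemma cylb_rcons n s b x : cylb (n, rcons s b) x = cylb (n, s) x && (projT2 x (size s) == b).
Proof. by rewrite /cylb /= size_rcons /pref mkseqS eqseq_rcons andbA. Qed.

Lemma cylb_eq p q x : size p.2 = size q.2 -> cylb p x -> cylb q x -> p = q.
Proof.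
move: p q => [n s] [n' s'] /= ss' /andP[/= /eqP <- /eqP <-] /andP[/= /eqP <- /eqP <-].
by rewrite ss'.
Qed.

(** With the depth equal to [m], two cylinders are equal or disjoint and their projections are
    orthogonal; restricting to the first [m] summands keeps the list finite. *)
Definition cyls m : seq (nat * seq bool) :=
  [seq (n, tval s) | n <- iota 0 m, s <- enum {: m.-tuple bool}].

Lemma mem_cyls m p : (p \in cyls m) = (p.1 < m)%N && (size p.2 == m).
Proof.
apply/allpairsP/andP => [[[n s] /= [nm _ ->]]|[pm ps]].
  by rewrite mem_iota in nm; rewrite /= size_tuple.
exists (p.1, Tuple ps); rewrite mem_iota mem_enum; split=> //=; by case: (p).
Qed.

(* The triple ((k, n), b) is the n-th of the infinitely many basis vectors that lie
   over z_k if b is true and over w_k otherwise. *)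
Definition bidx : Type := (nat * nat * bool)%type.
HB.instance Definition _ := Choice.on bidx.
Definition blk (i : bidx) : nat := i.1.1.

Definition bidxs m : seq bidx :=
  [seq (kn, b) | kn <- [seq (k, n) | k <- iota 0 m, n <- iota 0 m], b <- [:: true; false]].

Lemma mem_bidxs m (i : bidx) : (i \in bidxs m) = (i.1.1 < m)%N && (i.1.2 < m)%N.
Proof.
move: i => [[k n] b] /=; apply/allpairsP/andP => [[[kn c] /= [h _ [e1 e2]]]|[km nm]].
  move/allpairsP: h => [[k' n'] /= []]; rewrite !mem_iota -e1 => ? ? [-> ->].
  by split.
exists ((k, n), b); split=> //=; last by case: b.
by apply/allpairsP; exists (k, n); rewrite !mem_iota.
Qed.

Section Algebra.
Context (R : realType) (z w : nat -> cantor_sum).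

Definition jidx : Type := (bidx + cantor_sum)%type.
HB.instance Definition _ := Choice.on jidx.

Definition point (j : jidx) : cantor_sum :=
  match j with inl i => if i.2 then z (blk i) else w (blk i) | inr x => x end.

Definition Hsp : hilbertType R := l2 R jidx.
Definition eb (j : jidx) : Hsp := ebase R j.

Definition Dop (p : nat * seq bool) : Hsp -> Hsp :=
  diagop (fun j : jidx => cylb p (point j)).
Definition Eop (i j : bidx) (h : Hsp) : Hsp := inner h (eb (inl j)) *: eb (inl i).

Lemma Dop_eb p j : Dop p (eb j) = (cylb p (point j))%:R *: eb j.
Proof. exact: diagop_ebase. Qed.

Lemma Dop_linear p k x y : Dop p (k *: x + y) = k *: Dop p x + Dop p y.
Proof. exact: diagop_linear. Qed.

Lemma DopZ p k x : Dop p (k *: x) = k *: Dop p x.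
Proof.
have D0 : Dop p 0 = 0.
  by have := Dop_linear p (-1) 0 0; rewrite scaler0 addr0 scaleN1r addNr.
by have := Dop_linear p k x 0; rewrite D0 !addr0.
Qed.

Lemma nr_Dop p x : nr (Dop p x) <= 1 * nr x.
Proof. exact: nr_diagop. Qed.

Lemma Dop_adj p x y : inner (Dop p x) y = inner x (Dop p y) :> R[i].
Proof. exact: diagop_adj. Qed.

Lemma inner_eb i j : inner (eb i) (eb j) = (i == j)%:R :> R[i].
Proof. exact: ebase_orth. Qed.

Lemma nr_eb j : nr (eb j) = 1.
Proof. exact: nr_ebase. Qed.

Lemma Eop_eb i j l : Eop i j (eb l) = (l == inl j)%:R *: eb (inl i).
Proof. by rewrite /Eop inner_eb. Qed.

Lemma Eop_linear i j k x y : Eop i j (k *: x + y) = k *: Eop i j x + Eop i j y.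
Proof. by rewrite /Eop inner_linearl scalerDl scalerA. Qed.

Lemma nr_Eop i j x : nr (Eop i j x) <= 1 * nr x.
Proof.
rewrite /Eop nrZ nr_eb mulr1 mul1r (le_trans (inner_CS _ _))//.
by rewrite nr_eb mulr1.
Qed.

Lemma Eop_adj i j x y : inner (Eop i j x) y = inner x (Eop j i y) :> R[i].
Proof. by rewrite /Eop innerZl innerZr -innerC mulrC. Qed.

Lemma Hop_eq (T T' : Hsp -> Hsp) (C C' : R) :
  (forall k x y, T (k *: x + y) = k *: T x + T y) -> (forall x, nr (T x) <= C * nr x) ->
  (forall k x y, T' (k *: x + y) = k *: T' x + T' y) -> (forall x, nr (T' x) <= C' * nr x) ->
  (forall j, T (eb j) = T' (eb j)) -> T = T'.
Proof. by move=> h1 h2 h3 h4 h5; apply/funext; exact: l2_op_eq h1 h2 h3 h4 h5. Qed.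

Definition gen : Type := ((nat * seq bool) + (bidx * bidx))%type.
HB.instance Definition _ := Choice.on gen.

Definition gen_op (g : gen) : Hsp -> Hsp :=
  match g with inl p => Dop p | inr ij => Eop ij.1 ij.2 end.

(** Matrix units are confined to one block but run freely between the vectors over [z k] and those
    over [w k]; this is what ties the two points together. *)
Definition gens m : seq gen :=
  map inl (cyls m) ++
  map inr [seq ij <- [seq (i, j) | i <- bidxs m, j <- bidxs m] | blk ij.1 == blk ij.2].

Lemma mem_gens m (g : gen) : (g \in gens m) = match g with
  | inl p => (p.1 < m)%N && (size p.2 == m)
  | inr ij => [&& blk ij.1 == blk ij.2, ij.1 \in bidxs m & ij.2 \in bidxs m] end.
Proof.
rewrite mem_cat; case: g => [p|[i j]].
  rewrite mem_map; last by move=> ? ? [].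
  rewrite mem_cyls [X in _ || X](_ : _ = false) ?orbF//.
  by apply/negbTE/negP => /mapP[].
rewrite mem_map; last by move=> ? ? [].
rewrite [X in X || _](_ : _ = false) /=; last by apply/negbTE/negP => /mapP[].
rewrite mem_filter /=; congr (_ && _); apply/allpairsP/andP.
  by move=> [[i' j'] /= [? ? [-> ->]]].
by move=> [? ?]; exists (i, j).
Qed.

Notation spn := (gspan gen_op gens).

Lemma spn_gen m g k : g \in gens m -> spn m (k *: gen_op g).
Proof.
by move=> gm; have := lspanZD k (gspan_gen gen_op gm) (lspan0 _); rewrite addr0; exact.
Qed.

Lemma gen_op_linear g k x y : gen_op g (k *: x + y) = k *: gen_op g x + gen_op g y.
Proof. by case: g => [p|ij]; [exact: Dop_linear|exact: Eop_linear]. Qed.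

Lemma nr_gen_op g x : nr (gen_op g x) <= 1 * nr x.
Proof. by case: g => [p|ij]; [exact: nr_Dop|exact: nr_Eop]. Qed.

Lemma gen_op_bd g : exists2 C, 0 <= C & op_bounded (gen_op g) C.
Proof. by exists 1 => //; exact: nr_gen_op. Qed.

Lemma gen_op_eq (T : Hsp -> Hsp) g k : (forall k x y, T (k *: x + y) = k *: T x + T y) ->
  (exists C, forall x, nr (T x) <= C * nr x) ->
  (forall j, T (eb j) = k *: gen_op g (eb j)) -> T = k *: gen_op g.
Proof.
move=> Tl [C TC] Te; apply: (Hop_eq (C := C) (C' := nr k)) => //.
  by move=> c x y; rewrite !fctE gen_op_linear scalerDr !scalerA mulrC.
move=> x; rewrite fctE nrZ ler_wpM2l ?nr_ge0// (le_trans (nr_gen_op _ _))//.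
by rewrite mul1r.
Qed.

Lemma DopS n s : Dop (n, s) = Dop (n, rcons s true) + Dop (n, rcons s false).
Proof.
apply: (Hop_eq (C := 1) (C' := 2)) => [k x y|x|k x y|x|j].
- exact: Dop_linear.
- exact: nr_Dop.
- by rewrite !fctE !Dop_linear scalerDr addrACA.
- rewrite fctE (le_trans (nrD _ _))// (le_trans (lerD (nr_Dop _ _) (nr_Dop _ _)))//.
  by rewrite -mulrDl.
- rewrite fctE !Dop_eb -scalerDl !cylb_rcons; congr (_ *: _).
  case: (cylb _ _); rewrite ?addr0//=.
  by case: (projT2 (point j) (size s)); rewrite ?addr0 ?add0r.
Qed.

Lemma gens_refine m g : g \in gens m -> spn m.+1 (gen_op g).
Proof.
rewrite mem_gens; case: g => [[n s] /andP[/= nm /eqP sm]|[i j] /= /and3P[ij im jm]].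
  rewrite /= DopS; have h b : inl (n, rcons s b) \in gens m.+1.
    by rewrite mem_gens /= size_rcons sm eqxx andbT ltnW.
  have := lspanZD 1 (gspan_gen gen_op (h true)) (gspan_gen gen_op (h false)).
  by rewrite scale1r.
apply: (gspan_gen gen_op (g := inr (i, j))); rewrite mem_gens /= ij /=.
move: im jm; rewrite !mem_bidxs => /andP[h1 h2] /andP[h3 h4].
by rewrite (leqW h1) (leqW h2) (leqW h3) (leqW h4).
Qed.

(** The product of two generators of a stage is always a scalar multiple of a generator: cylinders
    of equal depth are equal or disjoint, and a basis vector is an eigenvector of each cylinder
    projection. *)
Lemma gens_comp m g h : g \in gens m -> h \in gens m -> spn m (gen_op g \o gen_op h).
Proof.
move=> gm hm; have gm' := gm; have hm' := hm.
have lin k x y : (gen_op g \o gen_op h) (k *: x + y) =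
    k *: (gen_op g \o gen_op h) x + (gen_op g \o gen_op h) y.
  by rewrite /= !gen_op_linear.
have bd : exists C, forall x, nr ((gen_op g \o gen_op h) x) <= C * nr x.
  exists 1 => x; rewrite (le_trans (nr_gen_op _ _))// (le_trans _ (nr_gen_op h x))//.
  by rewrite mul1r.
rewrite !mem_gens in gm' hm'; case: g h gm hm gm' hm' lin bd => [p|[i j]] [q|[i' j']].
- move=> pm qm /andP[_ /eqP ps] /andP[_ /eqP qs] lin bd.
  rewrite (gen_op_eq (k := (p == q)%:R) (g := inl q) lin bd); first exact: spn_gen.
  move=> l; rewrite /= Dop_eb DopZ Dop_eb !scalerA; congr (_ *: _).
  have [<-|pq] := eqVneq p q; first by case: (cylb p _); rewrite ?mulr1 ?mulr0 ?mul1r.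
  have [cq|] := boolP (cylb q _); last by rewrite !(mul0r, mulr0).
  rewrite mul0r mul1r; case: (boolP (cylb p _)) => // cp.
  by rewrite (cylb_eq _ cp cq) ?eqxx// ?ps ?qs in pq.
- move=> pm qm _ _ lin bd.
  rewrite (gen_op_eq (k := (cylb p (point (inl i')))%:R) (g := inr (i', j')) lin bd).
    exact: spn_gen.
  by move=> l; rewrite /= Eop_eb DopZ Dop_eb !scalerA mulrC.
- move=> pm qm _ _ lin bd.
  rewrite (gen_op_eq (k := (cylb q (point (inl j)))%:R) (g := inr (i, j)) lin bd).
    exact: spn_gen.
  move=> l; rewrite /= Dop_eb Eop_eb /Eop innerZl inner_eb.
  have [->|_] := eqVneq l (inl j); last by rewrite mulr0 !(scale0r, scaler0).
  by case: (cylb _ _); rewrite ?mul1r ?mul0r ?scale1r ?scale0r.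
- move=> pm qm /and3P[bij im jm] /and3P[bij' im' jm'] lin bd.
  rewrite /= in bij im jm bij' im' jm'.
  have [e|ne] := eqVneq i' j.
    rewrite (gen_op_eq (k := 1) (g := inr (i, j')) lin bd).
      apply: spn_gen; rewrite mem_gens /= im jm' (eqP bij) -e bij'//.
    move=> l; rewrite /= Eop_eb Eop_eb /Eop innerZl inner_eb e eqxx mulr1 scale1r.
    by [].
  rewrite (gen_op_eq (k := 0) (g := inr (i, j)) lin bd); first exact: spn_gen.
  move=> l; rewrite /= Eop_eb /Eop innerZl !inner_eb scale0r.
  by rewrite (_ : (inl i' == inl j :> jidx) = false) ?mulr0 ?scale0r//; apply/eqP => -[] /eqP; exact/negP.
Qed.

Lemma gens_adj m g : g \in gens m -> exists2 T, spn m T & adjoint (inner_adj_form Hsp) (gen_op g) T.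
Proof.
case: g => [p|[i j]] gm; first by exists (Dop p); [exact: (gspan_gen gen_op gm)|exact: Dop_adj].
exists (Eop j i); last exact: Eop_adj.
apply: (gspan_gen gen_op (g := inr (j, i))); move: gm; rewrite !mem_gens /= => /and3P[/eqP -> -> ->].
by rewrite eqxx.
Qed.

Definition Kcore : opcore (inner_adj_form Hsp) :=
  lim_core gens_refine gens_comp gens_adj gen_op_linear gen_op_bd.
Definition Alg : cstarAlgType R := opalg Kcore.

Lemma Alg_AF : is_AF Alg.
Proof. exact: lim_AF. Qed.

End Algebra.

(** * Its primitive ideals *)

Section PrimClosed.
Context (R : realType) (A : cstarAlgType R) (I : set A) (hI : primitive_ideal I).

Lemma primitive_ideal0 : I 0.
Proof. by case: hI => H [pi [pir _ ->]] x; exact: rep0 pir _. Qed.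

Lemma primitive_idealZD k a b : I a -> I b -> I (k *: a + b).
Proof.
case: hI => H [pi [pir _ ->]] Ia Ib x.
by rewrite (rep_linear pir) Ia Ib scaler0 addr0.
Qed.

Lemma primitive_ideal_closed a :
  (forall e : R, 0 < e -> exists2 b, I b & nr (a - b) <= e) -> I a.
Proof.
case: hI => H [pi [pir _ ->]] Ia x; apply: nr_le0; apply/ler_addgt0Pl => e e0; rewrite addr0.
have c0 : 0 < nr x + 1 by rewrite ltr_wpDl ?nr_ge0.
have [b Ib ab] := Ia _ (divr_gt0 e0 c0).
rewrite -[pi a x]subr0 -(Ib x) -(repB pir) (le_trans (rep_contractive pir _ _))//.
rewrite (le_trans (ler_wpM2r (nr_ge0 _) ab))// mulrAC ler_pdivrMr// ler_wpM2l ?lerDl//.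
exact: ltW.
Qed.

End PrimClosed.

Section Structure.
Context (R : realType) (z w : nat -> cantor_sum).
Local Notation H := (Hsp R).
Local Notation A := (Alg R z w).
Local Notation pt := (point z w).
Local Notation eb := (eb R).
Local Notation spn := (gspan (@gen_op R z w) gens).

Definition pi (a : A) (h : H) : H := opval a h.

Lemma pi_rep : star_representation pi.
Proof.
split.
- by move=> a k x y; exact: oplin.
- move=> a; apply: (@continuous_nr _ _ _ _ (nr a)) => x y.
  by rewrite -opB; exact: nr_op.
- by [].
- by [].
- by move=> a x y; exact: (opval_star a x y).
Qed.

Lemma pi_cmul (a b : A) h : pi (cmul a b) h = pi a (pi b h).
Proof. by []. Qed.
Lemma pi_scale k (a : A) h : pi (k *: a) h = k *: pi a h.
Proof. by []. Qed.
Lemma pi_add (a b : A) h : pi (a + b) h = pi a h + pi b h.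
Proof. by []. Qed.
Lemma pi_sub (a b : A) h : pi (a - b) h = pi a h - pi b h.
Proof. by []. Qed.
Lemma piZ (a : A) k h : pi a (k *: h) = k *: pi a h.
Proof. exact: opZ. Qed.

Lemma nr_pi (a : A) h : nr (pi a h) <= nr a * nr h.
Proof. exact: nr_op. Qed.

Lemma core_mem m f : spn m f -> op_mem (Kcore R z w) f.
Proof. by move=> mf; apply: op_mem_core; exists m. Qed.

Lemma core_approx (a : A) (e : R) : 0 < e -> exists m (f : A), spn m (pi f) /\ nr (a - f) <= e.
Proof.
move=> e0; have [f [m _ mf] af] := op_valP a e0.
exists m, (mkop (core_mem mf)); split=> //.
by apply: nr_op_le => //; exact: ltW.
Qed.

Definition gen_elt m g (gm : g \in gens m) : A := mkop (core_mem (gspan_gen (@gen_op R z w) gm)).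

Lemma alg_core_ind m (Q : A -> Prop) : Q 0 ->
  (forall k a b, Q a -> Q b -> Q (k *: a + b)) ->
  (forall g, g \in gens m -> forall a, pi a = gen_op (R := R) z w g -> Q a) ->
  forall a, spn m (pi a) -> Q a.
Proof.
move=> Q0 QZD Qg a am.
suff : forall f, spn m f -> exists2 b : A, pi b = f & Q b.
  by move=> /(_ _ am)[b ba]; rewrite (op_eq (S := b) (T := a))// => x;
  exact: (congr1 (@^~ x) ba).
apply: gspan_ind => [|k f g [b <- Qb] [c <- Qc]|g gm].
- by exists 0.
- by exists (k *: b + c) => //; exact: QZD.
- by exists (gen_elt gm) => //; exact: (Qg g).
Qed.

Lemma alg_ind (Q : A -> Prop) : Q 0 ->
  (forall k a b, Q a -> Q b -> Q (k *: a + b)) ->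
  (forall a, (forall e : R, 0 < e -> exists2 b, Q b & nr (a - b) <= e) -> Q a) ->
  (forall m g, g \in gens m -> forall a, pi a = gen_op (R := R) z w g -> Q a) ->
  forall a, Q a.
Proof.
move=> Q0 QZD Qcl Qg a; apply: Qcl => e e0.
have [m [f [mf af]]] := core_approx a e0.
by exists f => //; apply: (alg_core_ind Q0 QZD (Qg m)).
Qed.

Lemma pi_closed (a : A) (N : set H) h : closed N ->
  (forall e : R, 0 < e -> exists2 b : A, N (pi b h) & nr (a - b) <= e) -> N (pi a h).
Proof.
move=> /closed_nr cN hN; apply: cN => e e0.
have c0 : 0 < nr h + 1 by rewrite ltr_wpDl ?nr_ge0.
have [b Nb ab] := hN _ (divr_gt0 e0 c0); exists (pi b h) => //.
rewrite -pi_sub.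
rewrite (le_trans (nr_pi _ _))// (le_trans (ler_wpM2r (nr_ge0 _) ab))//.
by rewrite mulrAC ler_pdivrMr// ler_wpM2l ?lerDl// ltW.
Qed.

Section Invariant.
Variable S : pred jidx.

Definition supported : set H := [set h | forall j, ~~ S j -> inner h (eb j) = 0 :> R[i]].

Lemma supported_subspace : is_subspace supported.
Proof.
split=> [j _|k x y Nx Ny j jS]; first exact: inner0l.
by rewrite inner_linearl Nx// Ny// mulr0 addr0.
Qed.

Lemma supported_closed : closed supported.
Proof.
apply/closed_nr => x hx j jS; apply/(@nr_le0 R (R[i]^o)).
apply/ler_addgt0Pl => e e0; rewrite addr0; have [y Ny xy] := hx _ e0.
rewrite -[inner x _](subr0 _) -(Ny j jS) -innerBl (le_trans (inner_CS _ _))//.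
by rewrite nr_eb mulr1.
Qed.

Lemma supported_eb j : S j -> supported (eb j).
Proof.
move=> Sj i; rewrite inner_eb; case: eqVneq => // <-; by rewrite Sj.
Qed.

Lemma eb_inj (h h' : H) : (forall j, inner h (eb j) = inner h' (eb j) :> R[i]) -> h = h'.
Proof.
move=> hh'; apply/eqP; rewrite -subr_eq0; apply/eqP.
apply: (dense_orth (@l2_dense R jidx)) => _ [f _ <-].
have -> : inner (hemb (l2form R jidx) f) (h - h') = 0 :> R[i].
  rewrite innerC hemb_sum; suff -> : inner (h - h') (\sum_(j <- cover f) fsv f j *: eb j) = 0 :> R[i].
    exact: conjc0.
  elim: (cover f) => [|j s ih]; first by rewrite big_nil inner0r.
  by rewrite big_cons innerDr innerZr innerBl hh' subrr mulr0 add0r.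
by [].
Qed.

Lemma supported_sub (M : set H) : is_subspace M -> closed M -> (forall j, S j -> M (eb j)) ->
  supported `<=` M.
Proof.
move=> [M0 MZD] cM Me h Nh; move/closed_nr : (cM); apply => e e0.
have [_ [f _ <-] hf] := l2_dense h e0.
(* The diagonal projection fixes [h] and sends a finitely supported approximant to one supported in
   [S], without increasing the error. *)
have Dh : diagop S h = h.
  apply: eb_inj => j; rewrite diagop_adj diagop_ebase innerZr.
  have [Sj|Sj] := boolP (S j); first by rewrite conjc1 mul1r.
  by rewrite conjc0 mul0r Nh.
have DB x y : diagop (R := R) S (x - y) = diagop S x - diagop S y.
  have := diagop_linear (R := R) S (-1) y x.
  by rewrite !scaleN1r addrC [X in _ = X]addrC.
exists (diagop S (hemb (l2form R jidx) f)); last first.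
  by rewrite -[X in X - _]Dh -DB (le_trans (nr_diagop _ _))// mul1r.
rewrite hemb_sum; elim: (cover f) => [|j s ih].
  by rewrite big_nil -(subrr 0) DB subrr.
rewrite big_cons diagop_linear diagop_ebase; apply: MZD => //.
by have [Sj|Sj] := boolP (S j); rewrite ?scale1r ?scale0r//; exact: Me.
Qed.

Definition annihilator : set A := [set a | forall j, S j -> pi a (eb j) = 0].

Hypothesis Sblk : forall i j, blk i = blk j -> S (inl i) = S (inl j).

Lemma supported_inv a h : supported h -> supported (pi a h).
Proof.
move: a h; apply: alg_ind => [h _|k a b Qa Qb h Nh|a Qa h Nh|m g gm a ag h Nh].
- by case: supported_subspace.
- by rewrite pi_add pi_scale; apply: supported_subspace.2; [exact: Qa|exact: Qb].
- apply: pi_closed => [|e e0]; first exact: supported_closed.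
  have [b Qb ab] := Qa _ e0; exists b; [exact: Qb|exact: ab].
- rewrite ag => l lS; move: gm; rewrite mem_gens; case: g ag => [p|[i j]] ag /=.
    by rewrite Dop_adj Dop_eb innerZr Nh// mulr0.
  move=> /and3P[/eqP/Sblk Sij _ _]; rewrite /Eop innerZl inner_eb.
  have [il|_] := eqVneq (inl i : jidx) l; last by rewrite mulr0.
  by rewrite Nh ?mul0r// -Sij il.
Qed.

Lemma annihilatorE : annihilator = [set a | forall h, supported h -> pi a h = 0].
Proof.
apply/seteqP; split=> a ha; last by move=> j Sj; apply: ha; exact: supported_eb.
apply: supported_sub => //.
- split=> [|k x y xa ya]; first exact: op0.
  by rewrite /= [LHS]oplin -![opval a _]/(pi a _) xa ya scaler0 addr0.
- apply/closed_nr => x hx; apply: nr_le0; apply/ler_addgt0Pl => e e0; rewrite addr0.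
  have c0 : 0 < nr a + 1 by rewrite ltr_wpDl ?nr_ge0.
  have [y ya xy] := hx _ (divr_gt0 e0 c0).
  rewrite -[pi a x]subr0 -ya -[_ - _](opB a x y) (le_trans (nr_pi _ _))//.
  rewrite (le_trans (ler_wpM2l (nr_ge0 _) xy))// mulrA ler_pdivrMr// mulrC.
  by rewrite ler_wpM2l ?lerDl// ltW.
Qed.

(** Irreducibility reduces to transitivity on basis vectors: a nonzero invariant closed subspace
    contains a vector with a nonzero coordinate, from which the hypothesis reaches every basis
    vector of [S]. *)
Lemma annihilator_primitive :
  (forall M : set H, is_subspace M -> closed M -> (forall a h, M h -> M (pi a h)) ->
    forall h j, supported h -> M h -> S j -> inner h (eb j) != 0 :> R[i] ->
    forall j', S j' -> M (eb j')) ->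
  (exists a j, S j /\ pi a (eb j) != 0) -> primitive_ideal annihilator.
Proof.
move=> tr [a [j [Sj aj]]]; rewrite annihilatorE.
apply: (primitive_sub supported_subspace supported_closed pi_rep supported_inv).
  by exists a, (eb j); split=> //; exact: supported_eb.
move=> M sM cM MN Minv; have [M0|] := pselect (M `<=` [set 0]).
  by left; apply/seteqP; split=> // _ ->; case: sM.
move=> /existsNP[h /not_implyP[Mh h0]]; right; apply: supported_sub => // j' Sj'.
have [jh|] := pselect (exists j, inner h (eb j) != 0 :> R[i]); last first.
  move=> /forallNP hj; case: h0; apply: eb_inj => i; rewrite inner0l.
  by apply/eqP; apply/negP/negP; have /negP := hj i; rewrite negbK.
have [l lh] := jh; apply: (tr M sM cM Minv h l) => //; first exact: MN.
by apply: contraT => lS; have := MN _ Mh l lS => e; rewrite e eqxx in lh.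
Qed.

End Invariant.

(** The bound on [p] says that the cylinder occurs among the generators of stage [size p.2];
    [deep_cyl] supplies such cylinders around any point. *)
Lemma ex_Dop p : (p.1 < size p.2)%N -> exists d : A, pi d = Dop (R := R) z w p.
Proof.
move=> hp; have gm : inl p \in gens (size p.2) by rewrite mem_gens hp eqxx.
by exists (gen_elt gm).
Qed.

Lemma ex_Eop i j : blk i = blk j -> exists d : A, pi d = Eop (R := R) i j.
Proof.
move=> ij; pose m := (maxn (maxn i.1.1 i.1.2) (maxn j.1.1 j.1.2)).+1.
have gm : inr (i, j) \in gens m.
  rewrite mem_gens /= ij eqxx !mem_bidxs /m !ltnS !leq_max !leqnn ?orbT.
  by rewrite !orTb.
by exists (gen_elt gm).
Qed.

Definition atx (x : cantor_sum) : pred jidx := pred1 (inr x).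
Definition block (k : nat) : pred jidx := fun j => if j is inl i then blk i == k else false.

Lemma atx_blk x i j : blk i = blk j -> atx x (inl i) = atx x (inl j).
Proof. by []. Qed.
Lemma block_blk k i j : blk i = blk j -> block k (inl i) = block k (inl j).
Proof. by move=> /= ->. Qed.

Lemma deep_cyl (x : cantor_sum) m : (projT1 x < m)%N ->
  let p := (projT1 x, pref m (projT2 x)) in (p.1 < size p.2)%N /\ cylb p x.
Proof. by move=> xm; rewrite /= size_pref; split=> //; apply/cylbP; exact: mem_cyl. Qed.

Lemma atx_primitive x : primitive_ideal (annihilator (atx x)).
Proof.
apply: annihilator_primitive; first exact: atx_blk.
  move=> M [M0 MZD] cM Minv h j Nh Mh /eqP -> hx j' /eqP ->.
  have hE : h = inner h (eb (inr x)) *: eb (inr x).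
    apply: eb_inj => l; rewrite innerZl inner_eb.
    have [<-|xl] := eqVneq; first by rewrite mulr1.
    by rewrite mulr0 Nh// /atx /= eq_sym.
  have := MZD (inner h (eb (inr x)))^-1 h 0 Mh M0.
  by rewrite addr0 {2}hE scalerA mulVf// scale1r.
have [p1 p2] := deep_cyl (ltnSn (projT1 x)); have [d dp] := ex_Dop p1.
exists d, (inr x); split; first exact: eqxx.
rewrite dp Dop_eb; have -> : cylb _ (pt (inr x)) = true := p2.
rewrite scale1r.
by apply/eqP => /(congr1 (@nr _ _))/eqP; rewrite nr_eb nr0 oner_eq0.
Qed.

Lemma block_primitive k : primitive_ideal (annihilator (block k)).
Proof.
apply: annihilator_primitive; first exact: block_blk.
  move=> M [M0 MZD] cM Minv h [i|//] Nh Mh /eqP ik hi [j|//] /eqP jk.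
  have [d dE] := @ex_Eop j i (etrans jk (esym ik)).
  have := Minv d h Mh; rewrite dE /Eop => hd.
  have := MZD (inner h (eb (inl i)))^-1 _ 0 hd M0.
  by rewrite addr0 scalerA mulVf// scale1r.
pose i : bidx := ((k, 0%N), true).
have [d dE] := @ex_Eop i i erefl.
exists d, (inl i); split; first exact: eqxx.
rewrite dE Eop_eb eqxx scale1r.
by apply/eqP => /(congr1 (@nr _ _))/eqP; rewrite nr_eb nr0 oner_eq0.
Qed.

End Structure.

(** * Classification of the primitive ideals *)

Section Classification.
Context (R : realType) (z w : nat -> cantor_sum).
Local Notation H := (Hsp R).
Local Notation A := (Alg R z w).
Local Notation pt := (point z w).
Local Notation eb := (eb R).
Local Notation pi := (@pi R z w).
Local Notation Dop := (@Dop R z w).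
Local Notation Eop := (@Eop R).
Local Notation annihilator := (@annihilator R z w).
Local Notation spn := (gspan (@gen_op R z w) gens).

Lemma pi_inj (a b : A) : pi a =1 pi b -> a = b.
Proof. exact: op_eq. Qed.

Lemma Dop_coord p h l :
  inner (Dop p h) (eb l) = (cylb p (pt l))%:R * inner h (eb l) :> R[i].
Proof.
rewrite Dop_adj Dop_eb innerZr; congr (_ * _).
by case: (cylb _ _); rewrite ?conjc1 ?conjc0.
Qed.

Lemma Dop_comm p q h : Dop p (Dop q h) = Dop q (Dop p h).
Proof. by apply: eb_inj => l; rewrite !Dop_coord mulrCA. Qed.

Lemma Dop_absorb p r h : (forall x, cylb r x -> cylb p x) -> Dop p (Dop r h) = Dop r h.
Proof.
move=> rp; apply: eb_inj => l; rewrite !Dop_coord.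
by have [/rp ->|] := boolP (cylb r _); rewrite !(mul1r, mul0r, mulr0).
Qed.

Lemma Dop_disj p r h : (forall x, cylb r x -> ~~ cylb p x) -> Dop p (Dop r h) = 0.
Proof.
move=> rp; apply: eb_inj => l; rewrite !Dop_coord inner0l.
by have [/rp /negbTE ->|] := boolP (cylb r _); rewrite !(mul1r, mul0r, mulr0).
Qed.

Lemma cylb_deep (x : cantor_sum) M p y : (size p.2 <= M)%N ->
  cylb (projT1 x, pref M (projT2 x)) y -> cylb p y = cylb p x.
Proof.
move=> pM /andP[/= /eqP e1 /eqP]; rewrite size_pref => e2.
by rewrite /cylb e1 (pref_le pM e2).
Qed.

(** The character of evaluation at [x]: the vector over [x] outside the blocks is an eigenvector of
    all of [A], and matrix units send it to 0. *)
Definition chi (x : cantor_sum) (a : A) : R[i] :=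
  inner (pi a (eb (inr x))) (eb (inr x)).

Lemma chiE x a : pi a (eb (inr x)) = chi x a *: eb (inr x).
Proof.
apply: eb_inj => l; rewrite innerZl inner_eb.
have [<-|xl] := eqVneq; first by rewrite mulr1.
have h := @supported_inv R z w _ (@atx_blk x) a _ (@supported_eb R (atx x) _ (eqxx _)).
by rewrite mulr0 h// /atx /= eq_sym.
Qed.

Lemma chiZD x k a b : chi x (k *: a + b) = k * chi x a + chi x b.
Proof. by rewrite /chi pi_add pi_scale inner_linearl. Qed.

Lemma chi0 x : chi x 0 = 0.
Proof. exact: inner0l. Qed.

Lemma chiB x a b : chi x (a - b) = chi x a - chi x b.
Proof. by have := chiZD x (-1) b a; rewrite scaleN1r mulN1r addrC [RHS]addrC. Qed.

Lemma nr_chi x a : nr (chi x a) <= nr a.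
Proof.
rewrite (le_trans (inner_CS _ _))// nr_eb mulr1 (le_trans (nr_pi _ _))//.
by rewrite nr_eb mulr1.
Qed.

Lemma annihilator_atx x a : annihilator (atx x) a <-> chi x a = 0.
Proof.
split=> [h|h j /eqP ->]; first by rewrite /chi h ?inner0l//; exact: eqxx.
by rewrite chiE h scale0r.
Qed.

Lemma chi_Dop x p d : pi d = Dop p -> chi x d = (cylb p x)%:R.
Proof. by rewrite /chi => ->; rewrite Dop_eb innerZl inner_eb eqxx mulr1. Qed.

Variable (I : set A).
Hypothesis hI : primitive_ideal I.

Let IM a b : I a -> I (cmul a b).
Proof. by move=> Ia; have [] := primitive_idealM hI b Ia. Qed.
Let MI a b : I a -> I (cmul b a).
Proof. by move=> Ia; have [] := primitive_idealM hI b Ia. Qed.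
Let I0 : I 0 := primitive_ideal0 hI.
Let IZD := primitive_idealZD hI.
Let IZ k a : I a -> I (k *: a).
Proof. by move=> Ia; have := IZD k Ia I0; rewrite addr0. Qed.

(** If [a] in [I] had a nonzero matrix entry in the block, multiplying by matrix units on both sides
    would give a multiple of [d]. Conversely the annihilator times [d] is 0, and primeness applies
    since [d] is not in [I]. *)
Lemma primitive_block i j d : blk i = blk j -> pi d = Eop i j -> ~ I d ->
  I = annihilator (block (blk i)).
Proof.
move=> ij dE Id; apply/seteqP; split.
  move=> a Ia [l|//] /eqP li; apply: eb_inj => -[l'|x]; rewrite inner0l; last first.
    by rewrite (@supported_inv R z w (block (blk i)) (@block_blk _))//; apply: supported_eb; exact/eqP.
  have [/eqP l'i|l'i] := boolP (block (blk i) (inl l')); last first.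
    by rewrite (@supported_inv R z w (block (blk i)) (@block_blk _))//; apply: supported_eb; exact/eqP.
  have [d1 E1] := @ex_Eop R z w i l' (esym l'i).
  have [d2 E2] := @ex_Eop R z w l j (etrans li ij).
  set c := inner _ _; apply/eqP; apply: contraT => c0; case: Id.
  have <- : c^-1 *: cmul d1 (cmul a d2) = d.
    apply: pi_inj => h; rewrite pi_scale !pi_cmul E1 E2 dE /Eop.
    by rewrite piZ innerZl -/c scalerA mulrCA mulVf// mulr1.
  by apply: IZ; apply: MI; exact: IM.
have [||//|h] := @primitive_ideal_prime R A I (annihilator (block (blk i))) [set d] hI.
- move=> a b; rewrite annihilatorE => ha h Nh.
  exact: (ha _ (supported_inv (@block_blk (blk i)) b Nh)).
- move=> a _ ha ->; rewrite (_ : cmul a d = 0)//; apply: pi_inj => h.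
  rewrite pi_cmul dE /Eop piZ ha ?scaler0//.
  exact: eqxx.
- by case: Id; exact: h.
Qed.

Hypothesis IE : forall i j d, blk i = blk j -> pi d = Eop i j -> I d.

Definition live p := (p.1 < size p.2)%N /\ forall d, pi d = Dop p -> ~ I d.

Lemma ex_live : exists p, live p.
Proof.
apply: contrapT => /forallNP nl.
have /eqP := primitive_ideal_proper hI; apply; apply/seteqP; split=> // a _.
move: a; apply: alg_ind => //.
- by move=> a ha; exact: primitive_ideal_closed ha.
- move=> m [p|[i j]] gm a ag.
    apply: contrapT => Ia; apply: (nl p); split.
      by move: gm; rewrite mem_gens => /andP[pm /eqP ->].
    by move=> d dD; rewrite (_ : d = a)//; apply: pi_inj => h; rewrite dD ag.
  by move: gm; rewrite mem_gens => /and3P[/eqP ij _ _]; apply: (IE ij) ag.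
Qed.

Lemma live_split n s : live (n, s) -> exists b, live (n, rcons s b).
Proof.
move=> [/= ns hs]; apply: contrapT => /forallNP nb.
have [d dD] := @ex_Dop R z w (n, s) ns; apply: (hs d dD).
have h b : exists2 e, pi e = Dop (n, rcons s b) & I e.
  apply: contrapT => ne.
  have hn : (n < size (rcons s b))%N by rewrite size_rcons ltnW.
  by apply: (nb b); split=> // e eD Ie; apply: ne; exists e.
have [e1 e1D I1] := h true; have [e2 e2D I2] := h false.
rewrite (_ : d = 1 *: e1 + e2); first exact: IZD.
rewrite scale1r; apply: pi_inj => x.
by rewrite pi_add e1D e2D dD DopS.
Qed.

(** [live_split] prolongs a live word forever. Only lengths from that of the initial word on are
    obtained, hence [M] above [m] rather than [m] itself. *)
Lemma live_point : exists x : cantor_sum, forall m, exists2 M, (m <= M)%N &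
  live (projT1 x, pref M (projT2 x)).
Proof.
have [[n s0] l0] := ex_live.
have /choice[b hb] s : exists b, live (n, s) -> live (n, rcons s b).
  have [/live_split[b hb]|ns] := pselect (live (n, s)); first by exists b.
  by exists true.
pose t i := iter i (fun s => rcons s (b s)) s0.
have tl i : live (n, t i) by elim: i => //= i; exact: hb.
have ts i : size (t i) = (size s0 + i)%N.
  by elim: i => [|i ih]; rewrite ?addn0//= size_rcons ih addnS.
have tS i k l : (l < size (t i))%N -> nth true (t (i + k)%N) l = nth true (t i) l.
  move=> li; elim: k => [|k ih]; first by rewrite addn0.
  rewrite addnS /= nth_rcons [size _]ts (leq_trans li) ?ts ?leq_add2l ?leq_addr//.
pose x : cantor_space := fun l => nth true (t l.+1) l.
exists (existT _ n x) => m; exists (size (t m)); first by rewrite ts leq_addl.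
suff -> : (projT1 (existT (fun=> cantor_space) n x), pref (size (t m)) x) = (n, t m) by [].
congr pair; apply: (@eq_from_nth _ true); first by rewrite size_pref.
move=> l; rewrite size_pref => lm; rewrite nth_mkseq// /x.
have lS : (l < size (t l.+1))%N by rewrite ts leq_addl.
by rewrite -(tS l.+1 m l lS) -(tS m l.+1 l lm) addnC.
Qed.

(** For every [b] the product of [d], [b] and the projection of [r] lies in [I]: cylinder
    projections commute past [d], which the projection of [r] kills, and matrix units are in [I].
    Primeness then forces [d] into [I], since [r] is live. Without a unit, [d] has to be added to
    its right multiples to get a right-stable set containing it. *)
Lemma commuting_ideal d r : (forall p h, pi d (Dop p h) = Dop p (pi d h)) ->
  live r -> (forall h, pi d (Dop r h) = 0) -> I d.
Proof.
move=> dD [rr lr] dr0; have [dr drD] := @ex_Dop R z w r rr.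
have [||h|h] := @primitive_ideal_prime R A I
    [set a | a = d \/ exists b, a = cmul d b] [set dr] hI.
- by move=> _ b [->|[c ->]]; right; [exists b|exists (cmul c b); rewrite cmulA].
- have key b : I (cmul (cmul d b) dr).
    move: b; apply: alg_ind.
    + by rewrite cmulx0 cmul0x.
    + move=> k a b Ia Ib; rewrite cmulDr cmulZr cmulDl cmulZl; exact: IZD.
    + move=> a ha; apply: (primitive_ideal_closed hI) => e e0.
      have c0 : 0 < nr d * nr dr + 1 by rewrite ltr_wpDl ?mulr_ge0 ?nr_ge0.
      have [b Ib ab] := ha _ (divr_gt0 e0 c0); exists (cmul (cmul d b) dr) => //.
      rewrite -cmulBl -cmulBr (le_trans (nr_cmul _ _))//.
      rewrite (le_trans (ler_wpM2r (nr_ge0 _) (nr_cmul _ _)))// mulrAC.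
      rewrite (le_trans (ler_wpM2l _ ab)) ?mulr_ge0 ?nr_ge0//.
      by rewrite mulrA ler_pdivrMr// mulrC ler_wpM2l ?lerDl// ltW.
    + move=> m [p|[i j]] gm b bg.
        rewrite (_ : cmul _ _ = 0)//; apply: pi_inj => h.
        rewrite !pi_cmul bg drD /= dD dr0.
        by have := DopZ z w p 0 (0 : H); rewrite !scale0r.
      move: gm; rewrite mem_gens => /and3P[/eqP ij _ _].
      by apply: IM; apply: MI; exact: (IE ij bg).
  move=> _ _ [->|[b ->]] ->; last exact: key.
  rewrite (_ : cmul _ _ = 0)//; apply: pi_inj => h.
  by rewrite pi_cmul drD dr0.
- by apply: h; left.
- by case: (lr dr drD); exact: h.
Qed.

Lemma primitive_atx : exists x, I = annihilator (atx x).
Proof.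
have [x lx] := live_point; exists x.
have deep m M : (m <= M)%N -> forall p y, (size p.2 <= m)%N ->
    cylb (projT1 x, pref M (projT2 x)) y -> cylb p y = cylb p x.
  by move=> mM p y pm; apply: cylb_deep; exact: leq_trans mM.
(* [A] need not be unital; the projection [d0] of a live cylinder around [x] takes the place of the
   unit in [a - chi x a]. *)
have [M0 _ [g0 l0]] := lx 0%N; set r0 := (_, _) in g0 l0.
have [d0 d0D] := @ex_Dop R z w r0 g0.
have r0x : cylb r0 x by apply/cylbP; exact: mem_cyl.
have chi1 : chi x d0 = 1 by rewrite (chi_Dop x d0D) r0x.
have key m a : spn m (pi a) -> I (a - chi x a *: d0).
  move: a; apply: alg_core_ind.
  - by rewrite chi0 scale0r subr0.
  - move=> k a b Ia Ib; have := IZD k Ia Ib; rewrite chiZD.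
    rewrite scalerDl scalerBr scalerA opprD addrACA; exact.
  - move=> [p|[i j]] gm a ag; last first.
      move: gm; rewrite mem_gens => /and3P[/eqP ij _ _].
      rewrite (_ : chi x a = 0) ?scale0r ?subr0; first exact: (IE ij ag).
      by rewrite /chi ag /= Eop_eb /= scale0r inner0l.
    (* At this depth the cylinder around [x] is either inside or disjoint from the one of [p], and
       inside the one of [r0], so [a - chi x a *: d0] vanishes on it. *)
    have [M mM lM] := lx (maxn (size p.2) (size r0.2)).
    rewrite (chi_Dop x ag); have [px|px] := boolP (cylb p x).
      rewrite scale1r; apply: (commuting_ideal _ lM) => [q h|h].
        rewrite !pi_sub ag d0D /= !(Dop_comm _ q).
        have := Dop_linear (R := R) z w q (-1) (Dop r0 h) (Dop p h).
        by rewrite !scaleN1r addrC [in RHS]addrC => ->.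
      rewrite pi_sub ag d0D /= !Dop_absorb ?subrr// => y ry.
        by rewrite (deep _ _ mM)// leq_maxr.
      by rewrite (deep _ _ mM)// leq_maxl.
    rewrite scale0r subr0; apply: (commuting_ideal _ lM) => [q h|h].
      by rewrite ag /= Dop_comm.
    rewrite ag /= Dop_disj// => y ry; rewrite (deep _ _ mM)// leq_maxl//.
have sub a : chi x a = 0 -> I a.
  move=> xa; apply: (primitive_ideal_closed hI) => e e0.
  have e2 : 0 < e / 2 / (nr d0 + 1) by rewrite !divr_gt0// ltr_wpDl ?nr_ge0.
  have [m [f [mf af]]] := core_approx a e2.
  exists (f - chi x f *: d0); first exact: key mf.
  have le2 : e / 2 / (nr d0 + 1) <= e / 2.
    by rewrite ler_pdivrMr ?ltr_wpDl ?nr_ge0// ler_peMr ?lerDr ?nr_ge0// divr_ge0// ltW.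
  rewrite opprB addrCA addrC; apply: (le_trans (nrD _ _)).
  rewrite [e]splitr; apply: lerD; first exact: (le_trans af le2).
  have : nr (chi x f) <= e / 2 / (nr d0 + 1).
    apply: le_trans af; apply: le_trans (nr_chi x (a - f)); rewrite chiB xa sub0r.
    by rewrite (nrN (chi x f : R[i]^o)).
  move=> h; rewrite nrZ (le_trans (ler_wpM2r (nr_ge0 _) h))// mulrAC ler_pdivrMr ?ltr_wpDl ?nr_ge0//.
  by rewrite ler_wpM2l ?lerDl// divr_ge0// ltW.
apply/seteqP; split=> a.
  move=> Ia; apply/annihilator_atx/eqP; apply: contraT => c0.
  (* [chi x] vanishes at [d0 - (chi x a)^-1 *: a], which is therefore in [I]; if [a] were in [I] as
     well, so would be [d0]. *)
  case: (l0 d0 d0D); rewrite -[d0](subrK ((chi x a)^-1 *: a)) addrC.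
  apply: (IZD _ Ia); apply: sub.
  rewrite chiB chi1; have := chiZD x (chi x a)^-1 a 0.
  by rewrite addr0 chi0 addr0 => ->; rewrite mulVf// subrr.
by move=> /annihilator_atx; exact: sub.
Qed.

End Classification.

(** * Its Glimm space *)

(** In the hull-kernel topology [Q] lies in the closure of [P], and a Hausdorff space has no such
    distinct pairs of values. *)
Lemma prim_sub_eq (R : realType) (A : cstarAlgType R) (T : topologicalType)
    (f : Prim A -> T) (P Q : Prim A) : hausdorff_space T -> continuous f ->
  ideal_of P `<=` ideal_of Q -> f P = f Q.
Proof.
move=> hT cf PQ; apply: hT => U V.
rewrite !nbhsE => -[U' [oU' U'P] U'U] [V' [oV' V'Q] V'V].
exists (f P); split; first exact: U'U.
apply: V'V; apply: contrapT => V'P.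
have oW : open (f @^-1` V') by apply: open_comp => // x _; exact: cf.
move: oW; rewrite prim_openE => /(_ Q) hQ.
have : (~` (f @^-1` V')) Q; last by apply.
by apply: hQ => a ha; apply: PQ; exact: ha.
Qed.

Section GlimmSpace.
Context (R : realType) (X : topologicalType) (q : cantor_sum -> X).
Hypotheses (hX : hausdorff_space X) (tX : tychonoff_separated R X) (hq : quotient_map q).
Context (z w : nat -> cantor_sum).
Hypothesis qzw : forall k, q (z k) = q (w k).
Hypothesis zw_dense : forall x y p r, q x = q y -> cyl p x -> cyl r y ->
  exists k, cyl p (z k) /\ cyl r (w k).
Local Notation H := (Hsp R).
Local Notation A := (Alg R z w).
Local Notation pt := (point z w).
Local Notation eb := (eb R).
Local Notation pi := (@pi R z w).
Local Notation chi := (@chi R z w).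
Local Notation annihilator := (@annihilator R z w).
Local Notation spn := (gspan (@gen_op R z w) gens).

Let cq : continuous q.
Proof. by apply/continuousP => U /hq.2. Qed.

(* The matrix units of the m-th subalgebra vanish beyond the m-th vector of each block. *)
Lemma core_tail m (f : A) i : spn m (pi f) -> (m <= i.1.2)%N ->
  pi f (eb (inl i)) = chi (pt (inl i)) f *: eb (inl i).
Proof.
move=> mf mi; move: f mf; apply: alg_core_ind.
- by rewrite chi0 scale0r.
- by move=> k a b ha hb; rewrite chiZD pi_add pi_scale ha hb scalerDl scalerA.
- move=> [p|[j l]] gm a ag; first by rewrite (chi_Dop _ ag) ag /= Dop_eb.
  rewrite ag /= Eop_eb (_ : (_ == _ :> jidx) = false); last first.
    apply/eqP => -[il]; move: gm; rewrite mem_gens /= !mem_bidxs -il.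
    by rewrite [(i.1.2 < m)%N]ltnNge mi !andbF.
  by rewrite scale0r /chi ag /= Eop_eb /= scale0r inner0l scale0r.
Qed.

(** An element [f] of stage [m] multiplies the vector of the block with second index [m] by the
    value of [f] at [z k] or [w k]. Since [a] kills that vector, this value is as small as the
    distance from [a] to [f]. *)
Lemma block_sub k b : annihilator (block k) `<=` annihilator (atx (if b then z k else w k)).
Proof.
move=> a ha; apply/annihilator_atx; apply/(@nr_le0 R (R[i]^o)); apply/ler_addgt0Pl => e e0; rewrite addr0.
have [m [f [mf af]]] := core_approx a (divr_gt0 e0 (ltr0Sn R 1)).
pose i : bidx := ((k, m), b); set x := (X in chi X a).
have hf : nr (chi x f) <= e / 2.
  have := core_tail (i := i) mf (leqnn m); rewrite -[pt _]/x => fi.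
  apply: le_trans af; have := nr_pi (a - f) (eb (inl i)).
  by rewrite pi_sub fi ha /= ?eqxx// sub0r nrN nrZ nr_eb !mulr1.
rewrite -[chi x a](subrK (chi x f)); apply: (le_trans (nrD (V := R[i]^o) _ _)).
rewrite [e]splitr; apply: lerD => //.
by apply: le_trans af; rewrite -chiB; exact: nr_chi.
Qed.

Lemma prim_point (P : Prim A) : exists x, ideal_of P `<=` annihilator (atx x) /\
  (ideal_of P = annihilator (atx x) \/ exists2 k, ideal_of P = annihilator (block k) & x = z k).
Proof.
have [IE|] := pselect (forall i j d, blk i = blk j -> pi d = Eop (R := R) i j -> ideal_of P d).
  have [x Px] := primitive_atx (ideal_ofP P) IE.
  by exists x; split; [rewrite Px|left].
move=> /existsNP[i /existsNP[j /existsNP[d /not_implyP[ij /not_implyP[dE Pd]]]]].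
have Pk := primitive_block (ideal_ofP P) ij dE Pd.
exists (z (blk i)); split; last by right; exists (blk i).
by rewrite Pk; exact: (@block_sub _ true).
Qed.

(** For a block ideal the choice of [z k] over [w k] is arbitrary; it is the image under [q] that is
    canonical, and continuity is claimed for that image. *)
Definition prim_pt (P : Prim A) : cantor_sum := projT1 (cid (prim_point P)).

Lemma prim_pt_sub P : ideal_of P `<=` annihilator (atx (prim_pt P)).
Proof. by rewrite /prim_pt; case: cid => x []. Qed.

Lemma prim_ptP P : ideal_of P = annihilator (atx (prim_pt P)) \/
  exists2 k, ideal_of P = annihilator (block k) & prim_pt P = z k.
Proof. by rewrite /prim_pt; case: cid => x []. Qed.

Definition prim_at x : Prim A := projT1 (cid (prim_of_ideal (@atx_primitive R z w x))).
Lemma prim_atE x : ideal_of (prim_at x) = annihilator (atx x).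
Proof. by rewrite /prim_at; case: cid. Qed.

Definition prim_block k : Prim A := projT1 (cid (prim_of_ideal (@block_primitive R z w k))).
Lemma prim_blockE k : ideal_of (prim_block k) = annihilator (block k).
Proof. by rewrite /prim_block; case: cid. Qed.

Lemma small_cyl (U : set cantor_sum) x : open U -> U x ->
  exists p (d : A), [/\ pi d = Dop (R := R) z w p, cylb p x & forall y, cylb p y -> U y].
Proof.
move=> oU Ux; have [m mU] := cyl_base oU Ux.
have [xM Mx] := @deep_cyl x (maxn m (projT1 x).+1) (leq_maxr _ _).
have [d dD] := @ex_Dop R z w _ xM.
exists (projT1 x, pref (maxn m (projT1 x).+1) (projT2 x)), d; split=> // y /andP[/= /eqP e1 /eqP].
rewrite size_pref => e2; apply: mU; split=> //=; rewrite size_pref.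
exact: pref_le (leq_maxl _ _) e2.
Qed.

Lemma prim_pt_at x : prim_pt (prim_at x) = x.
Proof.
apply: contrapT => ne; have := prim_pt_sub (P := prim_at x); rewrite prim_atE.
set y := prim_pt _ => xy.
have [p [d [dD py pU]]] : exists p (d : A),
    [/\ pi d = Dop (R := R) z w p, cylb p y & forall y, cylb p y -> (~` [set x]) y].
  apply: small_cyl => //; apply/closed_openC.
  exact: (accessible_closed_set1 (hausdorff_accessible cantor_sum_hausdorff)).
have /annihilator_atx : annihilator (atx y) d.
  apply: xy; apply/annihilator_atx; rewrite (chi_Dop _ dD).
  by have [/pU|//] := boolP (cylb p x); case.
by rewrite (chi_Dop _ dD) py => /eqP; rewrite oner_eq0.
Qed.

Lemma prim_at_continuous : continuous prim_at.
Proof.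
apply/continuousP => U; rewrite prim_openE => oU.
rewrite openE => x Ux /=.
have [a ka Pa] : exists2 a, Defs.kernel (~` U) a & ~ ideal_of (prim_at x) a.
  apply: contrapT => na; apply: (oU (prim_at x)) Ux => a ka.
  by apply: contrapT => Pa; apply: na; exists a.
have xa : 0 < nr (chi x a : R[i]^o).
  rewrite lt0r nr_ge0 andbT; apply: contra_notN Pa => /eqP/nr_eq0 xa.
  by rewrite prim_atE; exact/annihilator_atx.
(* On stage [m], [chi] is constant over the cylinder of depth [m] around [x]. With error a third of
   [|chi x a|], the vanishing of [chi y a] would make [|chi x a|] at most two thirds of itself. *)
have [m [f [mf af]]] := core_approx a (divr_gt0 xa (ltr0Sn R 2)).
rewrite /interior nbhsE; exists (cyl (projT1 x, pref m (projT2 x))).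
  by split; [exact: cyl_open|exact: mem_cyl].
move=> y /cylbP xy /=; apply: contrapT => /ka; rewrite prim_atE => /annihilator_atx ya.
have xyf : chi y f = chi x f.
  move: f mf {af}; apply: alg_core_ind; first by rewrite !chi0.
    by move=> k b c hb hc; rewrite !chiZD hb hc.
  move=> [p|[i j]] gm b bg; last by rewrite /chi bg /= !Eop_eb /= !scale0r !inner0l.
  rewrite !(chi_Dop _ bg) (cylb_deep _ xy)//.
  by move: gm; rewrite mem_gens => /andP[_ /eqP ->].
have h1 : nr (chi x a - chi x f : R[i]^o) <= nr (chi x a : R[i]^o) / 3.
  by apply: le_trans af; rewrite -chiB; exact: nr_chi.
have h2 : nr (chi x f : R[i]^o) <= nr (chi x a : R[i]^o) / 3.
  apply: le_trans af; rewrite -xyf -[chi y f]opprK -[- chi y f]sub0r -ya -chiB.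
  by rewrite (nrN (_ : R[i]^o)); exact: nr_chi.
have := nrD (V := R[i]^o) (chi x a - chi x f) (chi x f); rewrite subrK => h3.
have := le_trans h3 (lerD h1 h2); move: (nr _) xa => u u0 {h1 h2 h3} h.
by move: h; rewrite leNgt => /negP; apply; rewrite -mulrDl; lra.
Qed.

Lemma prim_pt_continuous : continuous (q \o prim_pt).
Proof.
apply/continuousP => U oU; rewrite prim_openE => P kP UP.
have [p [d [dD px pU]]] : exists p (d : A),
    [/\ pi d = Dop (R := R) z w p, cylb p (prim_pt P) & forall y, cylb p y -> (q @^-1` U) y].
  by apply: small_cyl => //; exact/hq.2.
have /annihilator_atx : annihilator (atx (prim_pt P)) d.
  apply: prim_pt_sub; apply: kP => Q UQ.
  (* In the block case [d] has to kill the vectors over both [z k] and [w k]; by [qzw] both points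
     have the same image as [prim_pt Q], which is outside [U]. *)
  have nU y : q y = q (prim_pt Q) -> ~~ cylb p y.
    by move=> yQ; apply/negP => /pU; rewrite /= yQ.
  have [->|[k -> Qk]] := prim_ptP Q.
    by apply/annihilator_atx; rewrite (chi_Dop _ dD) (negbTE (nU _ _)).
  move=> [i|//] /eqP ik; rewrite dD Dop_eb (negbTE (nU _ _)) ?scale0r//=.
  by rewrite Qk ik; case: ifP => // _; rewrite qzw.
by rewrite (chi_Dop _ dD) px => /eqP; rewrite oner_eq0.
Qed.

(** For a pair [z k], [w k] both values equal the value at the block ideal, which is contained in
    both evaluation ideals. Density of these pairs and the Hausdorff property of the target extend
    this to all pairs identified by [q]. *)
Lemma Cb_pairs (f : Prim A -> R[i]^o) x y : continuous f -> q x = q y ->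
  f (prim_at x) = f (prim_at y).
Proof.
move=> cf xy; have hC := @norm_hausdorff _ (R[i]^o).
have cg : continuous (f \o prim_at).
  by move=> u; apply: continuous_comp; [exact: prim_at_continuous|exact: cf].
have fzw k : f (prim_at (z k)) = f (prim_at (w k)).
  transitivity (f (prim_block k)).
    by apply/esym/prim_sub_eq => //; rewrite prim_blockE prim_atE; exact: (@block_sub k true).
  by apply: prim_sub_eq => //; rewrite prim_blockE prim_atE; exact: (@block_sub k false).
apply: hC => U V; rewrite !nbhsE => -[U' [oU' U'x] U'U] [V' [oV' V'y] V'V].
have [m mU] := cyl_base (open_comp (fun u _ => cg u) oU') U'x.
have [n nV] := cyl_base (open_comp (fun u _ => cg u) oV') V'y.
have [k [kx ky]] := zw_dense xy (mem_cyl x m) (mem_cyl y n).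
exists (f (prim_at (z k))); split; first by apply: U'U; exact: (mU _ kx).
by rewrite fzw; apply: V'V; exact: (nV _ ky).
Qed.

Lemma Alg_glimm : homeomorphic X (Glimm A).
Proof.
have [|f [cf _]|F [G [FG GF cF cG _]]] := glimm_homeo hX tX prim_pt_continuous.
- move=> x; have [y yx] := hq.1 x; exists (prim_at y).
  by rewrite /= prim_pt_at.
- have /choice[s sP] x := hq.1 x.
  exists (fun x => f (prim_at (s x))).
    apply/continuousP => U oU; apply/hq.2.
    have -> : q @^-1` ((fun x => f (prim_at (s x))) @^-1` U) = (f \o prim_at) @^-1` U.
      by apply/seteqP; split=> y /=; rewrite (Cb_pairs cf (sP (q y))).
    apply: open_comp => // y _.
    by apply: continuous_comp; [exact: prim_at_continuous|exact: cf].
  move=> P /=; rewrite (Cb_pairs cf (sP (q (prim_pt P)))).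
  by apply: prim_sub_eq => //; rewrite prim_atE; exact: prim_pt_sub.
- by exists G, F; split.
Qed.

End GlimmSpace.

(** * Conclusion *)

Lemma AF_separable (R : realType) (A : cstarAlgType R) : is_AF A -> cstar_separable A.
Proof.
move=> [B [Bfd _ Bdense]].
have /choice[Ne NeP] n : exists Ne : {N : nat & 'I_N -> A}, B n = lspan (projT2 Ne).
  by have [_ [N [e ->]]] := Bfd n; exists (existT _ N e).
pose rc (p : rat * rat) : R[i] := ratr p.1 +i* ratr p.2.
pose D (ns : nat * seq (rat * rat)) : A :=
  \sum_(i < projT1 (Ne ns.1)) rc (nth (0, 0) ns.2 i) *: projT2 (Ne ns.1) i.
exists (range D); split.
  by apply: (card_le_trans (card_image_le _ _)); exact: countableP.
move=> U [x Ux] oU; have /nbhs_nr[e e0 eU] : nbhs x U by exact: open_nbhs_nbhs.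
have e20 : 0 < e / 2 by rewrite divr_gt0.
have : closure (\bigcup_n B n) x by rewrite Bdense.
move=> /closure_nr/(_ _ e20)[y [n _]]; rewrite NeP => -[c ->] xy.
set v := projT2 (Ne n) in xy *; pose M := \sum_i nr (v i).
have M0 : 0 <= M by apply: sumr_ge0 => i _; exact: nr_ge0.
have M1 : 0 < M + 1 by rewrite ltr_wpDl.
have /choice[p hp] i := complex_dense (c i) (divr_gt0 e20 M1).
pose s := codom p.
have ps (i : 'I_(projT1 (Ne n))) : nth (0, 0) s i = p i.
  by rewrite /s codomE (nth_map i) ?size_enum_ord// nth_ord_enum.
exists (D (n, s)); split; last by exists (n, s).
apply: eU; apply: (le_trans (nr_tri (\sum_i c i *: v i) _ _)).
rewrite [e]splitr lerD//.
rewrite /D /= -/v -sumrB.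
have nr_sum (F : 'I_(projT1 (Ne n)) -> A) : nr (\sum_i F i) <= \sum_i nr (F i).
  elim/big_ind2: _ => [|a b a' b' h h'|//]; first by rewrite nr0.
  by rewrite (le_trans (nrD _ _))// lerD.
apply: (le_trans (nr_sum _)); apply: (@le_trans _ _ (\sum_i e / 2 / (M + 1) * nr (v i))).
  by apply: ler_sum => i _; rewrite -scalerBl nrZ ps ler_wpM2r ?nr_ge0// hp.
rewrite -mulr_sumr mulrAC ler_pdivrMr// ler_wpM2l ?lerDl//.
exact: ltW.
Qed.

(** The empty space is no quotient of the nonempty [cantor_sum]. It is realised by the zero algebra,
    which has no primitive ideal because primitive ideals are proper. *)
Lemma AF_glimm_empty (R : realType) (X : topologicalType) : (X -> False) ->
  exists A : cstarAlgType R, is_AF A /\ homeomorphic X (Glimm A).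
Proof.
move=> X0; pose G (g : void) (h : l2 R void) := h; pose l (m : nat) : seq void := [::].
have gS m g : g \in l m -> gspan G l m.+1 (G g) by [].
have gM m g h : g \in l m -> h \in l m -> gspan G l m (G g \o G h) by [].
have gA m g : g \in l m -> exists2 T, gspan G l m T & adjoint (inner_adj_form (l2 R void)) (G g) T by [].
have gL g k x y : G g (k *: x + y) = k *: G g x + G g y by [].
have gC g : exists2 C, 0 <= C & op_bounded (G g) C by case: g.
exists (opalg (lim_core gS gM gA gL gC)); split; first exact: lim_AF.
set A := opalg _.
have A0 (a : A) : a = 0.
  apply: op_eq => x; apply: nr_eq => e e0.
  have c0 : 0 < nr x + 1 by rewrite ltr_wpDl ?nr_ge0.
  have [f [m _ [c fE]] af] := op_valP a (divr_gt0 e0 c0).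
  have f0 : f x = 0 by rewrite fE big_ord0.
  have := af x; rewrite f0 => /le_trans; apply.
  by rewrite mulrAC ler_pdivrMr// ler_wpM2l ?lerDl// ltW.
have P0 (P : Prim A) : False.
  have /eqP := primitive_ideal_proper (ideal_ofP P); apply; apply/seteqP; split=> // a _.
  by rewrite (A0 a); exact: primitive_ideal0 (ideal_ofP P).
exists (fun x => False_rect _ (X0 x)), (fun x => False_rect _ (P0 (glimm_repr x))).
split.
- by move=> x; case: (X0 x).
- by move=> x; case: (P0 (glimm_repr x)).
- by move=> x; case: (X0 x).
- by move=> x; case: (P0 (glimm_repr x)).
Qed.

Lemma dense_pairs (X : Type) (q : cantor_sum -> X) (x0 : cantor_sum) :
  exists z w : nat -> cantor_sum, (forall k, q (z k) = q (w k)) /\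
    forall x y p r, q x = q y -> cyl p x -> cyl r y ->
      exists k, cyl p (z k) /\ cyl r (w k).
Proof.
pose E p r (u : cantor_sum * cantor_sum) := [/\ q u.1 = q u.2, cyl p u.1 & cyl r u.2].
have /choice[c cP] pr : exists u : cantor_sum * cantor_sum, q u.1 = q u.2 /\
    ((exists u', E pr.1 pr.2 u') -> E pr.1 pr.2 u).
  have [[u Eu]|nE] := pselect (exists u', E pr.1 pr.2 u').
    by exists u; split=> //; case: Eu.
  (* The default still has to satisfy [q u.1 = q u.2], which is claimed for every index. *)
  by exists (x0, x0).
pose s k := if unpickle k is Some pr then c pr else (x0, x0).
exists (fun k => (s k).1), (fun k => (s k).2); split.
  by move=> k; rewrite /s; case: (unpickle k) => //= pr; exact: (cP pr).1.
move=> x y p r xy px ry; exists (pickle (p, r)); rewrite /s pickleK.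
by have [|_ ? ?] := (cP (p, r)).2; first by exists (x, y).
Qed.

Lemma komega_AF (R : realType) (X : topologicalType) (K : nat -> set X) :
  hausdorff_space X -> komega R K ->
  exists A : cstarAlgType R, is_AF A /\ homeomorphic X (Glimm A).
Proof.
move=> hX hK; have [[x0 _]|nX] := pselect (exists x : X, True); last first.
  by apply: AF_glimm_empty => x; apply: nX; exists x.
have [q hq] := komega_cantor x0 hX hK.
have [c0 _] := hq.1 x0; have [z [w [qzw dzw]]] := dense_pairs q c0.
exists (Alg R z w); split; first exact: Alg_AF.
apply: (Alg_glimm hX _ hq qzw dzw) => x F.
have [KT Kinc Kcm Kcl] := hK.
apply: (komega_tychonoff R hX KT Kinc) => [n|E]; first by case: (Kcm n).
by move/Kcl.
Qed.

Lemma homeomorphic_refl (X : topologicalType) : homeomorphic X X.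
Proof. by exists id, id; split=> // x; exact: cvg_id. Qed.

Unset Implicit Arguments.
Local Close Scope complex_scope.

Theorem theorem2 (R : realType) (X : topologicalType)
    (hX : hausdorff_space X) :
  let i := exists A : cstarAlgType R,
    is_AF A /\ homeomorphic X (Glimm A) in
  let ii := exists A : cstarAlgType R,
    cstar_separable A /\ homeomorphic X (Glimm A) in
  let iii := exists (Z Y : topologicalType) (q : Z -> Y),
    [/\ locally_compact [set: Z], hausdorff_space Z, @second_countable Z,
        quotient_map q & homeomorphic X Y] in
  let iv := exists K : nat -> set X,
    [/\ \bigcup_n K n = setT,
        forall n, K n `<=` K n.+1,
        forall n, compact (K n) /\ metrizable R (set_type (K n)) &
        forall F : set X, closed F <-> forall n, closed (F `&` K n)] in
  [/\ i <-> ii, ii <-> iii & iii <-> iv].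
Proof.
move=> i ii iii iv.
have i_ii : i -> ii by move=> [A [/AF_separable sA XA]]; exists A.
have ii_iv : ii -> iv by move=> [A [sA XA]]; exact (separable_glimm_quotient sA hX XA).
have iv_i : iv -> i by move=> [K hK]; exact: komega_AF hX hK.
have iv_iii : iv -> iii.
  move=> [K hK]; have [[x0 _]|nX] := pselect (exists x : X, True).
    have [q hq] := komega_cantor x0 hX hK; exists cantor_sum, X, q; split=> //.
    - exact: cantor_sum_locally_compact.
    - exact: cantor_sum_hausdorff.
    - exact: cantor_sum_second_countable.
    - exact: homeomorphic_refl.
  have X0 (x : X) : False by apply: nX; exists x.
  exists X, X, id; split.
  - by move=> x; case: (X0 x).
  - by move=> x; case: (X0 x).
  - exists set0; first exact: countable0.
    by split=> [U []|x]; case: (X0 x).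
  - by split=> // x; exists x.
  - exact: homeomorphic_refl.
have iii_iv : iii -> iv.
  move=> [Z [Y [q [lcZ hZ sZ hq [f [g [fg gf cf cg]]]]]]].
  have [K [W KW]] := lc2_second_countable lcZ hZ sZ.
  exact (quotient_komega R KW (quotient_map_homeo hq gf fg cg cf) hX).
split; split; try tauto.
Qed.
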